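(* Let $a>1$ and let $X$ be the algebraic curve defined by $w^2=z(z^2-1)(z^2-a^2)$. Set $f(z)=z(z^2-1)(z^2-a^2)$ and $$p=\int_1^a\frac{dz}{\sqrt{|f(z)|}},\quad q=\int_0^1\frac{dz}{\sqrt{|f(z)|}},\quad r=-\int_1^a\frac{z\,dz}{\sqrt{|f(z)|}},\quad s=\int_0^1\frac{z\,dz}{\sqrt{|f(z)|}}.$$ Then the period matrix of $X$ for the symplectic basis $\{\alpha_1,\alpha_2,\gamma_1,\gamma_2\}$ described in the context is $$\Pi=\frac{i}{ps-qr}\begin{bmatrix} 2qs-pr & pr \\ pr & -2pr \end{bmatrix}.$$
   Context: The algebraic curve means the compact Riemann surface of genus $2$ of the affine curve $w^2=f(z)$. A basis $\{\alpha_1,\alpha_2,\gamma_1,\gamma_2\}$ of $H_1(X,\mathbb{Z})$ is symplectic if the intersection numbers satisfy $i(\alpha_j,\alpha_k)=i(\gamma_j,\gamma_k)=0$, $i(\alpha_j,\gamma_k)=\delta_{j,k}$. For a basis $\omega_1,\omega_2$ of holomorphic $1$-forms put $A=[\int_{\alpha_k}\omega_j]_{j,k}$, $C=[\int_{\gamma_k}\omega_j]_{j,k}$ (row index $j$, column index $k$); the period matrix is $\Pi=A^{-1}C$, independent of the choice of $\omega_j$. Polygon. Let $P_0$ be a closed square and $P_1$ a closed rectangle in $\mathbb{C}$ with horizontal and vertical sides, where $P_1$ has the same height as $P_0$ and is adjacent to $P_0$ on its right along a full common vertical side. Let $Q_1$ be the image of $P_1$ under the reflection about the line through the upper left and lower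 right vertices of $P_0$ (so $Q_1$ lies below $P_0$ along a full common horizontal side). In the L-shaped polygon $P_0\cup P_1\cup Q_1$ glue by translation: the left side of $P_0$ to the right side of $P_1$; the left side of $Q_1$ to the right side of $Q_1$; the bottom side of $Q_1$ to the top side of $P_0$; the bottom side of $P_1$ to the top side of $P_1$. The result is a compact Riemann surface of genus $2$ with holomorphic $1$-form $d\zeta$, $\zeta$ the coordinate of the plane of the polygon. The rectangles can be, and are, chosen so that this surface is biholomorphic to $X$, with the centers of $P_0,P_1,Q_1$ corresponding to $(0,0),(1,0),(-1,0)$, the midpoint of the upper side of $P_1$ to $(a,0)$, the midpoint of the left side of $Q_1$ to $(-a,0)$, and $d\zeta=c\,\frac{dz}{w}$ with $c>0$. Basis. $\alpha_1$ (resp. $\alpha_2$) is the horizontal closed curve, oriented from left to right, through the center of $Q_1$ (resp. through the centers of $P_0$ and $P_1$). $\beta_1$ (resp. $\beta_2$) is the vertical closed curve, oriented upward, through the centers of $Q_1$ and $P_0$ (resp. through the center of $P_1$). Then $\gamma_1=\beta_1-\beta_2$ and $\gamma_2=\beta_2$ in $H_1(X,\mathbb{Z})$. *)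

(* Defs.v *)
From HB Require Import structures.
From mathcomp Require Import all_boot all_order all_algebra.
From mathcomp Require Import all_classical all_reals all_analysis.
From mathcomp Require Import complex ring lra.
From Stdlib Require Import Relation_Operators.

Set Implicit Arguments.
Unset Strict Implicit.
Unset Printing Implicit Defensive.

Import Order.TTheory GRing.Theory Num.Theory.
Import numFieldNormedType.Exports.

Local Open Scope classical_set_scope.
Local Open Scope ring_scope.

(* R[i] itself carries no topology in the libraries; as a numClosedFieldType
   it gets the one of its norm. *)
Definition cplx (R : realType) : numClosedFieldType := R[i].

Definition cpx (R : realType) (x y : R) : cplx R := Complex x y.
Definition re (R : realType) (z : cplx R) : R := complex.Re z.
Definition im (R : realType) (z : cplx R) : R := complex.Im z.
Definition rc (R : realType) (x : R) : cplx R := cpx x 0.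
Definition iC (R : realType) : cplx R := cpx 0 1.

Section RiemannSurface.
Context {R : realType}.
Local Notation C := (cplx R).

(* The holomorphic structure of a Riemann surface T is given by a family of
   local coordinates: [coord i] is defined on the open set [dom i], the domains
   cover T, and each point of [dom i] has a neighborhood on which [coord i] is a
   homeomorphism onto an open subset of the plane; the changes of coordinates
   are holomorphic.  These properties are not bundled: they hold for the two
   surfaces defined below. *)
Record coords (T : Type) := Coords {
  loc : Type;
  dom : loc -> set T;
  coord : loc -> T -> C }.

(* dg/dx = d at p, where x is a local coordinate at p: the limit of
   (g q - g p) / (x q - x p) is the complex derivative of g \o x^-1 at x p. *)
Definition has_deriv (T : topologicalType) (x g : T -> C) (p : T) (d : C) :=
  (fun q => (g q - g p) / (x q - x p)) @ p^' --> d.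

(* A 1-form is given by its coefficient in each local coordinate:
   it is [omega i p * d(coord i)] at p. *)
Definition form (T : Type) (A : coords T) := loc A -> T -> C.

Definition form_eq (T : Type) (A : coords T) (omega eta : form A) :=
  forall i p, dom i p -> omega i p = eta i p.

Definition holomorphic_form (T : topologicalType) (A : coords T)
    (omega : form A) :=
  (forall i p, dom i p -> exists d, has_deriv (coord i) (omega i) p d) /\
  (forall i j p, dom i p -> dom j p ->
    exists2 d, has_deriv (coord i) (coord j) p d &
               omega i p = omega j p * d).

Definition holomorphic_map (S T : topologicalType) (A : coords S)
    (B : coords T) (F : S -> T) :=
  continuous F /\
  (forall (i : loc A) (j : loc B) p, dom i p -> dom j (F p) ->
    exists d, has_deriv (coord i) (coord j \o F) p d).

Definition biholomorphic (S T : topologicalType) (A : coords S) (B : coords T)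
    (F : S -> T) :=
  exists G, [/\ cancel F G, cancel G F, holomorphic_map A B F &
                holomorphic_map B A G].

Definition is_pullback (S T : topologicalType) (A : coords S) (B : coords T)
    (F : S -> T) (omega : form B) (eta : form A) :=
  forall (i : loc A) (j : loc B) p, dom i p -> dom j (F p) ->
    exists2 d, has_deriv (coord i) (coord j \o F) p d &
               eta i p = omega j (F p) * d.

Definition holomorphic_basis (T : topologicalType) (A : coords T) (g : nat)
    (omega : 'I_g -> form A) :=
  [/\ forall k, holomorphic_form (omega k),
      forall b : 'I_g -> C,
        form_eq (fun i p => \sum_k b k * omega k i p) (fun _ _ => 0) ->
        forall k, b k = 0 &
      forall eta : form A, holomorphic_form eta ->
        exists b : 'I_g -> C,
          form_eq eta (fun i p => \sum_k b k * omega k i p)].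

Definition velocity (g : R -> C) (t : R) : C :=
  cpx (derive1 (fun s => re (g s)) t) (derive1 (fun s => im (g s)) t).

(* The value of omega on the velocity of c at time t, computed in any local
   coordinate around c t (they all give the same value when omega is a 1-form
   and c is differentiable at t). *)
Definition form_on_path (T : Type) (A : coords T) (omega : form A)
    (c : R -> T) (t : R) : C :=
  xget 0 [set v | exists2 i, dom i (c t) &
                  v = omega i (c t) * velocity (coord i \o c) t].

Definition path_integral (T : Type) (A : coords T) (omega : form A)
    (c : R -> T) : C :=
  cpx (\int[lebesgue_measure]_(t in `[0, 1]) re (form_on_path omega c t))
      (\int[lebesgue_measure]_(t in `[0, 1]) im (form_on_path omega c t)).

(* Homology classes are represented by integral combinations of closed curves,
   themselves parametrized by [0, 1]. *)
Definition one_cycle (T : Type) := seq (int * (R -> T)).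

Definition cycle_image (S T : Type) (F : S -> T) (sigma : one_cycle S) :
    one_cycle T :=
  [seq (x.1, F \o x.2) | x <- sigma].

Definition cycle_integral (T : Type) (A : coords T) (omega : form A)
    (sigma : one_cycle T) : C :=
  \sum_(x <- sigma) x.1%:~R * path_integral omega x.2.

Definition periods (T : Type) (A : coords T) (g : nat)
    (omega : 'I_g -> form A) (sigma : 'I_g -> one_cycle T) : 'M[C]_g :=
  \matrix_(j, k) cycle_integral (omega j) (sigma k).

Definition is_period_matrix (T : topologicalType) (A : coords T) (g : nat)
    (alpha gamma : 'I_g -> one_cycle T) (Pi : 'M[C]_g) :=
  forall omega : 'I_g -> form A, holomorphic_basis omega ->
    periods omega alpha \in unitmx /\
    Pi = invmx (periods omega alpha) *m periods omega gamma.

End RiemannSurface.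

Definition fpoly (K : comNzRingType) (b : K) : {poly K} :=
  'X * ('X^2 - 1) * ('X^2 - (b ^+ 2)%:P).

Section Curve.
Context {R : realType} (a : R).
Local Notation C := (cplx R).

Definition affine_curve : set (C * C) :=
  [set u | u.2 ^+ 2 = (fpoly (rc a)).[u.1]].

(* The degree of f is odd: there is a single point None at infinity. *)
Definition curve := one_point_compactification affine_curve.
HB.instance Definition _ := Topological.on curve.

(* 0 at infinity is a dummy value *)
Definition zc (p : curve) : C := if p is Some u then (set_val u).1 else 0.
Definition wc (p : curve) : C := if p is Some u then (set_val u).2 else 0.

(* z has a double pole and w a pole of order 5 at infinity, so z ^ 2 / w is a
   local coordinate there, with value 0. *)
Definition tc (p : curve) : C := if p is Some _ then zc p ^+ 2 / wc p else 0.

Variant curve_loc := Zloc | Wloc | Tloc.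

(* From 2 w dw = f'(z) dz one gets
   dt = z (4 f(z) - z f'(z)) / (2 w ^ 3) dz for t = z ^ 2 / w. *)
Definition curve_dom (i : curve_loc) : set curve :=
  let f := fpoly (rc a) in
  match i with
  | Zloc => [set p | p <> None /\ wc p <> 0]
  | Wloc => [set p | p <> None /\ f^`().[zc p] <> 0]
  | Tloc => [set p | p <> None ->
               wc p <> 0 /\ 4 * f.[zc p] - zc p * f^`().[zc p] <> 0]
  end.

Definition curve_coord (i : curve_loc) : curve -> C :=
  match i with Zloc => zc | Wloc => wc | Tloc => tc end.

Definition curve_atlas : coords curve := Coords curve_dom curve_coord.

Definition affine_point (p : curve) (z w : C) :=
  exists2 u : affine_curve, p = Some u & set_val u = (z, w).

Definition is_dz_over_w (omega : form curve_atlas) :=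
  holomorphic_form omega /\
  forall p, curve_dom Zloc p -> omega Zloc p = (wc p)^-1.

End Curve.

(* P0 is the square with lower left corner (corner_x, corner_y) and the given
   side, P1 has the given width. *)
Record Lshape (R : realType) := MkLshape {
  corner_x : R;
  corner_y : R;
  side : {posnum R};
  width : {posnum R} }.

Section Polygon.
Context {R : realType} (L : Lshape R).
Local Notation C := (cplx R).
Local Notation h := ((side L)%:num).
Local Notation l := ((width L)%:num).

Definition at_xy (x y : R) : C := cpx (corner_x L + x) (corner_y L + y).

Definition rectangle (x1 x2 y1 y2 : R) : set C :=
  [set zeta | exists x y,
     [/\ x1 <= x <= x2, y1 <= y <= y2 & zeta = at_xy x y]].

Definition P0 : set C := rectangle 0 h 0 h.
Definition P1 : set C := rectangle h (h + l) 0 h.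

(* In coordinates centered at the center of P0, the reflection about the line
   through the upper left and lower right vertices of P0 is
   (u, v) |-> (- v, - u). *)
Definition reflection (zeta : C) : C :=
  let m := at_xy (h / 2) (h / 2) in
  cpx (re m - (im zeta - im m)) (im m - (re zeta - re m)).
Definition Q1 : set C := reflection @` P1.

Lemma Q1E : Q1 = rectangle 0 h (- l) 0.
Proof.
apply/seteqP; split => [_ [_ [x [y [xP yP ->]]] <-]|_ [x [y [xP yP ->]]]].
  exists (h - y), (h - x); split; rewrite /at_xy /reflection/= /re /im/=.
  - by lra.
  - by lra.
  - by rewrite /cpx; congr Complex; field.
exists (at_xy (h - y) (h - x)).
  by exists (h - y), (h - x); split => //; lra.
by rewrite /reflection /at_xy /re /im /cpx /=; congr Complex; field.
Qed.

Definition polygon : set C := P0 `|` P1 `|` Q1.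

Definition side_pair (zeta zeta' : C) :=
  [\/ exists2 y, 0 <= y <= h &
        zeta = at_xy 0 y /\ zeta' = at_xy (h + l) y,
      exists2 y, - l <= y <= 0 &
        zeta = at_xy 0 y /\ zeta' = at_xy h y,
      exists2 x, 0 <= x <= h &
        zeta = at_xy x (- l) /\ zeta' = at_xy x h |
      exists2 x, h <= x <= h + l &
        zeta = at_xy x 0 /\ zeta' = at_xy x h].

Definition glued : rel polygon := fun u v =>
  `[< clos_refl_sym_trans polygon
        (fun u v => side_pair (set_val u) (set_val v)) u v >].

Lemma glued_refl : reflexive glued.
Proof. by move=> u; apply/asboolP; exact: rst_refl. Qed.

Lemma glued_sym : symmetric glued.
Proof. by move=> u v; apply/asboolP/asboolP; exact: rst_sym. Qed.

Lemma glued_trans : transitive glued.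
Proof.
by move=> v u x /asboolP uv /asboolP vx; apply/asboolP; exact: rst_trans uv vx.
Qed.

Canonical glued_equiv := EquivRel glued glued_refl glued_sym glued_trans.

Definition surface := quotient_topology {eq_quot glued}%qT.
HB.instance Definition _ := Topological.on surface.

Definition glue (u : polygon) : surface := \pi_surface%qT u.

Lemma corner_in_polygon : at_xy 0 0 \in polygon.
Proof.
by apply/mem_set; left; left; exists 0, 0; split => //; rewrite lexx /= ltW.
Qed.

(* The point of the surface at position (x, y) from the lower left vertex of
   P0, for (x, y) in the polygon. *)
Definition pt (x y : R) : surface :=
  glue (insubd (SigSub corner_in_polygon : polygon) (at_xy x y)).

(* The coordinates of the surface are the injective continuous functions x on
   open sets such that x ^ n is locally a primitive of d zeta.  One has n = 1
   away from the image of the vertices.  The eight vertices of the gluing are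
   identified to one point with total angle 6 pi, where n = 3. *)
Record surface_loc := SurfaceLoc {
  exponent : nat;
  sdom : set surface;
  scoord : surface -> C;
  exponentP : exponent = 1%N \/ exponent = 3%N;
  sdom_open : open sdom;
  scoord_inj : {in sdom &, injective scoord};
  scoord_continuous : {in sdom, continuous scoord};
  scoordP : forall u : polygon, sdom (glue u) ->
    \forall v \near u, scoord (glue v) ^+ exponent - scoord (glue u) ^+ exponent
                       = set_val v - set_val u }.

Definition surface_atlas : coords surface := Coords sdom scoord.

Definition dzeta : form surface_atlas := fun i p =>
  (exponent i)%:R * scoord i p ^+ (exponent i).-1.

Definition alpha1 (t : R) : surface := pt (t * h) (- l / 2).
Definition alpha2 (t : R) : surface := pt (t * (h + l)) (h / 2).
Definition beta1 (t : R) : surface := pt (h / 2) (t * (h + l) - l).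
Definition beta2 (t : R) : surface := pt (h + l / 2) (t * h).

Definition alpha : 'I_2 -> @one_cycle R surface :=
  tnth [tuple [:: (1, alpha1)]; [:: (1, alpha2)]].
Definition gamma : 'I_2 -> @one_cycle R surface :=
  tnth [tuple [:: (1, beta1); (-1, beta2)]; [:: (1, beta2)]].

Record uniformization (a c : R) (phi : surface -> curve a) : Prop := {
  phi_biholomorphic : biholomorphic surface_atlas (curve_atlas a) phi;
  center_P0 : affine_point (phi (pt (h / 2) (h / 2))) 0 0;
  center_P1 : affine_point (phi (pt (h + l / 2) (h / 2))) 1 0;
  center_Q1 : affine_point (phi (pt (h / 2) (- l / 2))) (-1) 0;
  upper_P1 : affine_point (phi (pt (h + l / 2) h)) (rc a) 0;
  left_Q1 : affine_point (phi (pt 0 (- l / 2))) (- rc a) 0;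
  c_gt0 : 0 < c;
  dzetaE : exists2 omega, @is_dz_over_w R a omega &
    is_pullback phi (fun i p => rc c * omega i p) dzeta }.

End Polygon.

Definition mx22 (K : Type) (x y z t : K) : 'M[K]_2 :=
  \matrix_(j, k) if j == 0 then (if k == 0 then x else y)
                 else (if k == 0 then z else t).

(* Main.v *)
Require Import Defs.
From HB Require Import structures.
From mathcomp Require Import all_boot all_order all_algebra.
From mathcomp Require Import all_classical all_reals all_analysis.
From mathcomp Require Import measurable_realfun complex ring lra.
Import Order.TTheory GRing.Theory Num.Theory.
Import numFieldNormedType.Exports.
Local Open Scope classical_set_scope.
Local Open Scope ring_scope.
Set Implicit Arguments.
Unset Strict Implicit.
Unset Printing Implicit Defensive.

(** Pulled back to the polygon, c dz/w is d zeta.  Along a straight path of the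
    polygon with constant velocity v this says that the point (z, w) of the
    curve moves by z' = k w, w' = k f'(z) / 2 with k = v / c
    ([path_velocity], [path_ode]).  The point at infinity is never met inside
    the polygon, because the coefficient of dz/w vanishes there while d zeta
    has no zero ([omega_infinity], [path_finite]).

    Trajectories of this equation are determined by one of their points
    ([flow_unique], by Gronwall's inequality), so they inherit its symmetries.
    Each of the curves alpha_1, alpha_2, beta_1, beta_2 goes through two of the
    points whose images are prescribed, which are branch points (u0, 0) and
    (u1, 0) with u0 < u1 real.  Complex conjugation fixes the trajectory, hence
    z is real ([flow_real]); the hyperelliptic involution reverses it, hence z
    is even about the times at which it meets a branch point ([flow_even]).
    Between these two times the injectivity of the uniformization forbids z to
    come back to u0 or u1, so that z increases from u0 to u1 and
    dx / sqrt |f x| = |k| dt there ([quarter_period]).  By evenness this part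
    is half of the closed curve, and the periods of dz/w and z dz/w are, up to
    the factor i of the vertical curves, twice the integrals of
    dx / sqrt |f x| and x dx / sqrt |f x| from u0 to u1 ([path_periods]).
    For the four curves (u0, u1) is (-a, -1), (0, 1), (-1, 0), (1, a), so that
    dz/w and z dz/w have the matrices
<<
      A = [2p 2q]     C = i [2(q - p)   2p]
          [2r 2s]           [2(r - s)  -2r]
>>
    An arbitrary basis of holomorphic forms is obtained from these two by an
    invertible matrix, because z dz/w is holomorphic and not proportional to
    dz/w ([z_form_holomorphic], [basis_change]); this matrix cancels in A^-1 C.

    The inverse of A gives
<<
      (ps - qr) Pi = i [2qs - ps - qr    ps + qr]
                       [2pr - ps - qr    -2pr   ]
>>
    so the stated form of Pi amounts to its symmetry ps + qr = pr.  Here this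
    bilinear relation is proved by substitutions in real integrals.  The
    involution x -> a / x of [1, a] gives r = - sqrt a p ([integral_xg]).  The
    two lifts of z -> a / z to the curve have elliptic quotients, on which
    z / (z^2 + a) is a coordinate; a Moebius map between them gives
    s = sqrt a (q - p) ([riemann_relation]).  These two equalities also show
    that ps - qr = sqrt a p (2q - p) is positive. *)

(** * The complex plane *)

Section ComplexPlane.
Context {R : realType}.
Local Notation C := (cplx R).
Implicit Types z w : C.

Lemma cpxE z : z = cpx (re z) (im z). Proof. by case: z. Qed.

Lemma norm_cplx z : `|z| = rc (Num.sqrt (re z ^+ 2 + im z ^+ 2)).
Proof. by case: z => x y; rewrite /re /im /= normc_def. Qed.

Lemma rc_norm (x : R) : `|rc x : C| = rc `|x|.
Proof. by rewrite norm_cplx /re /im /= expr0n /= addr0 sqrtr_sqr. Qed.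

Lemma rc_lt (x y : R) : (rc x < rc y :> C) = (x < y).
Proof. by rewrite /rc /cpx ltcE /= eqxx. Qed.
Lemma rc_le (x y : R) : (rc x <= rc y :> C) = (x <= y).
Proof. by rewrite /rc /cpx lecE /= eqxx. Qed.

Lemma rcD (x y : R) : rc (x + y) = rc x + rc y :> C.
Proof. exact: (rmorphD (real_complex R)). Qed.
Lemma rcB (x y : R) : rc (x - y) = rc x - rc y :> C.
Proof. exact: (rmorphB (real_complex R)). Qed.
Lemma rcN (x : R) : rc (- x) = - rc x :> C.
Proof. exact: (rmorphN (real_complex R)). Qed.
Lemma rcM (x y : R) : rc (x * y) = rc x * rc y :> C.
Proof. exact: (rmorphM (real_complex R)). Qed.
Lemma rcV (x : R) : rc x^-1 = (rc x)^-1 :> C.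
Proof. exact: (fmorphV (real_complex R)). Qed.
Lemma rc0 : rc 0 = 0 :> C. Proof. by []. Qed.
Lemma rc1 : rc 1 = 1 :> C. Proof. by []. Qed.
Lemma rcX (x : R) n : rc (x ^+ n) = rc x ^+ n :> C.
Proof. exact: (rmorphXn (real_complex R)). Qed.
Lemma rc_eq0 (x : R) : (rc x == 0 :> C) = (x == 0).
Proof. by rewrite /rc /cpx eq_complex /= eqxx andbT. Qed.
Lemma rc_inj : injective (@rc R). Proof. by move=> x y [] . Qed.

Lemma cpx_rc (x y : R) : cpx x y = rc x + iC R * rc y.
Proof. by rewrite /cpx /rc /iC; apply/eqP; rewrite eq_complex /=; apply/andP; split; apply/eqP; ring. Qed.

Lemma iC2 : iC R * iC R = -1.
Proof. by apply/eqP; rewrite eq_complex /=; apply/andP; split; apply/eqP; ring. Qed.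

Lemma reD z w : re (z + w) = re z + re w. Proof. by case: z w => ? ? []. Qed.
Lemma imD z w : im (z + w) = im z + im w. Proof. by case: z w => ? ? []. Qed.
Lemma reN z : re (- z) = - re z. Proof. by case: z. Qed.
Lemma imN z : im (- z) = - im z. Proof. by case: z. Qed.
Lemma reB z w : re (z - w) = re z - re w. Proof. by rewrite reD reN. Qed.
Lemma imB z w : im (z - w) = im z - im w. Proof. by rewrite imD imN. Qed.
Lemma reM z w : re (z * w) = re z * re w - im z * im w.
Proof. by case: z w => ? ? []. Qed.
Lemma imM z w : im (z * w) = re z * im w + im z * re w.
Proof. by case: z w => ? ? [] *; rewrite /im /re /=; ring. Qed.
Lemma re_rc (x : R) : re (rc x) = x. Proof. by []. Qed.
Lemma im_rc (x : R) : im (rc x) = 0. Proof. by []. Qed.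

Lemma cplx_eq z w : re z = re w -> im z = im w -> z = w.
Proof. by case: z w => ? ? [? ?]; rewrite /re /im /= => -> ->. Qed.

Lemma re_le_norm z : rc `|re z| <= `|z|.
Proof.
rewrite norm_cplx rc_le -sqrtr_sqr ler_wsqrtr // lerDl sqr_ge0 //.
Qed.
Lemma im_le_norm z : rc `|im z| <= `|z|.
Proof.
rewrite norm_cplx rc_le -sqrtr_sqr ler_wsqrtr // lerDr sqr_ge0 //.
Qed.
Lemma norm_le_reim z : `|z| <= rc (`|re z| + `|im z|).
Proof.
rewrite {1}(cpxE z) cpx_rc rcD (le_trans (ler_normD _ _)) // lerD //.
  by rewrite rc_norm.
rewrite normrM rc_norm norm_cplx /= /re /im /= expr0n expr1n add0r sqrtr1.
by rewrite mul1r.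
Qed.

Lemma pos_rc (e : C) : 0 < e -> e = rc (re e) /\ 0 < re e.
Proof.
case: e => x y; rewrite ltcE /= => /andP[/eqP yx ?]; split => //.
by rewrite /rc /cpx /re /= yx.
Qed.

Lemma cvg_cplxP (T : Type) (F : set_system T) {FF : Filter F} (f : T -> C) z :
  f @ F --> z <-> forall e : R, 0 < e -> \forall t \near F, `|z - f t| < rc e.
Proof.
split.
  move=> /cvgrPdist_lt fz e e0; apply: fz; by rewrite -rc0 rc_lt.
move=> fz; apply/cvgrPdist_lt => e /pos_rc[-> e0]; exact: fz.
Qed.

Lemma cvg_re (T : Type) (F : set_system T) {FF : Filter F} (f : T -> C) z :
  f @ F --> z -> (fun t => re (f t)) @ F --> re z.
Proof.
move=> /cvg_cplxP fz; apply/cvgrPdist_lt => e e0.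
apply: filterS (fz e e0) => t zt.
by rewrite -rc_lt -reB (le_lt_trans (re_le_norm _) zt).
Qed.

Lemma cvg_im (T : Type) (F : set_system T) {FF : Filter F} (f : T -> C) z :
  f @ F --> z -> (fun t => im (f t)) @ F --> im z.
Proof.
move=> /cvg_cplxP fz; apply/cvgrPdist_lt => e e0.
apply: filterS (fz e e0) => t zt.
by rewrite -rc_lt -imB (le_lt_trans (im_le_norm _) zt).
Qed.

Lemma cvg_cpx (T : Type) (F : set_system T) {FF : Filter F} (f g : T -> R) x y :
  f @ F --> x -> g @ F --> y ->
  (fun t => cpx (f t) (g t)) @ F --> (cpx x y : C).
Proof.
move=> /cvgrPdist_lt fx /cvgrPdist_lt gy; apply/cvg_cplxP => e e0.
have e2 : 0 < e / 2 by rewrite divr_gt0.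
near=> t; apply: le_lt_trans (norm_le_reim _) _.
rewrite rc_lt reB imB /= [e]splitr ltrD //; near: t; [exact: fx|exact: gy].
Unshelve. all: by end_near. Qed.

Lemma cvg_rc (T : Type) (F : set_system T) {FF : Filter F} (f : T -> R) x :
  f @ F --> x -> (fun t => rc (f t)) @ F --> (rc x : C).
Proof. by move=> fx; apply: cvg_cpx fx (cvg_cst _). Qed.

End ComplexPlane.

(** * Derivatives along a real variable *)

Section ComplexDerivative.
Context {R : realType}.
Local Notation C := (cplx R).

(** A relation rather than an operator: differentiability and the value of the
    derivative are stated together. *)
Definition cderiv (F : R -> C) (t : R) (d : C) :=
  (fun s => (F s - F t) / rc (s - t)) @ t^' --> d.

Lemma near_neq (t : R) : \forall s \near t^', s != t.
Proof. by rewrite /dnbhs near_withinE; apply: nearW. Qed.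

Lemma rc_sub_neq0 (s t : R) : s != t -> rc (s - t) != 0 :> C.
Proof. by rewrite rc_eq0 subr_eq0. Qed.

Lemma cvg_sub_rc (t : R) : (fun s => rc (s - t) : C) @ t^' --> (0 : C).
Proof.
rewrite -rc0 -(subrr t); apply: cvg_rc; apply: cvgB; last exact: cvg_cst.
exact: cvg_within.
Qed.

Lemma cderiv_cvg F t d : cderiv F t d -> F @ t^' --> F t.
Proof.
move=> Fd; rewrite -[F t]addr0 -(mulr0 d).
have : (fun s => F t + (F s - F t) / rc (s - t) * rc (s - t)) @ t^'
    --> F t + d * 0.
  apply: cvgD; first exact: cvg_cst.
  exact: (cvgM Fd (@cvg_sub_rc t)).
apply: cvg_trans; apply: near_eq_cvg; near=> s.
rewrite mulfVK ?rc_sub_neq0 //; first by rewrite addrC subrK.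
by near: s; exact: near_neq.
Unshelve. all: by end_near. Qed.

Lemma cderiv_continuous F t d : cderiv F t d -> F @ t --> F t.
Proof.
by move=> /cderiv_cvg Ft; apply/continuous_withinNx; exact: Ft.
Qed.

Lemma cderiv_cst (k : C) t : cderiv (fun=> k) t 0.
Proof.
rewrite /cderiv; under eq_cvg do rewrite subrr mul0r; exact: cvg_cst.
Qed.

Lemma cderivD F G t d e :
  cderiv F t d -> cderiv G t e -> cderiv (fun s => F s + G s) t (d + e).
Proof.
move=> Fd Ge; rewrite /cderiv.
by under eq_cvg do rewrite opprD addrACA mulrDl; exact: (cvgD Fd Ge).
Qed.

Lemma cderivN F t d : cderiv F t d -> cderiv (fun s => - F s) t (- d).
Proof.
move=> Fd; rewrite /cderiv.
by under eq_cvg do rewrite -opprD mulNr; exact: (cvgN Fd).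
Qed.

Lemma cderivB F G t d e :
  cderiv F t d -> cderiv G t e -> cderiv (fun s => F s - G s) t (d - e).
Proof. by move=> Fd Ge; exact: (cderivD Fd (cderivN Ge)). Qed.

Lemma cderivM F G t d e : cderiv F t d -> cderiv G t e ->
  cderiv (fun s => F s * G s) t (d * G t + F t * e).
Proof.
move=> Fd Ge; rewrite /cderiv.
have E s : (F s * G s - F t * G t) / rc (s - t) =
    (F s - F t) / rc (s - t) * G s + F t * ((G s - G t) / rc (s - t)).
  by ring.
under eq_cvg do rewrite E.
exact: (cvgD (cvgM Fd (cderiv_cvg Ge)) (cvgM (cvg_cst _) Ge)).
Qed.

Lemma cderivZ k F t d : cderiv F t d -> cderiv (fun s => k * F s) t (k * d).
Proof.
by move=> /(cderivM (cderiv_cst k t)); rewrite mul0r add0r.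
Qed.

Definition cconj (z : C) : C := cpx (re z) (- im z).

Lemma cconjB z w : cconj (z - w) = cconj z - cconj w.
Proof. by apply: cplx_eq; rewrite ?reB ?imB /cconj /= /re /im /=; ring. Qed.
Lemma cconjD z w : cconj (z + w) = cconj z + cconj w.
Proof. by apply: cplx_eq; rewrite ?reD ?imD /cconj /= /re /im /=; case: z w => ? ? [? ?] /=; ring. Qed.
Lemma cconjM z w : cconj (z * w) = cconj z * cconj w.
Proof. by apply: cplx_eq; rewrite /cconj /= /re /im /=; case: z w => ? ? [? ?] /=; ring. Qed.
Lemma cconj_rc (x : R) : cconj (rc x) = rc x.
Proof. by apply: cplx_eq; rewrite /= ?oppr0. Qed.

Lemma cderiv_conj F t d : cderiv F t d -> cderiv (fun s => cconj (F s)) t (cconj d).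
Proof.
move=> Fd; rewrite /cderiv.
have E s : (cconj (F s) - cconj (F t)) / rc (s - t) = cconj ((F s - F t) / rc (s - t)).
  by rewrite cconjM -cconjB -rcV cconj_rc.
under eq_cvg do rewrite E.
have h := cvgN (cvg_im Fd).
apply: cvg_cpx; [exact: (cvg_re Fd)|exact: h].
Qed.

Lemma cvg_reflect (c t : R) : (fun s => c - s) @ t^' --> (c - t)^'.
Proof.
have : (fun s => c - s) @ t --> c - t.
  by apply: cvgB; [exact: cvg_cst|exact: cvg_id].
move=> h A /= ; rewrite /dnbhs /within /= => /h /=.
rewrite !nbhs_simpl /= => nA.
apply: filterS nA => s /= sA st; apply: sA; apply: contra st => /eqP e.
by apply/eqP; move: e => /(congr1 (fun x => c - x)); rewrite !subKr.
Qed.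

Lemma cderiv_reflect F (c t : R) d : cderiv F (c - t) d ->
  cderiv (fun s => F (c - s)) t (- d).
Proof.
move=> Fd; rewrite /cderiv.
have : (fun s => - ((F (c - s) - F (c - t)) / rc ((c - s) - (c - t)))) @ t^'
    --> - d.
  have h := cvg_comp (fun s => c - s) (fun u => (F u - F (c - t)) / rc (u - (c - t)))
    (@cvg_reflect c t) Fd.
  exact: (cvgN h).
apply: cvg_trans; apply: near_eq_cvg; apply: nearW => s /=.
have -> : c - s - (c - t) = - (s - t) by ring.
by rewrite rcN invrN mulrN opprK.
Qed.

Lemma real_derive_dnbhs (f : R -> R) t d :
  (fun s => (f s - f t) / (s - t)) @ t^' --> d -> is_derive t 1 f d.
Proof.
move=> fd.
have h : (fun h => h^-1 *: ((f \o shift t) (h *: 1) - f t)) @ 0^' --> d.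
  have := fd; move=> /cvgrPdist_lt H; apply/cvgrPdist_lt => e e0.
  have := H e e0; rewrite /dnbhs !near_withinE.
  move=> /nbhs_ballP[r /= r0 rP]; apply/nbhs_ballP; exists r => // y /= yr y0.
  have := rP (y + t); rewrite /ball /= in yr *.
  rewrite addrK opprD addrCA addrN addr0 normrN.
  move=> /(_ _ _) ; rewrite /= [y *: 1]mulr1 [_^-1 *: _]mulrC; apply.
    by rewrite sub0r normrN in yr.
  by rewrite -subr_eq0 addrK.
apply: DeriveDef; last by rewrite /derive; apply/cvg_lim.
by apply/cvg_ex; exists d.
Qed.

Lemma cderiv_re F t d : cderiv F t d ->
  is_derive t 1 (fun s => re (F s)) (re d).
Proof.
move=> Fd; apply: real_derive_dnbhs.
have E s : (re (F s) - re (F t)) / (s - t) = re ((F s - F t) / rc (s - t)).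
  by rewrite -rcV reM re_rc im_rc mulr0 subr0 reB.
by under eq_cvg do rewrite E; exact: (cvg_re Fd).
Qed.

Lemma cderiv_im F t d : cderiv F t d ->
  is_derive t 1 (fun s => im (F s)) (im d).
Proof.
move=> Fd; apply: real_derive_dnbhs.
have E s : (im (F s) - im (F t)) / (s - t) = im ((F s - F t) / rc (s - t)).
  by rewrite -rcV imM re_rc im_rc mulr0 add0r imB.
by under eq_cvg do rewrite E; exact: (cvg_im Fd).
Qed.

Lemma cderiv_velocity F t d : cderiv F t d -> velocity F t = d.
Proof.
move=> Fd; rewrite /velocity !derive1E.
have [? ->] := cderiv_re Fd; have [? ->] := cderiv_im Fd.
by rewrite -cpxE.
Qed.

End ComplexDerivative.

(** * The quintic and derivatives in a local coordinate *)

Section Quintic.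
Variables (K : comNzRingType) (b : K).
Implicit Types x y : K.

Lemma fpolyE x : (fpoly b).[x] = x * (x ^+ 2 - 1) * (x ^+ 2 - b ^+ 2).
Proof. by rewrite /fpoly !hornerE. Qed.

Lemma dfpolyE x :
  (fpoly b)^`().[x] = 5 * x ^+ 4 - 3 * (1 + b ^+ 2) * x ^+ 2 + b ^+ 2.
Proof.
rewrite /fpoly !derivM !derivB !derivXn !derivX !derivC !hornerE /=; ring.
Qed.

(** The quotient (f x - f y) / (x - y) as a polynomial, hence with a value on
    the diagonal: derivatives on the curve are limits of such quotients at two
    points that merge. *)
Definition fdq x y :=
  x ^+ 4 + x ^+ 3 * y + x ^+ 2 * y ^+ 2 + x * y ^+ 3 + y ^+ 4
  - (1 + b ^+ 2) * (x ^+ 2 + x * y + y ^+ 2) + b ^+ 2.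

Lemma fdqP x y : (fpoly b).[x] - (fpoly b).[y] = (x - y) * fdq x y.
Proof. by rewrite !fpolyE /fdq; ring. Qed.

Lemma fdq_diag x : fdq x x = (fpoly b)^`().[x].
Proof. by rewrite dfpolyE /fdq; ring. Qed.

(** The same quotient for f'.  It is the coefficient of the linear equation
    satisfied by the difference of two trajectories. *)
Definition dfdq x y := 5 * (x + y) * (x ^+ 2 + y ^+ 2) - 3 * (1 + b ^+ 2) * (x + y).

Lemma dfdqP x y : (fpoly b)^`().[x] - (fpoly b)^`().[y] = (x - y) * dfdq x y.
Proof. by rewrite !dfpolyE /dfdq; ring. Qed.

End Quintic.

(* dnbhs p is a filter at every point of a topological space; it is proper only
   at the points that are not isolated. *)
#[local] Hint Extern 0 (Filter _) => (apply: dnbhs_filter) : typeclass_instances.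

Section HasDeriv.
Context {R : realType} {T : topologicalType}.
Local Notation C := (cplx R).
Implicit Types (x y g h : T -> C) (p : T) (d e : C).

Lemma has_derivM x g h p d e : h @ p^' --> h p ->
  has_deriv x g p d -> has_deriv x h p e ->
  has_deriv x (fun q => g q * h q) p (d * h p + g p * e).
Proof.
move=> hp gd he; rewrite /has_deriv.
have E q : (g q * h q - g p * h p) / (x q - x p) =
    (g q - g p) / (x q - x p) * h q + g p * ((h q - h p) / (x q - x p)).
  by ring.
under eq_cvg do rewrite E.
exact: (cvgD (cvgM gd hp) (cvgM (cvg_cst _) he)).
Qed.

Lemma has_derivV x h p e : h @ p^' --> h p -> h p != 0 ->
  has_deriv x h p e -> has_deriv x (fun q => (h q)^-1) p (- e / h p ^+ 2).
Proof.
move=> hp hp0 he; rewrite /has_deriv.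
have nz : \forall q \near p^', h q != 0.
  exact: (@cvgr_neq0 _ _ _ _ (dnbhs_filter p) _ _ hp hp0).
have : (fun q => - ((h q - h p) / (x q - x p)) * ((h q)^-1 * (h p)^-1)) @ p^'
    --> - e * ((h p)^-1 * (h p)^-1).
  exact: (cvgM (cvgN he) (cvgM (cvgV hp0 hp) (cvg_cst (h p)^-1))).
rewrite [h p ^+ 2]expr2 invfM; apply: cvg_trans; apply: near_eq_cvg.
apply: (@filterS _ _ (dnbhs_filter p) _ _ _ nz) => q hq0 /=.
by move: (x q - x p)^-1 => X; field; rewrite hp0 hq0.
Qed.

Lemma has_deriv_near x g h p d :
  (\forall q \near p, g q = h q) -> has_deriv x g p d -> has_deriv x h p d.
Proof.
move=> gh; have e := nbhs_singleton gh.
apply: cvg_trans; apply: near_eq_cvg.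
have : \forall q \near p^', g q = h q by exact: nbhs_dnbhs.
by apply: filterS => q ->; rewrite e.
Qed.

End HasDeriv.

(** * The curve near a finite point and near infinity *)

Section CurveTopology.
Context {R : realType} (a : R).
Local Notation C := (cplx R).
Local Notation f := (fpoly (rc a : C)).
Local Notation X := (curve a).
Implicit Types p q : X.

Lemma curve_eqn p : p <> None -> wc p ^+ 2 = f.[zc p].
Proof. by case: p => [u|] // _; rewrite /zc /wc; exact: (set_valP u). Qed.

Lemma curve_inj p q : p <> None -> q <> None -> zc p = zc q -> wc p = wc q ->
  p = q.
Proof.
case: p q => [u|] // [v|] // _ _ zE wE; congr Some; apply: val_inj.
have : (set_val u).1 = (set_val v).1 by [].
have : (set_val u).2 = (set_val v).2 by [].
rewrite set_valE; case: (\val u) => z1 w1; case: (\val v) => z2 w2 /=.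
by move=> -> ->.
Qed.

Lemma near_finite p : p <> None -> \forall q \near p, q <> None.
Proof.
case: p => [u|] // _.
by apply: (@filterS _ (nbhs u) _ setT); [move=> v|exact: filterT].
Qed.

Lemma zc_cvg p : p <> None -> @zc R a @ p --> zc p.
Proof.
case: p => [u|] // _; apply: (@cvg_comp _ _ _ (set_val : affine_curve a -> C * C) fst).
  exact: initial_continuous.
exact: cvg_fst.
Qed.

Lemma wc_cvg p : p <> None -> @wc R a @ p --> wc p.
Proof.
case: p => [u|] // _; apply: (@cvg_comp _ _ _ (set_val : affine_curve a -> C * C) snd).
  exact: initial_continuous.
exact: cvg_snd.
Qed.

Lemma horner_cvg (g : {poly C}) (T : Type) (F : set_system T) {FF : Filter F}
    (h : T -> C) z : h @ F --> z -> (fun t => g.[h t]) @ F --> g.[z].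
Proof.
move=> hz; elim/poly_ind: g => [|g c IH].
  by rewrite horner0; under eq_cvg do rewrite horner0; exact: cvg_cst.
rewrite !hornerE; under eq_cvg do rewrite !hornerE.
exact: (cvgD (cvgM IH hz) (cvg_cst _)).
Qed.

Definition box (M : R) : set C :=
  (fun u : R * R => cpx u.1 u.2 : C) @` (`[- M, M] `*` `[- M, M]).

Lemma compact_box M : compact (box M).
Proof.
apply: continuous_compact; last first.
  by apply: compact_setX; exact: segment_compact.
apply: continuous_subspaceT => u.
by apply: cvg_cpx; [exact: cvg_fst|exact: cvg_snd].
Qed.

Lemma in_box M z : `|z| <= rc M -> box M z.
Proof.
move=> zM; exists (re z, im z); last by rewrite -cpxE.
split => /=; rewrite in_itv /= -ler_norml -rc_le.
  exact: le_trans (re_le_norm _) zM.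
exact: le_trans (im_le_norm _) zM.
Qed.

Lemma box_norm M z : box M z -> `|z| <= rc (M + M).
Proof.
move=> [[x y] [/=]]; rewrite !in_itv /= -!ler_norml => xM yM <-.
by rewrite (le_trans (norm_le_reim _)) // rc_le lerD.
Qed.

Lemma closed_box M : closed (box M).
Proof. by apply: compact_closed; [exact: norm_hausdorff|exact: compact_box]. Qed.

Lemma closed_affine_curve : closed (affine_curve a).
Proof.
have -> : affine_curve a = (fun u : C * C => u.2 ^+ 2 - f.[u.1]) @^-1` [set 0].
  by apply/seteqP; split => u /=; [move=> ->; rewrite subrr|move/subr0_eq].
apply: preimage_closed.
  move=> u _; apply: cvgB; last exact: (@horner_cvg f _ (nbhs u) _ fst u.1 cvg_fst).
  have h : (fun v : C * C => v.2) @ nbhs u --> u.2 by exact: cvg_snd.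
  exact: (cvgM h h).
apply: accessible_closed_set1; apply: hausdorff_accessible.
exact: norm_hausdorff.
Qed.

(** A bounded part of the affine curve is compact, because w is bounded
    together with z; hence z tends to infinity at the point at infinity. *)
Lemma near_infinity (M : R) :
  \forall q \near (None : X), q = None \/ rc M < `|zc q|.
Proof.
pose A : set (affine_curve a) := [set u | box M (set_val u).1].
have [B B0 AB] : exists2 B : R, 0 <= B & forall u, A u -> box B (set_val u).2.
  (* K - 1 bounds |f z| = |w| ^ 2 when |z| <= N, and K - 1 <= K ^ 2. *)
  pose N := rc (M + M) : C.
  pose K := N * (N ^+ 2 + 1) * (N ^+ 2 + `|rc a| ^+ 2) + 1.
  have [M0|M0] := ltP M 0.
    exists 0 => // u [[x y] [/=]]; rewrite !in_itv /= => /andP[h1 h2].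
    by exfalso; have := le_trans h1 h2; lra.
  have N0 : 0 <= N by rewrite -rc0 rc_le addr_ge0.
  have KE : K = rc ((M + M) * ((M + M) ^+ 2 + 1) * ((M + M) ^+ 2 + `|a| ^+ 2) + 1).
    by rewrite /K /N rc_norm !(rcD, rcM, rcX, rc1).
  have K1 : 1 <= K.
    by rewrite lerDr !mulr_ge0 // ?addr_ge0 ?exprn_ge0.
  exists (re K); first by rewrite -rc_le rc0 KE re_rc -KE (le_trans _ K1).
  move=> u /box_norm uM; apply: in_box.
  have -> : rc (re K) = K by rewrite KE.
  rewrite -(@ler_pXn2r _ 2) ?nnegrE ?(le_trans _ K1) // -normrX.
  have -> : (set_val u).2 ^+ 2 = f.[(set_val u).1] by exact: (set_valP u).
  rewrite (@le_trans _ _ K) ?ler_eXnr // fpolyE !normrM.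
  rewrite (@le_trans _ _ (K - 1)) ?lerBlDr ?lerDl // /K addrK.
  have h (c : C) : `|(set_val u).1 ^+ 2 - c| <= N ^+ 2 + `|c|.
    apply: le_trans (ler_normB _ _) _; rewrite lerD2r normrX.
    by rewrite ler_pXn2r ?nnegrE.
  have h1 := h 1; rewrite normr1 in h1.
  have h2 := h (rc a ^+ 2); rewrite [`|rc a ^+ 2|]normrX in h2.
  by apply: ler_pM => //; apply: ler_pM.
exists A; last first.
  move=> q [[u nAu <-]|->]; [right|by left].
  have Mr : rc M \is @Num.real C.
    by rewrite realE -rc0 !rc_le; exact: le_total.
  rewrite real_ltNge ?normr_real //.
  by apply/negP => uM; apply: nAu; exact: in_box.
split; last first.
  apply: (@preimage_closed _ _ (fun u : affine_curve a => (set_val u).1)).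
    move=> u _; apply: (@cvg_comp _ _ _ (set_val : affine_curve a -> C * C) fst).
      exact: initial_continuous.
    exact: cvg_fst.
  exact: closed_box.
(* A cluster point is found in the plane C * C, where the curve is closed. *)
move=> F FF FA.
have cK := compact_closedI (compact_setX (@compact_box M) (@compact_box B))
  closed_affine_curve.
have GK : (set_val @ F) ((box M `*` box B) `&` affine_curve a).
  rewrite /fmap /=; apply: filterS FA => u Au; split; last exact: (set_valP u).
  by split; [exact: Au|exact: AB].
have [x [[[xM _] xX] xcl]] := cK _ (fmap_proper_filter _ FF) GK.
pose u : affine_curve a := exist _ x (mem_set xX).
exists u; split; first exact: xM.
move=> S U FS [V [[W oW <-] /= Wx] WU].
have [_ [[v Sv <-] Wv]] : (set_val @` S) `&` W !=set0.
  apply: xcl; last by apply: open_nbhs_nbhs; split.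
  rewrite /fmap /=; apply: filterS FS => v Sv; by exists v.
by exists v; split => //; apply: WU.
Qed.

End CurveTopology.

(** * Changes of coordinates on the curve *)

(** For a fixed second argument the difference quotient is a polynomial in the
    first one. *)
Lemma fdq_cvg (R : realType) (b : cplx R) (T : Type) (F : set_system T)
    {FF : Filter F} (h : T -> cplx R) (z : cplx R) :
  h @ F --> z -> (fun t => fdq b (h t) z) @ F --> (fpoly b)^`().[z].
Proof.
move=> hz; rewrite -fdq_diag.
pose g : {poly cplx R} := 'X^4 + 'X^3 * z%:P + 'X^2 * (z ^+ 2)%:P
  + 'X * (z ^+ 3)%:P + (z ^+ 4)%:P
  - (1 + b ^+ 2)%:P * ('X^2 + 'X * z%:P + (z ^+ 2)%:P) + (b ^+ 2)%:P.
have E x : fdq b x z = g.[x] by rewrite /g !hornerE /= /fdq; ring.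
by rewrite E; under eq_cvg do rewrite E; exact: (@horner_cvg _ g _ _ _ _ _ hz).
Qed.

Section LocalCoordinates.
Context {R : realType} (a : R).
Local Notation C := (cplx R).
Local Notation f := (fpoly (rc a : C)).
Local Notation X := (curve a).
Implicit Types p q : X.

Local Notation zf := (@zc R a).
Local Notation wf := (@wc R a).

Lemma dnbhs_near p (P : set X) : (\forall q \near p, P q) -> \forall q \near p^', P q.
Proof. by move=> h; exact: nbhs_dnbhs. Qed.

Lemma zc_cvg_dnbhs p : p <> None -> zf @ p^' --> zf p.
Proof. by move=> /zc_cvg h; apply: cvg_trans h; apply: cvg_app; exact: nbhs_dnbhs. Qed.

Lemma wc_cvg_dnbhs p : p <> None -> wf @ p^' --> wf p.
Proof. by move=> /wc_cvg h; apply: cvg_trans h; apply: cvg_app; exact: nbhs_dnbhs. Qed.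

(** The difference of w^2 = f z at two points of the curve.  It turns a
    difference quotient of w with respect to z, or of z with respect to w, into
    a quotient of continuous functions. *)
Lemma curve_slope p q : p <> None -> q <> None ->
  (zf q - zf p) * fdq (rc a) (zf q) (zf p) = (wf q - wf p) * (wf q + wf p).
Proof. by move=> pN qN; rewrite -fdqP -!curve_eqn // -subr_sqr. Qed.

Lemma fdq_zc_cvg p : p <> None ->
  (fun q => fdq (rc a) (zf q) (zf p)) @ p^' --> f^`().[zf p].
Proof. by move=> pN; exact: (@fdq_cvg _ (rc a) _ _ _ _ _ (zc_cvg_dnbhs pN)). Qed.

(** Where f' does not vanish, w determines z near p. *)
Lemma near_wc_neq p : p <> None -> f^`().[zf p] != 0 ->
  \forall q \near p^', [/\ q <> None, wf q - wf p != 0 &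
    fdq (rc a) (zf q) (zf p) != 0].
Proof.
move=> pN f'0.
have gn : \forall q \near p^', fdq (rc a) (zf q) (zf p) != 0.
  exact: (@cvgr_neq0 _ _ _ _ (dnbhs_filter p) _ _ (fdq_zc_cvg pN) f'0).
have qN := dnbhs_near (near_finite pN).
have qp : \forall q \near p^', q != p by exact: nbhs_dnbhs_neq.
near=> q.
have gnq : fdq (rc a) (zf q) (zf p) != 0 by near: q.
have qNq : q <> None by near: q.
have qpq : q != p by near: q.
have E := curve_slope pN qNq.
split => //; apply: contra qpq => /eqP w0; apply/eqP/curve_inj => //; last exact: subr0_eq.
apply: subr0_eq; apply/eqP; move/eqP: E; rewrite w0 mul0r mulf_eq0.
by rewrite (negbTE gnq) orbF.
Unshelve. all: by end_near. Qed.

(** Where w does not vanish, z determines w near p. *)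
Lemma near_zc_neq p : p <> None -> wf p != 0 ->
  \forall q \near p^', [/\ q <> None, zf q - zf p != 0 & wf q + wf p != 0].
Proof.
move=> pN w0.
have ww : wf p + wf p != 0 by rewrite -mulr2n mulrn_eq0.
have wp : (fun q => wf q + wf p) @ p^' --> wf p + wf p.
  exact: (cvgD (wc_cvg_dnbhs pN) (cvg_cst _)).
have wn : \forall q \near p^', wf q + wf p != 0.
  exact: (@cvgr_neq0 _ _ _ _ (dnbhs_filter p) _ _ wp ww).
have qN := dnbhs_near (near_finite pN).
have qp : \forall q \near p^', q != p by exact: nbhs_dnbhs_neq.
near=> q.
have wnq : wf q + wf p != 0 by near: q.
have qNq : q <> None by near: q.
have qpq : q != p by near: q.
have E := curve_slope pN qNq.
split => //; apply: contra qpq => /eqP z0; apply/eqP/curve_inj => //; first exact: subr0_eq.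
apply: subr0_eq; apply/eqP; move/eqP: E; rewrite z0 mul0r eq_sym mulf_eq0.
by rewrite (negbTE wnq) orbF.
Unshelve. all: by end_near. Qed.

Lemma has_deriv_wc_zc p : p <> None -> f^`().[zf p] != 0 ->
  has_deriv wf zf p (2 * wf p / f^`().[zf p]).
Proof.
move=> pN f'0; rewrite /has_deriv.
have : (fun q => (wf q + wf p) / fdq (rc a) (zf q) (zf p)) @ p^'
    --> (wf p + wf p) / f^`().[zf p].
  exact: (cvgM (cvgD (wc_cvg_dnbhs pN) (cvg_cst _)) (cvgV f'0 (fdq_zc_cvg pN))).
rewrite -mulr2n mulr_natl; apply: cvg_trans; apply: near_eq_cvg.
have := near_wc_neq pN f'0; apply: filterS => q [qN wq gq].
by apply/eqP; rewrite eqr_div // [X in X == _]mulrC -(curve_slope pN qN) mulrC.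
Qed.

Lemma has_deriv_zc_wc p : p <> None -> wf p != 0 ->
  has_deriv zf wf p (f^`().[zf p] / (2 * wf p)).
Proof.
move=> pN w0; rewrite /has_deriv.
have ww : wf p + wf p != 0 by rewrite -mulr2n mulrn_eq0.
have : (fun q => fdq (rc a) (zf q) (zf p) / (wf q + wf p)) @ p^'
    --> f^`().[zf p] / (wf p + wf p).
  exact: (cvgM (fdq_zc_cvg pN) (cvgV ww (cvgD (wc_cvg_dnbhs pN) (cvg_cst _)))).
rewrite -mulr2n mulr_natl; apply: cvg_trans; apply: near_eq_cvg.
have := near_zc_neq pN w0; apply: filterS => q [qN zq wq].
by apply/eqP; rewrite eqr_div // mulrC (curve_slope pN qN).
Qed.

End LocalCoordinates.

(** * The coefficients of dz/w *)

Section FormCoefficients.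
Context {R : realType} (a : R).
Local Notation C := (cplx R).
Local Notation f := (fpoly (rc a : C)).
Local Notation X := (curve a).
Implicit Types p q : X.

Local Notation zf := (@zc R a).
Local Notation wf := (@wc R a).
Local Notation tf := (@tc R a).

Lemma tcE p : p <> None -> tf p = zf p ^+ 2 / wf p.
Proof. by case: p. Qed.

Lemma wc_neq0_zc_neq0 p : p <> None -> wf p != 0 -> zf p != 0.
Proof.
move=> pN; apply: contra => /eqP z0; rewrite -sqrf_eq0.
by rewrite curve_eqn // z0 fpolyE !mul0r.
Qed.

Lemma has_deriv_zc_tc p : p <> None -> wf p != 0 -> has_deriv zf zf p 1 ->
  has_deriv zf tf p
    (zf p * (4 * f.[zf p] - zf p * f^`().[zf p]) / (2 * wf p ^+ 3)).
Proof.
move=> pN w0 z1.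
have z2 := has_derivM (zc_cvg_dnbhs pN) z1 z1.
have w1 := has_derivV (wc_cvg_dnbhs pN) w0 (has_deriv_zc_wc pN w0).
have wV : (fun q => (wf q)^-1) @ p^' --> (wf p)^-1 by exact: (cvgV w0 (wc_cvg_dnbhs pN)).
have zw1 := has_derivM wV z2 w1. move: zw1.
have -> : (1 * zf p + zf p * 1) * (wf p)^-1 +
    zf p * zf p * (- (f^`().[zf p] / (2 * wf p)) / wf p ^+ 2) =
    zf p * (4 * f.[zf p] - zf p * f^`().[zf p]) / (2 * wf p ^+ 3).
  by rewrite -(curve_eqn pN); field.
apply: has_deriv_near; have := near_finite pN.
by apply: filterS => q qN; rewrite tcE // expr2.
Qed.

Section HolomorphicOmega.
Variable omega : Defs.form (curve_atlas a).
Hypothesis hol : holomorphic_form omega.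
Hypothesis omegaZ : forall p, curve_dom (a:=a) Zloc p -> omega Zloc p = (wc p)^-1.
Hypothesis NI : forall p, ProperFilter p^'.

Lemma Zloc_dom p : p <> None -> wf p != 0 -> curve_dom (a:=a) Zloc p.
Proof. by move=> pN w0; split => //; apply/eqP. Qed.

(** The coordinate z takes the value z p only at p, so the quotient is 1 near p. *)
Lemma has_deriv_zc_zc p : p <> None -> wf p != 0 -> has_deriv zf zf p 1.
Proof.
move=> pN w0.
have : (fun=> 1 : C) @ p^' --> (1 : C) by exact: cvg_cst.
apply: cvg_trans; apply: near_eq_cvg.
have := near_zc_neq pN w0; apply: filterS => q [_ zq _].
by rewrite divff.
Qed.

Lemma omega_Wloc_regular p : p <> None -> wf p != 0 -> f^`().[zf p] != 0 ->
  omega Wloc p = 2 / f^`().[zf p].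
Proof.
move=> pN w0 f0; have pZ := Zloc_dom pN w0.
have pW : curve_dom (a:=a) Wloc p by split => //; apply/eqP.
have [d dP ->] := hol.2 Wloc Zloc p pW pZ; rewrite (omegaZ pZ).
have PF := NI p.
rewrite (cvg_unique (@norm_hausdorff _ C^o) dP (has_deriv_wc_zc pN f0)).
by field; rewrite f0.
Qed.

Lemma dfpoly_cvg p : p <> None ->
  (fun q => f^`().[zf q]) @ p^' --> f^`().[zf p].
Proof. by move=> pN; exact: (horner_cvg (zc_cvg_dnbhs pN)). Qed.

(** At a branch point, dz/w is not given by its coefficient in the coordinate z.
    Its coefficient in the coordinate w is the limit of the values
    2 / f' at the neighboring points, which exist because the curve has no
    isolated point. *)
Lemma omega_Wloc p : p <> None -> f^`().[zf p] != 0 ->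
  omega Wloc p = 2 / f^`().[zf p].
Proof.
move=> pN f0; have [w0|w0] := eqVneq (wf p) 0; last exact: omega_Wloc_regular.
have PF := NI p.
have pW : curve_dom (a:=a) Wloc p by split => //; apply/eqP.
have [d dP] := hol.1 Wloc p pW.
have H : (fun q => omega Wloc p +
    (omega Wloc q - omega Wloc p) / (wf q - wf p) * (wf q - wf p)) @ p^'
    --> omega Wloc p + d * (wf p - wf p).
  exact: (cvgD (cvg_cst _) (cvgM dP (cvgB (wc_cvg_dnbhs pN) (cvg_cst _)))).
have K : (fun q => 2 / f^`().[zf q]) @ p^' --> 2 / f^`().[zf p].
  exact: (cvgM (cvg_cst _) (cvgV f0 (dfpoly_cvg pN))).
rewrite subrr mulr0 addr0 in H.
apply: (cvg_unique (@norm_hausdorff _ C^o) H).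
apply: cvg_trans K; apply: near_eq_cvg.
have fn : \forall q \near p^', f^`().[zf q] != 0.
  exact: (@cvgr_neq0 _ _ _ _ (dnbhs_filter p) _ _ (dfpoly_cvg pN) f0).
have := near_wc_neq pN f0; apply: filterS2 fn => q fq [qN wq _].
rewrite mulfVK // addrC subrK omega_Wloc_regular //.
by rewrite w0 subr0 in wq.
Qed.

Lemma omega_Tloc p : p <> None -> wf p != 0 ->
  4 * f.[zf p] - zf p * f^`().[zf p] != 0 ->
  omega Tloc p = 2 * f.[zf p] / (zf p * (4 * f.[zf p] - zf p * f^`().[zf p])).
Proof.
move=> pN w0 f0; have pZ := Zloc_dom pN w0; have z0 := wc_neq0_zc_neq0 pN w0.
have pT : curve_dom (a:=a) Tloc p by move=> _; split => //; apply/eqP.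
have [d dP] := hol.2 Zloc Tloc p pZ pT; rewrite (omegaZ pZ).
have PF := NI p.
rewrite (cvg_unique (@norm_hausdorff _ C^o) dP (has_deriv_zc_tc pN w0 (has_deriv_zc_zc pN w0))).
have D0 : zf p * (4 * f.[zf p] - zf p * f^`().[zf p]) / (2 * wf p ^+ 3) != 0.
  by rewrite mulf_neq0 ?invr_eq0 ?mulf_neq0 ?expf_neq0 // pnatr_eq0.
move=> e; rewrite -[LHS](mulfK D0) -e.
move: f0 z0 w0; rewrite -(curve_eqn pN) => f0 z0 w0.
by field; rewrite z0 w0 f0.
Qed.

End HolomorphicOmega.
End FormCoefficients.

(** * The form z dz/w *)

(** Near infinity w is only known through w^2 = f z, so limits that involve w
    are computed after squaring. *)
Lemma sqr_cvg0 (R : realType) (T : Type) (F : set_system T) {FF : Filter F}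
    (Q : T -> cplx R) : (fun t => Q t ^+ 2) @ F --> (0 : cplx R) ->
  Q @ F --> (0 : cplx R).
Proof.
move=> /cvg_cplxP H; apply/cvg_cplxP => e e0.
apply: filterS (H _ (exprn_gt0 2 e0)) => t.
rewrite !sub0r !normrN normrX rcX ltr_pXn2r ?nnegrE //.
by rewrite -rc0 rc_le ltW.
Qed.

Section ZForm.
Context {R : realType} (a : R).
Local Notation C := (cplx R).
Local Notation f := (fpoly (rc a : C)).
Local Notation X := (curve a).
Implicit Types p q : X.
Variable omega : Defs.form (curve_atlas a).
Hypothesis hol : holomorphic_form omega.
Hypothesis omegaZ : forall p, curve_dom (a:=a) Zloc p -> omega Zloc p = (wc p)^-1.
Hypothesis NI : forall p, ProperFilter p^'.

(** The coefficient of z dz/w in the coordinate t is 2 f / (4 f - z f') at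
    finite points, and - 2 is its limit when z tends to infinity. *)
Definition z_form : Defs.form (curve_atlas a) :=
  fun i p => if p is None then -2 else zc p * omega i p.

Lemma z_formE i p : p <> None -> z_form i p = zc p * omega i p.
Proof. by case: p. Qed.

Lemma z_form_finite i p : p <> None -> curve_dom (a:=a) i p ->
  exists d, has_deriv (curve_coord (a:=a) i) (z_form i) p d.
Proof.
move=> pN pi.
have [e eP] : exists e, has_deriv (curve_coord (a:=a) i) (@zc R a) p e.
  have [w0|w0] := eqVneq (wc p) 0; last first.
    have [d dP _] := hol.2 i Zloc p pi (Zloc_dom pN w0).
    by exists d.
  case: i pi => [[]//|[_ /eqP f0]|/(_ pN)[]//].
  by exists (2 * wc p / f^`().[zc p]); exact: has_deriv_wc_zc.
have [d dP] := hol.1 i p pi.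
exists (d * zc p + omega i p * e).
have h : has_deriv (curve_coord (a:=a) i) (fun q => omega i q * zc q) p
    (d * zc p + omega i p * e).
  exact: (has_derivM (zc_cvg_dnbhs pN) dP eP).
apply: has_deriv_near h; have := near_finite pN.
by apply: filterS => q qN; rewrite z_formE // mulrC.
Qed.

(** Everything near infinity is expressed by polynomials in 1 / z. *)
Lemma inv_zc_cvg : (fun q : X => (zc q)^-1) @ (None : X)^' --> (0 : C).
Proof.
apply/cvg_cplxP => e e0.
have : \forall q \near (None : X)^', q != None /\ (q = None \/ rc e^-1 < `|zc q|).
  have h1 : \forall q \near (None : X)^', q != None by exact: nbhs_dnbhs_neq.
  have h2 := dnbhs_near (near_infinity a e^-1).
  by near=> q; split; near: q.
apply: filterS => q [qN [/eqP|]]; first by rewrite (negbTE qN).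
rewrite sub0r normrN normfV => h.
have z0 : 0 < `|zc q| by apply: lt_trans h; rewrite -rc0 rc_lt invr_gt0.
by rewrite invf_plt ?posrE // -?rcV // -rc0 rc_lt.
Unshelve. all: by end_near. Qed.

(* The reciprocal polynomials of f and of z f' - 4 f. *)
Let fr : {poly C} := (1 - 'X^2) * (1 - (rc a ^+ 2)%:P * 'X^2).
Let gr : {poly C} := 1 + (1 + rc a ^+ 2)%:P * 'X^2 - (3 * rc a ^+ 2)%:P * 'X^4.

Lemma f_recip (z : C) : z != 0 -> f.[z] = z ^+ 5 * fr.[z^-1].
Proof. by move=> z0; rewrite fpolyE /fr !hornerE /=; field. Qed.

Lemma g_recip (z : C) : z != 0 ->
  4 * f.[z] - z * f^`().[z] = - (z ^+ 5 * gr.[z^-1]).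
Proof. by move=> z0; rewrite fpolyE dfpolyE /gr !hornerE /=; field. Qed.

Lemma fr0E : fr.[0] = 1.
Proof. by rewrite /fr !hornerE /=; ring. Qed.

Lemma gr0E : gr.[0] = 1.
Proof. by rewrite /gr !hornerE /=; ring. Qed.

Lemma near_infinity_regular : \forall q \near (None : X)^',
  [/\ q <> None, zc q != 0, wc q != 0,
      4 * f.[zc q] - zc q * f^`().[zc q] != 0 & gr.[(zc q)^-1] != 0].
Proof.
have fr0 : (fun q : X => fr.[(zc q)^-1]) @ (None : X)^' --> fr.[0].
  exact: (horner_cvg inv_zc_cvg).
have gr0 : (fun q : X => gr.[(zc q)^-1]) @ (None : X)^' --> gr.[0].
  exact: (horner_cvg inv_zc_cvg).
have f1 : fr.[0] != 0 by rewrite fr0E oner_eq0.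
have g1 : gr.[0] != 0 by rewrite gr0E oner_eq0.
have h1 : \forall q \near (None : X)^', fr.[(zc q)^-1] != 0.
  exact: (@cvgr_neq0 _ _ _ _ (dnbhs_filter _) _ _ fr0 f1).
have h2 : \forall q \near (None : X)^', gr.[(zc q)^-1] != 0.
  exact: (@cvgr_neq0 _ _ _ _ (dnbhs_filter _) _ _ gr0 g1).
have h3 : \forall q \near (None : X)^', q != None by exact: nbhs_dnbhs_neq.
have h4 := dnbhs_near (near_infinity a 0).
near=> q.
have qN : q <> None by apply/eqP; near: q.
have z0 : zc q != 0.
  rewrite -normr_gt0; have : q = None \/ rc 0 < `|zc q| by near: q.
  by case.
have fq : fr.[(zc q)^-1] != 0 by near: q.
have gq : gr.[(zc q)^-1] != 0 by near: q.
split => //; last by rewrite g_recip // oppr_eq0 mulf_neq0 // expf_neq0.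
by rewrite -sqrf_eq0 curve_eqn // f_recip // mulf_neq0 // expf_neq0.
Unshelve. all: by end_near. Qed.

(** The square of the difference quotient is a rational function of 1 / z with a
    zero of order 3 at 1 / z = 0. *)
Lemma z_form_infinity : has_deriv (@tc R a) (z_form Tloc) None 0.
Proof.
pose n : {poly C} := (- 4 * (1 + rc a ^+ 2))%:P + (8 * rc a ^+ 2)%:P * 'X^2.
pose Q q := (z_form Tloc q - z_form Tloc None) / (tc q - tc (None : X)).
have H : (fun q : X => (zc q)^-1 ^+ 3 * n.[(zc q)^-1] ^+ 2 * fr.[(zc q)^-1] /
    gr.[(zc q)^-1] ^+ 2) @ (None : X)^' --> (0 : C).
  have u := inv_zc_cvg.
  have gg : (fun q : X => gr.[(zc q)^-1] ^+ 2) @ (None : X)^' --> gr.[0] ^+ 2.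
    have h : (fun q : X => gr.[(zc q)^-1]) @ (None : X)^' --> gr.[0].
      exact: (horner_cvg u).
    exact: (cvgM h h).
  have g0 : gr.[0] ^+ 2 != 0 by rewrite gr0E expr1n oner_eq0.
  pose N : {poly C} := 'X^3 * n ^+ 2 * fr.
  have NE x : x ^+ 3 * n.[x] ^+ 2 * fr.[x] = N.[x] by rewrite /N !hornerE.
  have N0 : N.[0] / gr.[0] ^+ 2 = 0 by rewrite -NE expr0n /= !mul0r.
  rewrite -N0; under eq_cvg do rewrite NE.
  have hN : (fun q : X => N.[(zc q)^-1]) @ (None : X)^' --> N.[0].
    exact: (horner_cvg u).
  exact: (cvgM hN (cvgV g0 gg)).
have QE : \forall q \near (None : X)^', Q q ^+ 2 =
    (zc q)^-1 ^+ 3 * n.[(zc q)^-1] ^+ 2 * fr.[(zc q)^-1] / gr.[(zc q)^-1] ^+ 2.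
  have := near_infinity_regular; apply: filterS => q [qN z0 w0 g0 gr0].
  rewrite /Q z_formE // (omega_Tloc hol omegaZ NI) //= subr0.
  rewrite -/(@tc R a q) tcE //.
  have nE : 10 * f.[zc q] - 2 * zc q * f^`().[zc q] = zc q ^+ 3 * n.[(zc q)^-1].
    by rewrite fpolyE dfpolyE /n !hornerE /=; field.
  rewrite (_ : zc q * _ - -2 = (10 * f.[zc q] - 2 * zc q * f^`().[zc q]) /
    (4 * f.[zc q] - zc q * f^`().[zc q])); last by field; rewrite z0 g0.
  rewrite nE g_recip //.
  have w2 : wc q ^+ 2 = zc q ^+ 5 * fr.[(zc q)^-1] by rewrite curve_eqn // f_recip.
  move: gr0 w2 z0 w0; move: (n.[(zc q)^-1]) (gr.[(zc q)^-1]) (fr.[(zc q)^-1]) => N G F.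
  move: (zc q) (wc q) => z w.
  move=> G0 w2 z0 w0.
  transitivity (N ^+ 2 * w ^+ 2 / (z ^+ 8 * G ^+ 2)).
    by field; rewrite z0 G0 w0.
  by rewrite w2; field; rewrite z0 G0.
have Q2 : (fun q => Q q ^+ 2) @ (None : X)^' --> (0 : C).
  by apply: cvg_trans H; apply: near_eq_cvg; apply: filterS QE => q ->.
exact: (sqr_cvg0 Q2).
Qed.

Lemma tc_cvg_infinity : (@tc R a) @ (None : X)^' --> (0 : C).
Proof.
have h : (fun q : X => (zc q)^-1 / fr.[(zc q)^-1]) @ (None : X)^' --> 0 / fr.[0].
  have f1 : fr.[0] != 0 by rewrite fr0E oner_eq0.
  exact: (cvgM inv_zc_cvg (cvgV f1 (horner_cvg inv_zc_cvg))).
rewrite mul0r in h.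
have t2 : (fun q : X => tc q ^+ 2) @ (None : X)^' --> (0 : C).
  apply: cvg_trans h; apply: near_eq_cvg.
  have := near_infinity_regular; apply: filterS => q [qN z0 w0 _ _].
  rewrite -/(@tc R a q) tcE // expr_div_n curve_eqn // f_recip //.
  have := w0; rewrite -sqrf_eq0 curve_eqn // f_recip // mulf_eq0 expf_eq0 /=.
  rewrite (negbTE z0) /= => fr0; by field; rewrite z0 fr0.
exact: (sqr_cvg0 t2).
Qed.

(** At neighboring points the coefficient of dz/w in the coordinate t is explicit,
    and it is of the order of 1 / z. *)
Lemma omega_infinity : omega Tloc None = 0.
Proof.
have PF := NI (None : X).
have pT : curve_dom (a:=a) Tloc None by [].
have [d dP] := hol.1 Tloc None pT.
have H : (fun q : X => omega Tloc None +
    (omega Tloc q - omega Tloc None) / (tc q - tc (None : X)) * tc q) @ (None : X)^'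
    --> omega Tloc None + d * 0.
  exact: (cvgD (cvg_cst _) (cvgM dP tc_cvg_infinity)).
have K : (fun q : X => -2 * (zc q)^-1 * (fr.[(zc q)^-1] / gr.[(zc q)^-1])) @ (None : X)^'
    --> -2 * 0 * (fr.[0] / gr.[0]).
  have g1 : gr.[0] != 0 by rewrite gr0E oner_eq0.
  exact: (cvgM (cvgM (cvg_cst _) inv_zc_cvg)
    (cvgM (horner_cvg inv_zc_cvg) (cvgV g1 (horner_cvg inv_zc_cvg)))).
rewrite mulr0 addr0 in H; rewrite mulr0 mul0r in K.
apply: (cvg_unique (@norm_hausdorff _ C^o) H).
apply: cvg_trans K; apply: near_eq_cvg.
have := near_infinity_regular; apply: filterS => q [qN z0 w0 g0 gr0].
have t0 : tc q != 0 by rewrite tcE // mulf_neq0 ?invr_eq0 ?expf_neq0.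
rewrite /= subr0 mulfVK // addrC subrK (omega_Tloc hol omegaZ NI) // g_recip // f_recip //.
by field; rewrite z0 gr0.
Qed.

(** Together with dz/w this gives two independent elements of the span of any basis
    of holomorphic forms. *)
Lemma z_form_holomorphic : holomorphic_form z_form.
Proof.
split=> [i [u|] pi|i j [u|] pi pj].
- exact: z_form_finite.
- exists 0; case: i pi => [[]//|[]//|_]; exact: z_form_infinity.
- have [d dP e] := hol.2 i j _ pi pj; exists d => //.
  by rewrite !z_formE // e mulrA.
- case: i pi => [[]//|[]//|_]; case: j pj => [[]//|[]//|_].
  exists 1; last by rewrite mulr1.
  have : (fun=> 1 : C) @ (None : X)^' --> (1 : C) by exact: cvg_cst.
  apply: cvg_trans; apply: near_eq_cvg.
  have := near_infinity_regular; apply: filterS => q [qN z0 w0 _ _].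
  rewrite /= -/(@tc R a q) -/(@tc R a None) tcE // subr0 divff //.
  by rewrite mulf_neq0 ?invr_eq0 ?expf_neq0.
Qed.

End ZForm.

(** * Gluing the polygon *)

Section SurfaceTopology.
Context {R : realType} (L : Lshape R).
Local Notation C := (cplx R).
Local Notation h := ((side L)%:num).
Local Notation l := ((width L)%:num).
Local Notation poly := (polygon L).
Local Notation S := (surface L).
Local Notation glue := (@Defs.glue R L).

(** The interior of the L-shape is the union of two overlapping open rectangles. *)
Definition inner_xy (x y : R) : bool :=
  [&& 0 < x < h + l & 0 < y < h] || [&& 0 < x < h & - l < y < h].

Definition inner (zeta : C) : bool :=
  inner_xy (re zeta - corner_x L) (im zeta - corner_y L).

Lemma inner_at x y : inner (at_xy L x y) = inner_xy x y.
Proof. by rewrite /inner /at_xy /re /im /= !(addrC (corner_x L), addrC (corner_y L)) !addrK. Qed.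

Lemma at_xyE (zeta : C) : zeta = at_xy L (re zeta - corner_x L) (im zeta - corner_y L).
Proof. by apply: cplx_eq; rewrite /at_xy /re /im /= addrC subrK. Qed.

Lemma polygon_at x y : 0 <= x <= h + l -> 0 <= y <= h -> poly (at_xy L x y).
Proof.
move=> xP yP; left; have [xh|xh] := leP x h.
  by left; exists x, y; split => //; lra.
by right; exists x, y; split => //; lra.
Qed.

Lemma polygon_at_left x y : 0 <= x <= h -> - l <= y <= h -> poly (at_xy L x y).
Proof.
move=> xP yP; have [y0|y0] := leP 0 y.
  by left; left; exists x, y; split => //; lra.
by right; rewrite Q1E; exists x, y; split => //; lra.
Qed.

Lemma inner_polygon zeta : inner zeta -> poly zeta.
Proof.
rewrite {2}(at_xyE zeta) /inner => /orP[]/andP[xP yP].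
  by apply: polygon_at; lra.
by apply: polygon_at_left; lra.
Qed.

Lemma polygonP zeta : poly zeta ->
  let x := re zeta - corner_x L in let y := im zeta - corner_y L in
  (0 <= x <= h + l /\ 0 <= y <= h) \/ (0 <= x <= h /\ - l <= y <= h).
Proof.
have h0 : 0 < h by []. have l0 : 0 < l by [].
case; [case|rewrite Q1E] => -[x [y [xP yP ->]]]; rewrite /at_xy /re /im /=;
  rewrite !(addrC (corner_x L), addrC (corner_y L)) !addrK; by [left; lra|right; lra].
Qed.

Lemma side_pair_not_inner zeta zeta' : side_pair L zeta zeta' ->
  ~~ inner zeta /\ ~~ inner zeta'.
Proof.
have h0 : 0 < h by []. have l0 : 0 < l by [].
case=> -[t tP [-> ->]]; rewrite !inner_at /inner_xy; split;
  apply/negP => /orP[]/andP[H1 H2]; lra.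
Qed.

(** Only boundary points occur in the side pairs, so a chain of identifications
    that starts or ends at an interior point is trivial. *)
Lemma glued_inner (u v : poly) : glued u v ->
  inner (set_val u) || inner (set_val v) -> u = v.
Proof.
move=> /asboolP; elim=> {u v} [u v /side_pair_not_inner[/negbTE-> /negbTE->]||u v _ IH|u v w _ IH1 _ IH2] //.
  by rewrite orbC => /IH.
case/orP => [iu|iw].
  have e : u = v by apply: IH1; rewrite iu.
  by rewrite e; apply: IH2; rewrite -e iu.
have e : v = w by apply: IH2; rewrite iw orbT.
by rewrite -e; apply: IH1; rewrite e iw orbT.
Qed.

Lemma glue_eq (u v : poly) : glue u = glue v -> glued u v.
Proof. by move=> e; apply/eqquotP; exact: e. Qed.

Lemma glue_inner (u v : poly) : glue u = glue v -> inner (set_val u) -> u = v.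
Proof. by move=> /glue_eq uv iu; apply: glued_inner => //; rewrite iu. Qed.

Lemma glueK (s : S) : glue (repr s : poly) = s.
Proof. exact: reprK. Qed.

Definition polygon_point (zeta : C) (Z : poly zeta) : poly := exist _ zeta (mem_set Z).

Lemma pt_glue x y (P : poly (at_xy L x y)) : pt L x y = glue (polygon_point P).
Proof.
rewrite /pt; congr glue; apply: val_inj.
by rewrite insubdK //; exact: mem_set.
Qed.

Lemma glue_continuous : continuous glue.
Proof. exact: pi_continuous. Qed.

Definition inner_dom : set S := [set s | inner (set_val (repr s : poly))].

Lemma inner_dom_glue u : inner_dom (glue u) = inner (set_val u) :> Prop.
Proof.
rewrite /inner_dom /=; apply/propext; split => i.
  by rewrite -(glue_inner (glueK (glue u)) i).
by have e := glue_inner (esym (glueK (glue u))) i; rewrite /= -e.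
Qed.

Lemma repr_inner u : inner (set_val u) -> (repr (glue u) : poly) = u.
Proof. by move=> i; rewrite -(glue_inner (esym (glueK (glue u))) i). Qed.

Lemma near_inner zeta : inner zeta -> \forall w \near zeta, inner w.
Proof.
have cr : (fun w : C => re w - corner_x L) @ zeta --> re zeta - corner_x L.
  exact: (cvgB (@cvg_re _ _ (nbhs zeta) _ id zeta cvg_id) (cvg_cst _)).
have ci : (fun w : C => im w - corner_y L) @ zeta --> im zeta - corner_y L.
  exact: (cvgB (@cvg_im _ _ (nbhs zeta) _ id zeta cvg_id) (cvg_cst _)).
rewrite /inner /inner_xy => /orP[]/andP[/andP[a1 a2] /andP[a3 a4]];
  near=> w; apply/orP; [left|right]; apply/andP; split; apply/andP; split;
  near: w; by [exact: (cvgr_gt _ cr)|exact: (cvgr_lt _ cr)|exact: (cvgr_gt _ ci)|exact: (cvgr_lt _ ci)].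
Unshelve. all: by end_near. Qed.

End SurfaceTopology.

(** * Charts and continuity on the surface *)

Section SurfacePaths.
Context {R : realType} (L : Lshape R).
Local Notation C := (cplx R).
Local Notation h := ((side L)%:num).
Local Notation l := ((width L)%:num).
Local Notation poly := (polygon L).
Local Notation S := (surface L).
Local Notation glue := (@Defs.glue R L).

Definition flat_coord (s : S) : C := set_val (repr s : poly).

Lemma flat_coord_glue u : inner L (set_val u) -> flat_coord (glue u) = set_val u.
Proof. by move=> i; rewrite /flat_coord repr_inner. Qed.

Lemma open_inner_sub (W : set C) : open W ->
  open [set s : S | @inner_dom R L s /\ W (flat_coord s)].
Proof.
move=> oW.
suff : open (glue @^-1` [set s : S | @inner_dom R L s /\ W (flat_coord s)]) by [].
have -> : glue @^-1` [set s : S | @inner_dom R L s /\ W (flat_coord s)] =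
    set_val @^-1` ([set zeta | inner L zeta] `&` W).
  apply/seteqP; split => u /=; rewrite inner_dom_glue => -[i Wu].
    by split => //; rewrite -(flat_coord_glue i).
  by split => //; rewrite flat_coord_glue.
exists ([set zeta | inner L zeta] `&` W) => //.
apply: openI => //; rewrite openE => z; exact: near_inner.
Qed.

Lemma open_inner_dom : open (@inner_dom R L).
Proof.
have -> : @inner_dom R L = [set s : S | @inner_dom R L s /\ setT (flat_coord s)].
  by apply/seteqP; split => s //= [].
exact/open_inner_sub/openT.
Qed.

Lemma flat_coord_inj : {in @inner_dom R L &, injective flat_coord}.
Proof.
move=> s t _ _ e; rewrite -(glueK s) -(glueK t); congr Defs.glue.
exact: val_inj.
Qed.

Lemma flat_coord_continuous : {in @inner_dom R L, continuous flat_coord}.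
Proof.
move=> s /set_mem si V.
rewrite nbhsE => -[W [oW Ws] WV].
have oN := open_inner_sub oW.
apply: (@filterS _ (nbhs s) _ [set s : S | @inner_dom R L s /\ W (flat_coord s)]).
  by move=> t [_ /WV].
exact: open_nbhs_nbhs.
Qed.

Lemma near_val (u : poly) (P : set C) :
  (\forall z \near set_val u, P z) -> \forall v \near u, P (set_val v).
Proof. exact: initial_continuous. Qed.

Lemma flat_coordP (u : poly) : @inner_dom R L (glue u) ->
  \forall v \near u, flat_coord (glue v) ^+ 1 - flat_coord (glue u) ^+ 1
                       = set_val v - set_val u.
Proof.
rewrite inner_dom_glue => iu.
have := near_val (near_inner iu); apply: filterS => v iv.
by rewrite !flat_coord_glue.
Qed.

(** Away from the boundary of the polygon, its own coordinate is a chart, in which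
    d zeta has the coefficient 1. *)
Definition flat_loc : surface_loc L :=
  SurfaceLoc (or_introl (erefl 1%N)) open_inner_dom flat_coord_inj
    flat_coord_continuous flat_coordP.

(** The gluing map is continuous on the whole closed polygon: a path may begin
    and end on the sides. *)
Lemma pt_cvg (T : Type) (F : set_system T) {FF : Filter F} (x_ y_ : T -> R) x y :
  x_ @ F --> x -> y_ @ F --> y -> poly (at_xy L x y) ->
  (\forall t \near F, poly (at_xy L (x_ t) (y_ t))) ->
  (fun t => pt L (x_ t) (y_ t)) @ F --> pt L x y.
Proof.
move=> xF yF P PF; rewrite (pt_glue P).
have zF : (fun t => at_xy L (x_ t) (y_ t)) @ F --> (at_xy L x y : C).
  by apply: cvg_cpx; apply: cvgD => //; exact: cvg_cst.
move=> U nU; have : nbhs (polygon_point P) (glue @^-1` U) by exact: (glue_continuous nU).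
move=> [V [[W oW <-] /= Wz] VU].
rewrite /fmap /=.
have WF : \forall t \near F, W (at_xy L (x_ t) (y_ t)).
  by apply: zF; apply: open_nbhs_nbhs.
apply: filterS2 PF WF => t Pt Wt; rewrite /= (pt_glue Pt).
exact: VU.
Qed.

Lemma pt_inj x y x' y' : inner_xy L x y -> poly (at_xy L x' y') ->
  pt L x y = pt L x' y' -> x = x' /\ y = y'.
Proof.
move=> i P'; have P : poly (at_xy L x y) by apply: inner_polygon; rewrite inner_at.
rewrite (pt_glue P) (pt_glue P') => /glue_inner e.
have {}e : polygon_point P = polygon_point P' by apply: e; rewrite /= inner_at.
by have [/addrI-> /addrI->] := congr1 set_val e.
Qed.

(** The L-shape is star-shaped about the points of the open square P0, and the
    segment from a boundary point enters the interior at once. *)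
Lemma polygon_star x y e x0 y0 : poly (at_xy L x y) ->
  0 < x0 < h -> 0 < y0 < h -> 0 < e <= 1 ->
  inner_xy L (x + e * (x0 - x)) (y + e * (y0 - y)).
Proof.
have h0 : 0 < h by []. have l0 : 0 < l by [].
move=> /polygonP; rewrite /at_xy /re /im /= !(addrC (corner_x L), addrC (corner_y L)) !addrK.
move=> xy x0P y0P eP; rewrite /inner_xy; apply/orP; case: xy => -[xP yP]; [left|right];
 by apply/andP; split; apply/andP; split; nra.
Qed.

(** Derivatives are defined by limits at punctured neighborhoods; they are
    unique only at points that are not isolated. *)
Lemma surface_nonisolated (s : S) : ProperFilter s^'.
Proof.
split; last exact: dnbhs_filter.
rewrite /dnbhs /within /= => s0.
pose u : poly := repr s; pose z := set_val u.
pose x := re z - corner_x L; pose y := im z - corner_y L.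
have P : poly (at_xy L x y) by rewrite -at_xyE; exact: set_valP u.
have sE : s = pt L x y.
  rewrite (pt_glue P) -(glueK s); congr Defs.glue; apply: val_inj.
  by rewrite /= -at_xyE.
have h0 : 0 < h by [].
(* The segment from s to (x0, h / 2) leaves s because x0 differs from x. *)
have [x0 [x0P xx0]] : exists x0, 0 < x0 < h /\ x0 - x != 0.
  have [xh|xh] := eqVneq x (h / 2).
    exists (h / 3); split; first by lra.
    by rewrite xh lt_eqF //; lra.
  by exists (h / 2); split; [lra|rewrite subr_eq0 eq_sym].
have y0P : 0 < h / 2 < h by lra.
have cx : (fun e : R => x + e * (x0 - x)) @ 0^'+ --> x.
  rewrite -[X in _ --> X]addr0 -[X in _ --> _ + X](mul0r (x0 - x)).
  apply: cvgD; first exact: cvg_cst.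
  apply: cvgM; last exact: cvg_cst.
  exact: cvg_within.
have cy : (fun e : R => y + e * (h / 2 - y)) @ 0^'+ --> y.
  rewrite -[X in _ --> X]addr0 -[X in _ --> _ + X](mul0r (h / 2 - y)).
  apply: cvgD; first exact: cvg_cst.
  apply: cvgM; last exact: cvg_cst.
  exact: cvg_within.
have near01 : \forall e \near (0 : R)^'+, 0 < e <= 1.
  by near=> e; apply/andP; split; near: e; [exact: nbhs_right_gt|exact: nbhs_right_le].
have nP : \forall e \near (0 : R)^'+, inner_xy L (x + e * (x0 - x)) (y + e * (h / 2 - y)).
  by apply: filterS near01 => e; exact: polygon_star.
have nPp : \forall e \near (0 : R)^'+, poly (at_xy L (x + e * (x0 - x)) (y + e * (h / 2 - y))).
  by apply: filterS nP => e ie; apply: inner_polygon; rewrite inner_at.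
have c : (fun e => pt L (x + e * (x0 - x)) (y + e * (h / 2 - y))) @ (0 : R)^'+
    --> pt L x y by exact: (pt_cvg cx cy P nPp).
rewrite sE in s0.
have nF : \forall e \near (0 : R)^'+,
    pt L (x + e * (x0 - x)) (y + e * (h / 2 - y)) != pt L x y -> False.
  by apply: (c (fun t : S => t != pt L x y -> False)); apply: filterS s0.
have : \forall e \near (0 : R)^'+, False.
  near=> e.
  have : pt L (x + e * (x0 - x)) (y + e * (h / 2 - y)) != pt L x y -> False.
    by near: e.
  have i : inner_xy L (x + e * (x0 - x)) (y + e * (h / 2 - y)) by near: e.
  have e0 : 0 < e by near: e; exact: nbhs_right_gt.
  apply; apply/eqP => E; have [e1 _] := pt_inj i P E.
  have : e * (x0 - x) = 0 by apply: (addrI x); rewrite addr0.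
  by apply/eqP; rewrite mulf_neq0 // gt_eqF.
by move=> /filter_ex [].
Unshelve. all: by end_near. Qed.

End SurfacePaths.

(** * Straight paths as trajectories *)

Section PathODE.
Context {R : realType} (a : R) (L : Lshape R) (c : R) (phi : surface L -> curve a).
Local Notation C := (cplx R).
Local Notation f := (fpoly (rc a : C)).
Local Notation X := (curve a).
Local Notation S := (surface L).
Local Notation poly := (polygon L).
Implicit Types (s t : R).
Hypothesis bih : biholomorphic (surface_atlas L) (curve_atlas a) phi.

Lemma phi_inj : injective phi.
Proof. by case: bih => G [/can_inj]. Qed.

Lemma phi_continuous : continuous phi.
Proof. by case: bih => G [_ _ []]. Qed.

(** Transported from the polygon by the inverse of the uniformization. *)
Lemma curve_nonisolated (q : X) : ProperFilter q^'.
Proof.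
split; last exact: dnbhs_filter.
rewrite /dnbhs /within /= => q0.
case: bih => G [FG GF [cF _] _].
have n0 : nbhs q (fun y => y != q -> False) by apply: filterS q0.
have n1 : nbhs (G q) (fun u : S => phi u != q -> False).
  have h : phi @ G q --> phi (G q) by exact: cF.
  by rewrite GF in h; exact: (h _ n0).
have := surface_nonisolated (G q); case=> + _; apply.
rewrite /dnbhs /within /=; apply: filterS n1 => u + uG; apply.
by apply: contra uG => /eqP e; rewrite -e FG.
Qed.

Variables (omega : Defs.form (curve_atlas a)).
Hypothesis c0 : 0 < c.
Hypothesis hol : holomorphic_form omega.
Hypothesis omegaZ : forall p, curve_dom (a:=a) Zloc p -> omega Zloc p = (wc p)^-1.
Hypothesis pull : is_pullback phi (fun i p => rc c * omega i p) (@dzeta R L).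
Hypothesis a1 : 1 < a.

Variables (x0 y0 dx dy : R).
Definition straight_path (t : R) : S := pt L (x0 + t * dx) (y0 + t * dy).
Definition slope : C := cpx dx dy.
Hypothesis inn : forall t, 0 < t < 1 -> inner_xy L (x0 + t * dx) (y0 + t * dy).
Hypothesis slope0 : slope != 0.

Let P t := phi (straight_path t).
Let k : C := slope / rc c.

Lemma near01 (t : R) : 0 < t < 1 -> \forall s \near t, 0 < s < 1.
Proof.
move=> /andP[t0 t1]; near=> s; apply/andP; split; near: s.
  exact: lt_nbhsr.
exact: lt_nbhsl.
Unshelve. all: by end_near. Qed.

Lemma path_flat t : 0 < t < 1 ->
  flat_coord (straight_path t) = at_xy L (x0 + t * dx) (y0 + t * dy).
Proof.
move=> t01; have PP : poly (at_xy L (x0 + t * dx) (y0 + t * dy)).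
  by apply: inner_polygon; rewrite inner_at inn.
by rewrite /straight_path (pt_glue PP) flat_coord_glue //= inner_at inn.
Qed.

Lemma path_inner_dom t : 0 < t < 1 -> inner_dom (straight_path t).
Proof.
move=> t01; have PP : poly (at_xy L (x0 + t * dx) (y0 + t * dy)).
  by apply: inner_polygon; rewrite inner_at inn.
by rewrite /straight_path (pt_glue PP) inner_dom_glue /= inner_at inn.
Qed.

Lemma path_flatB s t : 0 < s < 1 -> 0 < t < 1 ->
  flat_coord (straight_path s) - flat_coord (straight_path t) = rc (s - t) * slope.
Proof.
move=> s01 t01; rewrite !path_flat // /slope; apply: cplx_eq;
  rewrite ?reB ?imB ?reM ?imM /at_xy /re /im /=; ring.
Qed.

Lemma affine_cvg (x d t : R) (F : set_system R) {FF : Filter F} :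
  (F --> t) -> (fun s => x + s * d) @ F --> x + t * d.
Proof.
move=> h; have k1 : (fun s : R => s) @ F --> t by exact: h.
exact: (cvgD (cvg_cst _) (cvgM k1 (cvg_cst _))).
Qed.

Lemma path_cvg (t : R) (F : set_system R) {FF : Filter F} : (F --> t) ->
  poly (at_xy L (x0 + t * dx) (y0 + t * dy)) ->
  (\forall s \near F, poly (at_xy L (x0 + s * dx) (y0 + s * dy))) ->
  straight_path @ F --> straight_path t.
Proof.
move=> Ft Pt PF; apply: pt_cvg => //; exact: affine_cvg.
Qed.

(** A straight path is injective, so that a derivative on the surface can be
    composed with it. *)
Lemma path_dnbhs t : 0 < t < 1 -> straight_path @ t^' --> (straight_path t)^'.
Proof.
move=> t01.
have i01 := near01 t01.
have c1 : straight_path @ t --> straight_path t.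
  apply: path_cvg => //; first by apply: inner_polygon; rewrite inner_at inn.
  by apply: filterS i01 => s s01; apply: inner_polygon; rewrite inner_at inn.
move=> U; rewrite /dnbhs /within /= => nU.
have {}nU : \forall s \near t, straight_path s != straight_path t -> U (straight_path s) by exact: (c1 _ nU).
rewrite /fmap /= nbhs_simpl /=.
apply: filterS2 i01 nU => s s01 h st; apply: h.
apply/eqP => e; have := path_flatB s01 t01; rewrite e subrr => /esym/eqP.
by rewrite mulf_eq0 (negbTE slope0) orbF rc_eq0 subr_eq0 (negbTE st).
Qed.

Lemma path_cderiv (G : S -> C) t d : 0 < t < 1 ->
  has_deriv (@flat_coord R L) G (straight_path t) d ->
  cderiv (fun s => G (straight_path s)) t (slope * d).
Proof.
move=> t01 Gd.
have H : (fun s => (G (straight_path s) - G (straight_path t)) /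
    (flat_coord (straight_path s) - flat_coord (straight_path t))) @ t^' --> d.
  exact: (cvg_comp straight_path (fun q => (G q - G (straight_path t)) /
    (flat_coord q - flat_coord (straight_path t))) (path_dnbhs t01) Gd).
have K : (fun s => slope * ((G (straight_path s) - G (straight_path t)) /
    (flat_coord (straight_path s) - flat_coord (straight_path t)))) @ t^' --> slope * d.
  exact: (cvgM (cvg_cst _) H).
apply: cvg_trans K; apply: near_eq_cvg.
have i01 : \forall s \near t^', 0 < s < 1 by exact: (nbhs_dnbhs (near01 t01)).
have st : \forall s \near t^', s != t by exact: near_neq.
apply: filterS2 i01 st => s s01 st; rewrite path_flatB //.
by field; rewrite slope0 rc_sub_neq0.
Qed.

(** The pullback equation, read along the path: the coefficient of the form
    times the velocity of the path is constant, in every chart. *)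
Lemma path_velocity j t : 0 < t < 1 -> curve_dom (a:=a) j (P t) ->
  exists2 D, cderiv (fun s => curve_coord (a:=a) j (P s)) t D &
    omega j (P t) * D = k.
Proof.
move=> t01 jP.
have [d dP e] := @pull (flat_loc L) j (straight_path t) (path_inner_dom t01) jP.
exists (slope * d); first exact: (path_cderiv t01 dP).
have c0' : rc c != 0 :> C by rewrite rc_eq0 gt_eqF.
move: e; rewrite /dzeta /= expr0 mulr1 => e.
have -> : omega j (P t) * (slope * d) =
    slope * (rc c * omega j (P t) * d) / rc c by field.
by rewrite -e mulr1.
Qed.

Lemma k_neq0 : k != 0.
Proof. by rewrite mulf_neq0 // invr_eq0 rc_eq0 gt_eqF. Qed.

(** The coefficient of dz/w vanishes at infinity, while its product with the
    velocity of the path is the nonzero number k. *)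
Lemma path_finite t : 0 < t < 1 -> P t <> None.
Proof.
move=> t01 PN.
have PT : curve_dom (a:=a) Tloc (P t) by move=> h; case: (h PN).
have [D _ e] := path_velocity t01 PT.
have := k_neq0; rewrite -e PN.
by rewrite (omega_infinity hol omegaZ curve_nonisolated) mul0r eqxx.
Qed.

Lemma P_dnbhs t : 0 < t < 1 -> P @ t^' --> (P t)^'.
Proof.
move=> t01.
have h : phi @ (straight_path t)^' --> (P t)^'.
  move=> U; rewrite /dnbhs /within /= => nU.
  have h1 : \forall u \near straight_path t, phi u != P t -> U (phi u).
    exact: (phi_continuous nU).
  rewrite /fmap /= nbhs_simpl /=; apply: filterS h1 => u h1 ut; apply: h1.
  by apply: contra ut => /eqP/phi_inj ->.
exact: (cvg_comp straight_path phi (path_dnbhs t01) h).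
Qed.

Lemma Z_cvg t : 0 < t < 1 -> (fun s => zc (P s)) @ t^' --> zc (P t).
Proof.
by move=> t01; exact: (cvg_comp P (@zc R a) (P_dnbhs t01) (zc_cvg_dnbhs (path_finite t01))).
Qed.

Lemma W_cvg t : 0 < t < 1 -> (fun s => wc (P s)) @ t^' --> wc (P t).
Proof.
by move=> t01; exact: (cvg_comp P (@wc R a) (P_dnbhs t01) (wc_cvg_dnbhs (path_finite t01))).
Qed.

Lemma simple_roots (z : C) : f.[z] = 0 -> f^`().[z] != 0.
Proof.
have a0 : rc a != 0 :> C by rewrite rc_eq0 gt_eqF // (lt_trans _ a1).
have aa : rc a ^+ 2 - 1 != 0 :> C.
  by rewrite -rcX -rc1 -rcB rc_eq0 subr_eq0 gt_eqF // exprn_egt1.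
rewrite fpolyE dfpolyE => /eqP; rewrite !mulf_eq0 !subr_eq0 -orbA => /or3P[]/eqP z0.
- by rewrite z0 !expr0n /= !mulr0 subr0 add0r expf_neq0.
- have -> : 5 * z ^+ 4 - 3 * (1 + rc a ^+ 2) * z ^+ 2 + rc a ^+ 2 = -2 * (rc a ^+ 2 - 1).
    by rewrite -[4%N]/(2 * 2)%N exprM z0; ring.
  by rewrite mulf_neq0 // oppr_eq0 pnatr_eq0.
- have -> : 5 * z ^+ 4 - 3 * (1 + rc a ^+ 2) * z ^+ 2 + rc a ^+ 2 =
      2 * rc a ^+ 2 * (rc a ^+ 2 - 1).
    by rewrite -[4%N]/(2 * 2)%N exprM z0; ring.
  by rewrite !mulf_neq0 // ?pnatr_eq0 // expf_neq0.
Qed.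

(** The coordinate z gives the velocity of z where w is nonzero, and w gives the
    velocity of w where f' is nonzero; the relation w^2 = f z gives the other
    velocity.  One of the two cases always holds because f has simple roots. *)
Lemma path_ode t : 0 < t < 1 ->
  cderiv (fun s => zc (P s)) t (k * wc (P t)) /\
  cderiv (fun s => wc (P s)) t (k * (f^`().[zc (P t)] / 2)).
Proof.
move=> t01; have PN := path_finite t01.
have [f0|f0] := eqVneq f^`().[zc (P t)] 0.
  have w0 : wc (P t) != 0.
    apply/negP => /eqP w0; have := curve_eqn PN; rewrite w0 expr0n => /esym.
    by move=> /simple_roots; rewrite f0 eqxx.
  have PZ := Zloc_dom PN w0.
  have [D DP e] := path_velocity t01 PZ.
  have ww : wc (P t) + wc (P t) != 0 by rewrite -mulr2n mulrn_eq0.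
  have {D DP e} Zd : cderiv (fun s => zc (P s)) t (k * wc (P t)).
    have -> : k * wc (P t) = D by rewrite -e (omegaZ PZ); field.
    exact: DP.
  split; [exact: Zd|rewrite /cderiv].
  have H : (fun s => (zc (P s) - zc (P t)) / rc (s - t) *
      (fdq (rc a) (zc (P s)) (zc (P t)) / (wc (P s) + wc (P t)))) @ t^' -->
      k * wc (P t) * (f^`().[zc (P t)] / (wc (P t) + wc (P t))).
    exact: (cvgM Zd (cvgM (@fdq_cvg _ (rc a) _ _ _ _ _ (Z_cvg t01))
      (cvgV ww (cvgD (W_cvg t01) (cvg_cst _))))).
  have -> : k * (f^`().[zc (P t)] / 2) =
      k * wc (P t) * (f^`().[zc (P t)] / (wc (P t) + wc (P t))).
    by rewrite -mulr2n -mulr_natl; field.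
  apply: cvg_trans H; apply: near_eq_cvg.
  have n1 : \forall s \near t^', [/\ P s <> None, zc (P s) - zc (P t) != 0 &
      wc (P s) + wc (P t) != 0] by exact: (P_dnbhs t01 (near_zc_neq PN w0)).
  have n2 := near_neq t.
  apply: filterS2 n1 n2 => s [sN zs ws] st.
  have E := curve_slope PN sN.
  rewrite mulrAC mulrA E mulfK //.
have PW : curve_dom (a:=a) Wloc (P t) by split => //; apply/eqP.
have [D DP] := path_velocity t01 PW.
rewrite (omega_Wloc hol omegaZ curve_nonisolated PN f0) => e.
have {D DP e} Wd : cderiv (fun s => wc (P s)) t (k * (f^`().[zc (P t)] / 2)).
  have -> : k * (f^`().[zc (P t)] / 2) = D by rewrite -e; field.
  exact: DP.
split; [rewrite /cderiv|exact: Wd].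
have H : (fun s => (wc (P s) - wc (P t)) / rc (s - t) *
      ((wc (P s) + wc (P t)) / fdq (rc a) (zc (P s)) (zc (P t)))) @ t^' -->
      k * (f^`().[zc (P t)] / 2) * ((wc (P t) + wc (P t)) / f^`().[zc (P t)]).
    exact: (cvgM Wd (cvgM (cvgD (W_cvg t01) (cvg_cst _))
      (cvgV f0 (@fdq_cvg _ (rc a) _ _ _ _ _ (Z_cvg t01))))).
have -> : k * wc (P t) =
    k * (f^`().[zc (P t)] / 2) * ((wc (P t) + wc (P t)) / f^`().[zc (P t)]).
  by rewrite -mulr2n -mulr_natl; field.
apply: cvg_trans H; apply: near_eq_cvg.
have n1 : \forall s \near t^', [/\ P s <> None, wc (P s) - wc (P t) != 0 &
    fdq (rc a) (zc (P s)) (zc (P t)) != 0].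
  exact: (P_dnbhs t01 (near_wc_neq PN f0)).
have n2 := near_neq t.
apply: filterS2 n1 n2 => s [sN zs ws] st.
have E := curve_slope PN sN.
by rewrite mulrAC mulrA -E mulfK.
Qed.

End PathODE.

(** * Uniqueness of trajectories *)

Section LinearODE.
Context {R : realType}.
Local Notation C := (cplx R).
Implicit Types (s t A B : R).

(** D exp (- K t) has a nonpositive derivative. *)
Lemma gronwall (D D' : R -> R) (K t0 b : R) : t0 < b ->
  (forall t, t0 <= t <= b -> is_derive t 1 D (D' t)) ->
  (forall t, t0 <= t <= b -> D' t <= K * D t) ->
  D t0 = 0 -> D b <= 0.
Proof.
move=> t0b Dd DK D0.
pose g (t : R) := D t * expR (- K * t).
pose g' (t : R) := (D' t - K * D t) * expR (- K * t).
have gd t : t0 <= t <= b -> is_derive t 1 g (g' t).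
  move=> tP; have Dt := Dd t tP.
  have : is_derive t 1 g (D t *: (expR (- K * t) *: (- K *: 1)) + expR (- K * t) *: D' t).
    apply: is_deriveM.
  have -> // : D t *: (expR (- K * t) *: (- K *: 1)) + expR (- K * t) *: D' t = g' t.
  by rewrite /g' /GRing.scale /=; ring.
have cg : {within `[t0, b], continuous g}.
  apply: derivable_within_continuous => t; rewrite in_itv /= => tP.
  by have [] := gd t tP.
have [t tP e] : exists2 t, t \in `]t0, b[%R & g b - g t0 = g' t * (b - t0).
  apply: MVT t0b _ cg => t; rewrite in_itv /= => /andP[h1 h2].
  by apply: gd; rewrite !ltW.
move: tP; rewrite in_itv /= => /andP[h1 h2].
have : g b <= 0.
  have gt0 : g t0 = 0 by rewrite /g D0 mul0r.
  rewrite gt0 subr0 in e; rewrite e.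
  rewrite mulr_le0_ge0 ?subr_ge0 ?(ltW t0b) // /g' mulr_le0_ge0 ?expR_ge0 //.
  by rewrite subr_le0 DK // !ltW.
by rewrite /g pmulr_lle0 // expR_gt0.
Qed.

Lemma two_mul_le (x y m M : R) : `|m| <= M -> 2 * (m * (x * y)) <= M * (x ^+ 2 + y ^+ 2).
Proof.
rewrite ler_norml => /andP[h1 h2].
have p1 : 0 <= (M + m) * (x - y) ^+ 2 by rewrite mulr_ge0 ?sqr_ge0 //; lra.
have p2 : 0 <= (M - m) * (x + y) ^+ 2 by rewrite mulr_ge0 ?sqr_ge0 //; lra.
nra.
Qed.

Definition sqn (z : C) : R := re z ^+ 2 + im z ^+ 2.

Lemma sqn_ge0 z : 0 <= sqn z.
Proof. by rewrite addr_ge0 ?sqr_ge0. Qed.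

Lemma sqn_le0 z : sqn z <= 0 -> z = 0.
Proof.
rewrite /sqn => h; have r0 := sqr_ge0 (re z); have i0 := sqr_ge0 (im z).
have /eqP : re z ^+ 2 = 0 by lra.
have /eqP : im z ^+ 2 = 0 by lra.
by rewrite !sqrf_eq0 => /eqP i /eqP r; apply: cplx_eq.
Qed.

Lemma cderiv_sqn (F : R -> C) t d : cderiv F t d ->
  is_derive t 1 (fun s => sqn (F s)) (2 * (re (F t) * re d + im (F t) * im d)).
Proof.
move=> Fd; have h1 := cderiv_re Fd; have h2 := cderiv_im Fd.
rewrite /sqn; apply: is_derive_eq.
by rewrite /GRing.scale /=; ring.
Qed.

Lemma cplx_bounded (q : R -> C) t0 b : t0 <= b ->
  (forall t, t0 <= t <= b -> q @ t --> q t) ->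
  exists M, forall t, t0 <= t <= b -> `|re (q t)| <= M /\ `|im (q t)| <= M.
Proof.
move=> t0b qc.
have bd (g : R -> R) : (forall t, t0 <= t <= b -> g @ t --> g t) ->
    exists M, forall t, t0 <= t <= b -> `|g t| <= M.
  move=> gc.
  have [x xP xM] : exists2 x, x \in `[t0, b]%R &
      forall t, t \in `[t0, b]%R -> `|g t| <= `|g x|.
    apply: (@EVT_max _ (fun t => `|g t|)) => //.
    apply: continuous_in_subspaceT => t; rewrite inE /= in_itv /= => tP.
    exact: cvg_norm (gc t tP).
  by exists `|g x| => t tP; apply: xM; rewrite in_itv.
have [M1 h1] := bd (fun t => re (q t)) (fun t tP => cvg_re (qc t tP)).
have [M2 h2] := bd (fun t => im (q t)) (fun t tP => cvg_im (qc t tP)).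
exists (Num.max M1 M2) => t tP; split; rewrite le_max.
  by rewrite h1.
by rewrite h2 // orbT.
Qed.

(** The sum of the squared moduli of d and e satisfies the hypothesis of
    Gronwall's inequality on every compact subinterval. *)
Lemma linear_ode_forward (B t0 : R) (d e q : R -> C) (k : C) :
  (forall t, t0 <= t < B -> cderiv d t (k * e t) /\ cderiv e t (q t * d t)) ->
  (forall t, t0 <= t < B -> q @ t --> q t) ->
  d t0 = 0 -> e t0 = 0 -> forall t, t0 <= t < B -> d t = 0 /\ e t = 0.
Proof.
move=> de qc d0 e0 b /andP[]; rewrite le_eqVlt => /predU1P[<- //|t0b bB].
have inB t : t0 <= t <= b -> t0 <= t < B.
  by move=> /andP[-> tb] /=; exact: le_lt_trans tb bB.
have [M0 h0] := @cplx_bounded (fun=> k) t0 b (ltW t0b) (fun t _ => cvg_cst _).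
have [M1 h1] := cplx_bounded (ltW t0b) (fun t tP => qc t (inB t tP)).
pose M := Num.max M0 M1.
have kM t : t0 <= t <= b -> [/\ `|re k| <= M, `|im k| <= M, `|re (q t)| <= M &
    `|im (q t)| <= M].
  move=> tP; have [? ?] := h0 t tP; have [? ?] := h1 t tP.
  by split; rewrite /M le_max; apply/orP; by [left|right].
pose N t := sqn (d t) + sqn (e t).
pose N' t := 2 * (re (d t) * re (k * e t) + im (d t) * im (k * e t)) +
  2 * (re (e t) * re (q t * d t) + im (e t) * im (q t * d t)).
have Nd t : t0 <= t <= b -> is_derive t 1 N (N' t).
  move=> /inB /de [dd ed].
  have := cderiv_sqn dd; have := cderiv_sqn ed => h2 h3.
  exact: is_deriveD.
have NN t : t0 <= t <= b -> N' t <= (4 * M) * N t.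
  move=> /kM[k1 k2 q1 q2]; rewrite /N' /N /sqn !reM !imM.
  move: (re (d t)) (im (d t)) (re (e t)) (im (e t)) => x1 x2 y1 y2.
  have := two_mul_le x1 y1 k1.
  have := two_mul_le x2 y2 k1.
  have := two_mul_le x2 y1 k2.
  have k2' : `|- im k| <= M by rewrite normrN.
  have := two_mul_le x1 y2 k2'.
  have := two_mul_le x1 y1 q1.
  have := two_mul_le x2 y2 q1.
  have := two_mul_le x1 y2 q2.
  have q2' : `|- im (q t)| <= M by rewrite normrN.
  have := two_mul_le x2 y1 q2'.
  move: (re k) (im k) (re (q t)) (im (q t)) => kr ki qr qi; lra.
have Nb : N b <= 0.
  apply: (gronwall t0b Nd NN); rewrite /N d0 e0 /sqn /= !expr0n /= !addr0 //.
have s1 := sqn_ge0 (d b); have s2 := sqn_ge0 (e b).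
by split; apply: sqn_le0; rewrite /N in Nb; lra.
Qed.

(** Times before t0 are reduced to times after t0 by reversing time; the sign
    of e changes, to keep the form of the system. *)
Lemma linear_ode_unique (A B t0 : R) (d e q : R -> C) (k : C) :
  A < t0 < B ->
  (forall t, A < t < B -> cderiv d t (k * e t) /\ cderiv e t (q t * d t)) ->
  (forall t, A < t < B -> q @ t --> q t) ->
  d t0 = 0 -> e t0 = 0 -> forall t, A < t < B -> d t = 0 /\ e t = 0.
Proof.
move=> /andP[At0 t0B] de qc d0 e0 t /andP[At tB].
have [t0t|tt0] := leP t0 t.
  apply: (@linear_ode_forward B t0 d e q k) => //; last by rewrite t0t.
  - by move=> s /andP[h1 h2]; apply: de; rewrite h2 (lt_le_trans At0).
  - by move=> s /andP[h1 h2]; apply: qc; rewrite h2 (lt_le_trans At0).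
pose d1 s := d (0 - s); pose e1 s := - e (0 - s); pose q1 s := q (0 - s).
have inAB s : - t0 <= s < - A -> A < 0 - s < B.
  by move=> /andP[h1 h2]; apply/andP; split; lra.
have := @linear_ode_forward (- A) (- t0) d1 e1 q1 k _ _ _ _ (- t).
rewrite /d1 /e1 sub0r !opprK => H; case: H.
- move=> s /inAB /de [dd ed]; split.
    by rewrite mulrN; exact: (cderiv_reflect dd).
  by rewrite /q1 -[_ * _]opprK; apply: cderivN; exact: (cderiv_reflect ed).
- move=> s /inAB /qc qs; rewrite /q1.
  have h : (fun u : R => 0 - u) @ s --> 0 - s.
    exact: (cvgB (cvg_cst _) cvg_id).
  exact: (cvg_comp _ _ h qs).
- by rewrite d0.
- by rewrite e0 oppr0.
- by rewrite lerN2 ltrN2 At (ltW tt0).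
by rewrite !add0r => -> /eqP; rewrite oppr_eq0 => /eqP ->.
Qed.

Variable a : R.
Local Notation f := (fpoly (rc a : C)).

Definition hyperelliptic_flow (A B : R) (k : C) (z w : R -> C) :=
  forall t, A < t < B ->
    cderiv z t (k * w t) /\ cderiv w t (k * (f^`().[z t] / 2)).

(** The difference of two solutions satisfies a linear system, because f' is a
    polynomial. *)
Lemma flow_unique (A B t0 : R) (k : C) (z w z1 w1 : R -> C) : A < t0 < B ->
  hyperelliptic_flow A B k z w -> hyperelliptic_flow A B k z1 w1 ->
  z t0 = z1 t0 -> w t0 = w1 t0 ->
  forall t, A < t < B -> z t = z1 t /\ w t = w1 t.
Proof.
move=> t0P zw zw1 z0 w0 t tP.
pose q t := k / 2 * dfdq (rc a) (z t) (z1 t).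
have := @linear_ode_unique A B t0 (fun t => z t - z1 t) (fun t => w t - w1 t) q k t0P.
move=> H; case: (H _ _ _ _ t tP) => [{}t {}tP|{}t {}tP|||/subr0_eq ? /subr0_eq //].
- have [zd wd] := zw t tP; have [z1d w1d] := zw1 t tP; split.
    by rewrite mulrBr; exact: (cderivB zd z1d).
  have -> : q t * (z t - z1 t) = k * (f^`().[z t] / 2) - k * (f^`().[z1 t] / 2).
    by rewrite -mulrBr -mulrBl dfdqP /q; field.
  exact: (cderivB wd w1d).
- have [/cderiv_continuous zd _] := zw t tP; have [/cderiv_continuous z1d _] := zw1 t tP.
  have sq (F : R -> C) : F @ t --> F t -> (fun s => F s ^+ 2) @ t --> F t ^+ 2.
    by move=> h; rewrite expr2; under eq_cvg do rewrite expr2; exact: (cvgM h h).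
  exact: (cvgM (cvg_cst _) (cvgB (cvgM (cvgM (cvg_cst _) (cvgD zd z1d))
    (cvgD (sq _ zd) (sq _ z1d))) (cvgM (cvg_cst _) (cvgD zd z1d)))).
- by rewrite z0 subrr.
- by rewrite w0 subrr.
Qed.

End LinearODE.

(** * Improper substitution *)

Section ImproperSubstitution.
Context {R : realType}.
Notation mu := (@lebesgue_measure R).
Implicit Types (a b A B : R) (F G : R -> R).

Lemma continuous_measurable_oo a b G : {in `]a, b[, continuous G} ->
  measurable_fun `]a, b[ (EFin \o G).
Proof.
move=> cG; apply/measurable_EFinP; apply: open_continuous_measurable_fun.
  exact: interval_open.
by move=> x; rewrite inE /= => xab; exact: cG.
Qed.

(** Monotone convergence on an exhaustion by compact intervals. *)
Lemma exhaust_integral a b G (a_ b_ : nat -> R) :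
  {in `]a, b[, continuous G} -> {in `]a, b[, forall x, 0 <= G x} ->
  (forall n, a < a_ n) -> (forall n, b_ n < b) ->
  nonincreasing_seq a_ -> nondecreasing_seq b_ ->
  (forall x, a < x < b -> exists n, a_ n <= x <= b_ n) ->
  (\int[mu]_(x in `[a_ n, b_ n]) (G x)%:E)%E @[n --> \oo] -->
  (\int[mu]_(x in `]a, b[) (G x)%:E)%E.
Proof.
move=> cG G0 aa bb da nb ex.
have -> : (`]a, b[)%classic = \bigcup_n `[a_ n, b_ n]%classic.
  apply/seteqP; split => x /=.
    by rewrite in_itv /= => /ex [n nP]; exists n => //=; rewrite in_itv.
  move=> [n _ /=]; rewrite !in_itv /= => /andP[h1 h2].
  by rewrite (lt_le_trans (aa n) h1) (le_lt_trans h2 (bb n)).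
have sub n : (`[a_ n, b_ n] `<=` `]a, b[)%classic.
  move=> x /=; rewrite !in_itv /= => /andP[h1 h2].
  by rewrite (lt_le_trans (aa n) h1) (le_lt_trans h2 (bb n)).
apply: ge0_nondecreasing_set_cvg_integral.
- apply/nondecreasing_seqP => n; apply/subsetPset => x /=; rewrite !in_itv /=.
  move=> /andP[h1 h2]; apply/andP; split.
    by apply: le_trans h1; apply: da.
  by apply: (le_trans h2); apply: nb.
- by [].
- move=> n; apply: (measurable_funS _ (@sub n)) => //.
  exact: continuous_measurable_oo.
- by move=> n x /sub xab; rewrite lee_fin; apply: G0.
Qed.

Lemma exhaust_seq a b : a < b -> exists a_ b_ : nat -> R,
  [/\ (forall n, a < a_ n), (forall n, b_ n < b), (forall n, a_ n < b_ n),
      nonincreasing_seq a_ & nondecreasing_seq b_] /\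
  (forall x, a < x < b -> exists n, a_ n <= x <= b_ n).
Proof.
(* The denominator n.+3 gives a_ n < b_ n already for n = 0. *)
move=> ab; pose e n : R := (b - a) / (n.+3)%:R.
have e0 n : 0 < e n by rewrite divr_gt0 // subr_gt0.
have de : nonincreasing_seq e.
  move=> m n mn; rewrite /e ler_pM2l ?subr_gt0 // lef_pV2 ?posrE // ler_nat.
  by rewrite !ltnS.
have e3 n : 3 * e n <= b - a.
  rewrite /e mulrCA ler_piMr ?subr_ge0 ?(ltW ab) // ler_pdivrMr // mul1r.
  by rewrite ler_nat.
exists (fun n => a + e n), (fun n => b - e n); split; first split.
- by move=> n; rewrite ltrDl.
- by move=> n; rewrite gtrDl oppr_lt0.
- by move=> n; have := e3 n; have := e0 n; lra.
- by move=> m n mn; rewrite lerD2l; apply: de.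
- by move=> m n mn; rewrite lerD2l lerN2; apply: de.
- move=> x /andP[ax xb].
  pose d := Num.min (x - a) (b - x).
  have d0 : 0 < d by rewrite lt_min !subr_gt0 ax xb.
  pose n := Num.truncn ((b - a) / d).
  have en : e n <= d.
    rewrite /e ler_pdivrMr // mulrC -ler_pdivrMr //.
    have := truncnS_gt ((b - a) / d); rewrite -/n => h.
    by apply: (le_trans (ltW h)); rewrite ler_nat !ltnS leqW.
  exists n; move: en; rewrite le_min => /andP[h1 h2]; apply/andP; split; lra.
Qed.

(** The function F is only required to be well behaved on the open interval,
    and G may be unbounded near its ends: the substitution is made on compact
    subintervals, and both sides converge monotonically. *)
Lemma improper_substitution_increasing a b A B F F' G : a < b ->
  (forall x, a < x < b -> A < F x < B) ->
  (forall y, A < y < B -> exists2 x, a < x < b & F x = y) ->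
  (forall x, a < x < b -> is_derive x 1 F (F' x)) ->
  (forall x, a < x < b -> 0 < F' x) ->
  {in `]a, b[, continuous F'} ->
  {in `]A, B[, continuous G} -> {in `]A, B[, forall y, 0 <= G y} ->
  (\int[mu]_(y in `]A, B[) (G y)%:E = \int[mu]_(x in `]a, b[) (G (F x) * F' x)%:E)%E.
Proof.
move=> ab FAB Fsurj dF F'0 cF' cG G0.
have [a_ [b_ [[aa bb abn da nb] ex]]] := exhaust_seq ab.
have inab n x : a_ n <= x <= b_ n -> a < x < b.
  by move=> /andP[h1 h2]; rewrite (lt_le_trans (aa n) h1) (le_lt_trans h2 (bb n)).
have F'E x : a < x < b -> (derive1 F) x = F' x.
  by move=> /dF [_ h]; rewrite derive1E.
have cF : {in `]a, b[, continuous F}.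
  move=> x; rewrite in_itv /= => /dF [h _]; apply: differentiable_continuous.
  exact/derivable1_diffP.
have Finc x y : a < x -> x < y -> y < b -> F x < F y.
  move=> ax xy yb; apply: (@gtr0_derive1_lt_oo _ F a b) => //.
  - by move=> z; rewrite in_itv /= => /dF [].
  - by move=> z; rewrite in_itv /= => zab; rewrite F'E // F'0.
  - by move=> z /set_mem; exact: cF.
  - by rewrite in_itv /= ax (lt_trans xy).
  - by rewrite in_itv /= yb (lt_trans ax).
have Fle x y : a < x -> x <= y -> y < b -> F x <= F y.
  by move=> ax; rewrite le_eqVlt => /predU1P[->//|xy] yb; apply/ltW/Finc.
have an n : a < a_ n < b by apply: (@inab n); rewrite lexx ltW.
have bn n : a < b_ n < b by apply: (@inab n); rewrite lexx ltW.
have cF1 : {in `]a, b[, continuous (derive1 F)}.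
  move=> x xab; rewrite /continuous_at F'E; last by rewrite in_itv in xab.
  apply: cvg_trans (cF' x xab); apply: near_eq_cvg.
  near=> z; rewrite F'E //; have : z \in `]a, b[ by near: z; exact: near_in_itvoo.
  by rewrite in_itv.
have H1 : (\int[mu]_(y in `[F (a_ n), F (b_ n)]) (G y)%:E)%E @[n --> \oo] -->
    (\int[mu]_(y in `]A, B[) (G y)%:E)%E.
  apply: exhaust_integral => //.
  - by move=> n; have /FAB/andP[] := an n.
  - by move=> n; have /FAB/andP[] := bn n.
  - move=> m n mn; have /andP[h1 _] := an n; have /andP[_ h2] := an m.
    by apply: Fle => //; apply: da.
  - move=> m n mn; have /andP[h1 _] := bn m; have /andP[_ h2] := bn n.
    by apply: Fle => //; apply: nb.
  - move=> y /Fsurj[x xab <-]; have [n nP] := ex x xab; exists n.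
    move: (nP) (inab n x nP) => /andP[h1 h2] /andP[h3 h4].
    by rewrite !Fle //.
have H2 : (\int[mu]_(x in `[a_ n, b_ n]) (G (F x) * F' x)%:E)%E @[n --> \oo] -->
    (\int[mu]_(x in `]a, b[) (G (F x) * F' x)%:E)%E.
  apply: exhaust_integral => //.
    move=> x xab; apply: cvgM; last exact: cF'.
    apply: (cvg_comp F G); first exact: cF.
    by apply: cG; move: xab; rewrite !in_itv /=; exact: FAB.
  move=> x; rewrite in_itv /= => xab; rewrite mulr_ge0 //; last exact/ltW/F'0.
  by apply: G0; rewrite in_itv /=; exact: FAB.
apply: (cvg_unique _ H1); first exact: ereal_hausdorff.
apply: cvg_trans H2; apply: near_eq_cvg.
apply: nearW => n.
have sub x : x \in `[a_ n, b_ n] -> x \in `]a, b[.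
  by rewrite !in_itv /=; exact: inab.
rewrite integration_by_substitution_increasing //.
- apply: eq_integral => x; rewrite inE /= => /sub.
  by rewrite in_itv /= => /F'E <-.
- exact: ltW.
- move=> x y; rewrite !in_itv /= => /inab/andP[h1 h2] /inab/andP[h3 h4] xy.
  exact: Finc.
- by move=> x xab; apply: cF1; apply: sub; exact: subset_itv_oo_cc.
- apply/cvg_ex; exists ((derive1 F) (a_ n)); apply: cvg_at_right_filter.
  by apply: cF1; rewrite in_itv /= an.
- apply/cvg_ex; exists ((derive1 F) (b_ n)); apply: cvg_at_left_filter.
  by apply: cF1; rewrite in_itv /= bn.
- split.
  + move=> x xab; have := sub x (subset_itv_oo_cc xab).
    by rewrite in_itv /= => /dF [].
  + by apply: cvg_at_right_filter; apply: cF; rewrite in_itv /= an.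
  + by apply: cvg_at_left_filter; apply: cF; rewrite in_itv /= bn.
- apply: continuous_in_subspaceT => y; rewrite inE /= in_itv /= => /andP[h1 h2].
  apply: cG; rewrite in_itv /=.
  have /FAB/andP[h3 _] := an n; have /FAB/andP[_ h4] := bn n.
  by rewrite (lt_le_trans h3 h1) (le_lt_trans h2 h4).
Unshelve. all: by end_near. Qed.

(** An increasing function that is continuous up to the endpoints maps the open
    interval onto an open interval. *)
Lemma improper_substitution a b F F' G : a < b ->
  {within `[a, b], continuous F} ->
  (forall x, a < x < b -> is_derive x 1 F (F' x)) ->
  (forall x, a < x < b -> 0 < F' x) ->
  {in `]a, b[, continuous F'} ->
  {in `]F a, F b[, continuous G} -> {in `]F a, F b[, forall y, 0 <= G y} ->
  (\int[mu]_(y in `]F a, F b[) (G y)%:E = \int[mu]_(x in `]a, b[) (G (F x) * F' x)%:E)%E.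
Proof.
move=> ab cF dF F'0 cF' cG G0.
have Finc x y : a <= x -> x < y -> y <= b -> F x < F y.
  move=> ax xy yb; apply: (@gtr0_derive1_lt_cc _ F a b) => //.
  - by move=> z; rewrite in_itv /= => /dF [].
  - move=> z; rewrite in_itv /= => zab; rewrite derive1E.
    by have [_ ->] := dF z zab; exact: F'0.
  - by rewrite in_itv /= ax (le_trans (ltW xy)).
  - by rewrite in_itv /= yb (le_trans ax (ltW xy)).
apply: improper_substitution_increasing => //.
  by move=> x /andP[ax xb]; rewrite !Finc // ltW.
move=> y /andP[ay yb]; have Fab := lt_trans ay yb.
have [x] : exists2 x, x \in `[a, b]%R & F x = y.
  apply: IVT => //; first exact: ltW.
  by rewrite ge_min le_max (ltW ay) (ltW yb) orbT.
rewrite in_itv /= => /andP[ax xb] Fx; exists x => //; apply/andP; split.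
  by rewrite lt_neqAle ax andbT; apply: contraTneq ay => ->; rewrite Fx ltxx.
by rewrite lt_neqAle xb andbT; apply: contraTneq yb => <-; rewrite Fx ltxx.
Qed.

Lemma improper_substitution_oppr A B G : A < B ->
  {in `]A, B[, continuous G} -> {in `]A, B[, forall y, 0 <= G y} ->
  (\int[mu]_(y in `]A, B[) (G y)%:E = \int[mu]_(x in `](- B)%R, (- A)%R[) (G (- x)%R)%:E)%E.
Proof.
move=> AB cG G0.
have [a_ [b_ [[aa bb abn da nb] ex]]] := exhaust_seq AB.
have H1 := exhaust_integral cG G0 aa bb da nb ex.
have H2 : (\int[mu]_(x in `[(- b_ n)%R, (- a_ n)%R]) (G (- x)%R)%:E)%E @[n --> \oo] -->
    (\int[mu]_(x in `](- B)%R, (- A)%R[) (G (- x)%R)%:E)%E.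
  have inv (x : R) : x \in `](- B), (- A)[ -> - x \in `]A, B[.
    by rewrite !in_itv /= => /andP[h1 h2]; apply/andP; split; lra.
  apply: (@exhaust_integral (- B) (- A) (fun x => G (- x)) (fun n => - b_ n) (fun n => - a_ n)).
  - move=> x xab; apply: (cvg_comp (fun y => - y) G); last exact/cG/inv.
    exact: (cvgN cvg_id).
  - by move=> x xab; apply/G0/inv.
  - by move=> n; rewrite ltrN2.
  - by move=> n; rewrite ltrN2.
  - by move=> m n mn; rewrite lerN2; apply: nb.
  - by move=> m n mn; rewrite lerN2; apply: da.
  - move=> x /andP[h1 h2]; have [|n /andP[h3 h4]] := ex (- x).
      by apply/andP; split; lra.
    by exists n; apply/andP; split; lra.
apply: (cvg_unique _ H1); first exact: ereal_hausdorff.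
apply: cvg_trans H2; apply: near_eq_cvg; apply: nearW => n.
rewrite (@integration_by_substitution_oppr _ (fun x => G (- x)) _ _ (ltW (abn n))).
  by apply: eq_integral => x _; rewrite /= opprK.
apply: continuous_in_subspaceT => y; rewrite inE /= in_itv /= => /andP[h1 h2].
apply: (cvg_comp (fun y => - y) G); first exact: (cvgN cvg_id).
by apply: cG; rewrite in_itv /=; have := aa n; have := bb n; lra.
Qed.

Lemma improper_substitution_decreasing a b A B F F' G : a < b -> A < B ->
  (forall x, a < x < b -> A < F x < B) ->
  (forall y, A < y < B -> exists2 x, a < x < b & F x = y) ->
  (forall x, a < x < b -> is_derive x 1 F (- F' x)) ->
  (forall x, a < x < b -> 0 < F' x) ->
  {in `]a, b[, continuous F'} ->
  {in `]A, B[, continuous G} -> {in `]A, B[, forall y, 0 <= G y} ->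
  (\int[mu]_(y in `]A, B[) (G y)%:E = \int[mu]_(x in `]a, b[) (G (F x) * F' x)%:E)%E.
Proof.
move=> ab AB FAB Fsurj dF F'0 cF' cG G0.
have inv (x : R) : x \in `](- B), (- A)[ -> - x \in `]A, B[.
  by rewrite !in_itv /= => /andP[h1 h2]; apply/andP; split; lra.
rewrite improper_substitution_oppr //.
have dN x : a < x < b -> is_derive x 1 (fun x => - F x) (F' x).
  by move=> /dF h; have := is_deriveN h; rewrite opprK; exact.
have cGN : {in `](- B), (- A)[, continuous (fun x => G (- x))}.
  move=> x xab; apply: (cvg_comp (fun y => - y) G); last exact/cG/inv.
  exact: (cvgN cvg_id).
have H := @improper_substitution_increasing a b (- B) (- A) (fun x => - F x) F'
  (fun x => G (- x)) ab _ _ dN F'0 cF' cGN _.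
rewrite H.
- by apply: eq_integral => x _; rewrite opprK.
- by move=> x /FAB/andP[h1 h2]; apply/andP; split; lra.
- move=> y /andP[h1 h2]; have [|x xab e] := Fsurj (- y).
    by apply/andP; split; lra.
  by exists x => //; rewrite e opprK.
- by move=> x xab; apply/G0/inv.
Qed.

End ImproperSubstitution.

(** * The bilinear relation between the real periods *)

Section RiemannRelation.
Context {R : realType}.
Notation mu := (@lebesgue_measure R).
Implicit Types (a x y u : R).

(** Integrals over an open interval with extended values: 1 / sqrt |f| is
    continuous there but unbounded, and its integrability is a consequence of
    the computations instead of a prerequisite. *)
Definition ooint (u v : R) (h : R -> R) : \bar R :=
  (\int[mu]_(x in `]u, v[) (h x)%:E)%E.

Lemma eq_ooint u v (h k : R -> R) : (forall x, u < x < v -> h x = k x) ->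
  ooint u v h = ooint u v k.
Proof.
move=> hk; apply: eq_integral => x; rewrite inE /= in_itv /= => xuv.
by rewrite hk.
Qed.

Definition invsqrtf (a x : R) : R := (Num.sqrt `|(fpoly a).[x]|)^-1.

Lemma invsqrtf_ge0 a x : 0 <= invsqrtf a x.
Proof. by rewrite invr_ge0 sqrtr_ge0. Qed.

Lemma horner_continuous (g : {poly R}) : continuous (fun x => g.[x]).
Proof.
move=> x; elim/poly_ind: g => [|g k IH].
  by rewrite /continuous_at horner0; under eq_cvg do rewrite horner0; exact: cvg_cst.
rewrite /continuous_at !hornerE; under eq_cvg do rewrite !hornerE.
exact: (cvgD (cvgM IH cvg_id) (cvg_cst _)).
Qed.

Lemma inv_sqrt_continuous (h : R -> R) x : h @ x --> h x -> 0 < h x ->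
  (fun y => (Num.sqrt (h y))^-1) @ x --> (Num.sqrt (h x))^-1.
Proof.
move=> hc h0; apply: cvgV; first by rewrite sqrtr_eq0 -ltNge.
apply: (cvg_comp h Num.sqrt); first exact: hc.
exact: sqrt_continuous.
Qed.

Lemma invsqrtf_continuous a x : (fpoly a).[x] != 0 -> {for x, continuous (invsqrtf a)}.
Proof.
move=> f0; apply: (@inv_sqrt_continuous (fun y => `|(fpoly a).[y]|)).
  by apply: cvg_norm; exact: horner_continuous.
by rewrite normr_gt0.
Qed.

Lemma invsqrtM (A B C : R) : 0 <= A -> 0 <= B -> 0 <= C -> A = B * C ^+ 2 ->
  (Num.sqrt A)^-1 = (Num.sqrt B)^-1 / C.
Proof.
move=> A0 B0 C0 ->; rewrite sqrtrM // sqrtr_sqr ger0_norm // invfM //.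
Qed.

Lemma absf1a (a x : R) : 1 < x < a -> `|(fpoly a).[x]| = x * (x ^+ 2 - 1) * (a ^+ 2 - x ^+ 2).
Proof.
move=> /andP[h1 h2]; rewrite fpolyE ler0_norm; first by ring.
by rewrite mulr_ge0_le0 ?mulr_ge0 //; nra.
Qed.

Lemma absf01 (a x : R) : 1 < a -> 0 < x < 1 -> `|(fpoly a).[x]| = x * (1 - x ^+ 2) * (a ^+ 2 - x ^+ 2).
Proof.
move=> a1 /andP[h1 h2]; rewrite fpolyE ger0_norm; first by ring.
by rewrite mulr_le0 ?mulr_ge0_le0 //; nra.
Qed.

Lemma f1a_neq0 (a x : R) : 1 < x < a -> (fpoly a).[x] != 0.
Proof.
move=> xP; rewrite -normr_gt0 absf1a //; move/andP: xP => [h1 h2].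
by rewrite !mulr_gt0 //; nra.
Qed.

Lemma f01_neq0 (a x : R) : 1 < a -> 0 < x < 1 -> (fpoly a).[x] != 0.
Proof.
move=> a1 xP; rewrite -normr_gt0 absf01 //; move/andP: xP => [h1 h2].
by rewrite !mulr_gt0 //; nra.
Qed.

Variable m : R.
Hypothesis m1 : 1 < m.
Let a := m ^+ 2.
Let g := invsqrtf a.

Let m0 : 0 < m. Proof. exact: lt_trans m1. Qed.
Let ma : m < a. Proof. by rewrite /a expr2 ltr_pMr. Qed.
Let a1 : 1 < a. Proof. exact: lt_trans ma. Qed.

Lemma inversion_derive x : 0 < x -> is_derive x 1 (fun y => a / y) (- (a / x ^+ 2)).
Proof.
move=> x0; have xn : x != 0 by rewrite gt_eqF.
have V : is_derive x 1 (fun y : R => y^-1) (- x ^- 2 *: 1).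
  exact: (@is_deriveV _ id x 1 1 xn (is_derive_id _ _)).
apply: is_derive_eq.
by rewrite /GRing.scale /= !(mulr0, mulr1, addr0, mulrN).
Qed.

Lemma inversion_deriv_continuous (u v : R) : 0 <= u ->
  {in `]u, v[, continuous (fun x => a / x ^+ 2)}.
Proof.
move=> u0 x; rewrite in_itv /= => /andP[ux _].
have x0 : 0 < x by exact: le_lt_trans ux.
apply: cvgM; first exact: cvg_cst.
apply: cvgV; first by rewrite expf_neq0 // gt_eqF.
exact: exprn_continuous.
Qed.

(** The involution x -> a / x permutes the branch points of the curve, hence
    preserves f up to a factor. *)
Lemma g_inversion x : 1 < x < a -> g (a / x) = g x * x ^+ 3 / m ^+ 3.
Proof.
move=> xP; move/andP: (xP) => [h1 h2]; have x0 : 0 < x by exact: lt_trans h1.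
have axP : 1 < a / x < a.
  by rewrite ltr_pdivlMr // mul1r h2 /= ltr_pdivrMr // ltr_pMr // (lt_trans _ a1).
have -> : g x * x ^+ 3 / m ^+ 3 = g x / (m ^+ 3 / x ^+ 3) by rewrite invf_div; ring.
apply: invsqrtM => //.
  by rewrite divr_ge0 // exprn_ge0 // ltW.
rewrite !absf1a // /a; field.
by rewrite gt_eqF.
Qed.

Lemma in_continuousM (k h : R -> R) u v : (forall x, k @ x --> k x) ->
  {in `]u, v[, continuous h} -> {in `]u, v[, continuous (fun x => k x * h x)}.
Proof. by move=> kc hc x xuv; apply: cvgM; [exact: kc|exact: hc]. Qed.

Lemma g_continuous_1a u v : 1 <= u -> v <= a -> {in `]u, v[, continuous g}.
Proof.
move=> u1 va x; rewrite in_itv /= => /andP[h1 h2]; apply: invsqrtf_continuous.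
by apply: f1a_neq0; rewrite (le_lt_trans u1) //= (lt_le_trans h2).
Qed.

(** The substitution x -> a / x exchanges x g and m g. *)
Lemma integral_xg : ooint 1 a (fun x => x * g x) = ooint 1 a (fun x => m * g x).
Proof.
have D x : 1 < x < a -> is_derive x 1 (fun x => a / x) (- (a / x ^+ 2)).
  by move=> /andP[h1 _]; apply: inversion_derive; exact: lt_trans h1.
rewrite /ooint (@improper_substitution_decreasing _ 1 a 1 a (fun x => a / x)
  (fun x => a / x ^+ 2) _ a1 a1 _ _ D).
- apply: eq_ooint => x xP.
  rewrite g_inversion // /a; field; move/andP: xP => [h1 _].
  by rewrite !gt_eqF // (lt_trans _ h1).
- move=> x /andP[h1 h2]; have x0 : 0 < x by exact: lt_trans h1.
  by rewrite ltr_pdivlMr // mul1r h2 /= ltr_pdivrMr // ltr_pMr // (lt_trans _ a1).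
- move=> y /andP[h1 h2]; have y0 : 0 < y by exact: lt_trans h1.
  exists (a / y); last by rewrite invf_div mulrCA divff ?mulr1 // gt_eqF // (lt_trans _ a1).
  by rewrite ltr_pdivlMr // mul1r h2 /= ltr_pdivrMr // ltr_pMr // (lt_trans _ a1).
- move=> x /andP[h1 _]; rewrite divr_gt0 ?exprn_gt0 // ?(lt_trans _ a1) //.
  exact: lt_trans h1.
- exact: inversion_deriv_continuous.
- by apply: in_continuousM; [move=> x; exact: cvg_id|exact: g_continuous_1a].
- move=> x; rewrite in_itv /= => /andP[h1 _].
  by rewrite mulr_ge0 ?invsqrtf_ge0 // ltW // (lt_trans _ h1).
Qed.

(** The substitution x -> a / x preserves (m + x) g dx up to orientation, and its
    fixed point m cuts the interval into two halves. *)
Lemma integral_inversion_half :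
  ooint m a (fun x => (m + x) * g x) = ooint 1 m (fun x => (m + x) * g x).
Proof.
have D x : 1 < x < m -> is_derive x 1 (fun x => a / x) (- (a / x ^+ 2)).
  by move=> /andP[h1 _]; apply: inversion_derive; exact: lt_trans h1.
rewrite /ooint (@improper_substitution_decreasing _ 1 m m a (fun x => a / x)
  (fun x => a / x ^+ 2) _ m1 ma _ _ D).
- apply: eq_ooint => x /andP[h1 h2].
  rewrite g_inversion; last by rewrite h1 (lt_trans h2).
  by rewrite /a; field; rewrite !gt_eqF // (lt_trans _ h1).
- move=> x /andP[h1 h2]; have x0 : 0 < x by exact: lt_trans h1.
  apply/andP; split; first by rewrite ltr_pdivlMr // /a expr2 ltr_pM2l.
  by rewrite ltr_pdivrMr // ltr_pMr // (lt_trans _ a1).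
- move=> y /andP[h1 h2]; have y0 : 0 < y by exact: lt_trans h1.
  exists (a / y); last by rewrite invf_div mulrCA divff ?mulr1 // gt_eqF // (lt_trans _ a1).
  by rewrite ltr_pdivlMr // mul1r h2 /= ltr_pdivrMr // /a expr2 ltr_pM2l.
- move=> x /andP[h1 _]; rewrite divr_gt0 ?exprn_gt0 // ?(lt_trans _ a1) //.
  exact: lt_trans h1.
- exact: inversion_deriv_continuous.
- apply: in_continuousM; last by apply: g_continuous_1a => //; exact: ltW.
  by move=> x; apply: cvgD; [exact: cvg_cst|exact: cvg_id].
- move=> x; rewrite in_itv /= => /andP[h1 _].
  by rewrite mulr_ge0 ?invsqrtf_ge0 // addr_ge0 // ltW // (lt_trans _ h1).
Qed.

(** The quotients of the curve by the two lifts of z -> a / z are elliptic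
    curves, on which F = z / (z ^ 2 + a) is a coordinate; G1 and G2 are their
    holomorphic differentials in this coordinate. *)
Let b := 1 + a.
Let k := 2 * m.
Let G1 u := (Num.sqrt (u * (1 + k * u) * (1 - b ^+ 2 * u ^+ 2)))^-1.
Let G2 u := (Num.sqrt (u * (1 - k * u) * (b ^+ 2 * u ^+ 2 - 1)))^-1.
Let F x := x / (x ^+ 2 + a).
Let F' x := (a - x ^+ 2) / (x ^+ 2 + a) ^+ 2.

Let kb : k < b.
Proof.
have h : 0 < (m - 1) ^+ 2 by rewrite exprn_gt0 // subr_gt0.
by rewrite /k /b /a; nra.
Qed.

Let den_gt0 x : 0 < x ^+ 2 + a.
Proof. by rewrite ltr_wpDl ?sqr_ge0 // (lt_trans _ a1). Qed.

Lemma F_derive x : is_derive x 1 F (F' x).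
Proof.
have n0 : x ^+ 2 + a != 0 by rewrite gt_eqF.
have D : is_derive x 1 (fun y : R => y ^+ 2 + a) (2 * x).
  apply: is_derive_eq; rewrite /GRing.scale /=; ring.
have V := @is_deriveV _ (fun y : R => y ^+ 2 + a) x _ _ n0 D.
rewrite /F; apply: is_derive_eq.
by rewrite /GRing.scale /F' /=; field.
Qed.

Lemma F_continuous : continuous F.
Proof.
move=> x; apply: differentiable_continuous; apply/derivable1_diffP.
by have [] := F_derive x.
Qed.

Lemma F'_continuous : continuous F'.
Proof.
have h x : (fun y : R => y ^+ 2) @ x --> x ^+ 2 by exact: exprn_continuous.
move=> x; apply: cvgM; first exact: (cvgB (cvg_cst _) (h x)).
apply: cvgV; first by rewrite expf_neq0 // gt_eqF.
apply: (cvg_comp (fun y : R => y ^+ 2 + a) (fun y : R => y ^+ 2)).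
  exact: (cvgD (h x) (cvg_cst _)).
exact: h.
Qed.

Lemma F0 : F 0 = 0. Proof. by rewrite /F mul0r. Qed.
Lemma F1 : F 1 = b^-1. Proof. by rewrite /F expr1n mul1r. Qed.
Lemma Fm : F m = k^-1.
Proof. by rewrite /F /k /a; field; rewrite ?gt_eqF //; nra. Qed.

(** The form (m - x) g dx comes from one of the two elliptic quotients. *)
Lemma G1_F x : 0 < x < 1 -> G1 (F x) * F' x = (m - x) * g x.
Proof.
move=> xP; move/andP: (xP) => [x0 x1].
have n0 : x ^+ 2 + a != 0 by rewrite gt_eqF.
have xm : x < m by exact: lt_trans m1.
have -> : G1 (F x) = g x / ((x + m) / (x ^+ 2 + a) ^+ 2).
  apply: invsqrtM => //.
  - rewrite /F.
    have -> : x / (x ^+ 2 + a) * (1 + k * (x / (x ^+ 2 + a))) *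
      (1 - b ^+ 2 * (x / (x ^+ 2 + a)) ^+ 2) =
      `|(fpoly a).[x]| * ((x + m) / (x ^+ 2 + a) ^+ 2) ^+ 2.
      by rewrite absf01 // /b /k /a; field.
    by rewrite mulr_ge0 ?sqr_ge0.
  - by rewrite divr_ge0 ?exprn_ge0 ?(ltW (den_gt0 _)) // addr_ge0 // ltW.
  - by rewrite absf01 // /F /b /k /a; field.
rewrite /F' /a; field; rewrite -/a n0 /= gt_eqF //.
by rewrite addr_gt0.
Qed.

(** The form (m + x) g dx comes from the other elliptic quotient. *)
Lemma G2_F x : 1 < x < m -> G2 (F x) * F' x = (m + x) * g x.
Proof.
move=> xP; move/andP: (xP) => [x1 xm].
have x0 : 0 < x by exact: lt_trans x1.
have n0 : x ^+ 2 + a != 0 by rewrite gt_eqF.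
have xa : 1 < x < a by rewrite x1 (lt_trans xm).
have -> : G2 (F x) = g x / ((m - x) / (x ^+ 2 + a) ^+ 2).
  have E : F x * (1 - k * F x) * (b ^+ 2 * F x ^+ 2 - 1) =
      `|(fpoly a).[x]| * ((m - x) / (x ^+ 2 + a) ^+ 2) ^+ 2.
    by rewrite absf1a // /F /b /k /a; field.
  apply: invsqrtM => //.
  - by rewrite E mulr_ge0 ?sqr_ge0.
  - by rewrite divr_ge0 ?exprn_ge0 ?(ltW (den_gt0 _)) // subr_ge0 ltW.
rewrite /F' /a; field; rewrite -/a n0 /= gt_eqF //.
by rewrite subr_gt0.
Qed.

Lemma G1_pos u : 0 < u < b^-1 -> 0 < u * (1 + k * u) * (1 - b ^+ 2 * u ^+ 2).
Proof.
have b0 : 0 < b by rewrite addr_gt0 // (lt_trans _ a1).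
move=> /andP[u0 ub]; have bu : b * u < 1 by rewrite mulrC -ltr_pdivlMr // mul1r.
have bu0 : 0 < b * u by rewrite mulr_gt0.
rewrite mulr_gt0 //; last by rewrite -exprMn subr_gt0 expr_lt1 // ltW.
by rewrite mulr_gt0 // addr_gt0 // !mulr_gt0.
Qed.

Lemma G2_pos u : b^-1 < u < k^-1 -> 0 < u * (1 - k * u) * (b ^+ 2 * u ^+ 2 - 1).
Proof.
have b0 : 0 < b by rewrite addr_gt0 // (lt_trans _ a1).
have k0 : 0 < k by rewrite mulr_gt0.
move=> /andP[ub uk]; have bu : 1 < b * u by rewrite mulrC -ltr_pdivrMr // mul1r.
have u0 : 0 < u by apply: lt_trans ub; rewrite invr_gt0.
have ku : k * u < 1 by rewrite mulrC -ltr_pdivlMr // mul1r.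
rewrite mulr_gt0 //; last by rewrite -exprMn subr_gt0 exprn_egt1.
by rewrite mulr_gt0 // subr_gt0.
Qed.

Lemma G1_continuous : {in `]0, b^-1[, continuous G1}.
Proof.
move=> u; rewrite in_itv /= => /G1_pos h0.
apply: (@inv_sqrt_continuous (fun u => u * (1 + k * u) * (1 - b ^+ 2 * u ^+ 2)) u _ h0).
pose Q : {poly R} := 'X * (1 + k%:P * 'X) * (1 - (b ^+ 2)%:P * 'X ^+ 2).
have E y : y * (1 + k * y) * (1 - b ^+ 2 * y ^+ 2) = Q.[y] by rewrite /Q !hornerE.
by rewrite E; under eq_cvg do rewrite E; exact: horner_continuous.
Qed.

Lemma G2_continuous : {in `]b^-1, k^-1[, continuous G2}.
Proof.
move=> u; rewrite in_itv /= => /G2_pos h0.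
apply: (@inv_sqrt_continuous (fun u => u * (1 - k * u) * (b ^+ 2 * u ^+ 2 - 1)) u _ h0).
pose Q : {poly R} := 'X * (1 - k%:P * 'X) * ((b ^+ 2)%:P * 'X ^+ 2 - 1).
have E y : y * (1 - k * y) * (b ^+ 2 * y ^+ 2 - 1) = Q.[y] by rewrite /Q !hornerE.
by rewrite E; under eq_cvg do rewrite E; exact: horner_continuous.
Qed.

Lemma integral_G1 : ooint 0 b^-1 G1 = ooint 0 1 (fun x => (m - x) * g x).
Proof.
have D x : 0 < x < 1 -> is_derive x 1 F (F' x) by move=> _; exact: F_derive.
have := @improper_substitution _ 0 1 F F' G1 ltr01 _ D; rewrite F0 F1 => H.
rewrite /ooint H.
- by apply: eq_ooint => x; exact: G1_F.
- by apply: continuous_subspaceT; exact: F_continuous.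
- move=> x /andP[x0 x1]; rewrite divr_gt0 ?exprn_gt0 //.
  by rewrite subr_gt0 (@lt_trans _ _ 1) // expr_lt1 // ltW.
- by move=> x _; exact: F'_continuous.
- exact: G1_continuous.
- by move=> u _; rewrite invr_ge0 sqrtr_ge0.
Qed.

Lemma integral_G2 : ooint b^-1 k^-1 G2 = ooint 1 m (fun x => (m + x) * g x).
Proof.
have D x : 1 < x < m -> is_derive x 1 F (F' x) by move=> _; exact: F_derive.
have := @improper_substitution _ 1 m F F' G2 m1 _ D; rewrite F1 Fm => H.
rewrite /ooint H.
- by apply: eq_ooint => x; exact: G2_F.
- by apply: continuous_subspaceT; exact: F_continuous.
- move=> x /andP[x1 xm]; rewrite divr_gt0 ?exprn_gt0 //.
  by rewrite subr_gt0 /a ltr_pXn2r ?nnegrE // ltW // (lt_trans _ x1).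
- by move=> x _; exact: F'_continuous.
- exact: G2_continuous.
- by move=> u _; rewrite invr_ge0 sqrtr_ge0.
Qed.

Let delta u := 1 + (2 * k - b) * u.
Let moebius u := (1 + b * u) / (b * delta u).
Let moebius' u := 2 * (b - k) / (b * delta u ^+ 2).

Let b0 : 0 < b. Proof. by rewrite addr_gt0 // (lt_trans _ a1). Qed.
Let k0 : 0 < k. Proof. by rewrite mulr_gt0. Qed.

Let delta_gt0 u : 0 <= u <= b^-1 -> 0 < delta u.
Proof.
move=> /andP[u0 ub]; have bu : b * u <= 1 by rewrite mulrC -ler_pdivlMr // mul1r.
have [->|un] := eqVneq u 0; first by rewrite /delta mulr0 addr0.
have ku : 0 < k * u by rewrite mulr_gt0 // lt_neqAle eq_sym un.
by rewrite /delta; lra.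
Qed.

Lemma delta_derive u : is_derive u 1 delta (2 * k - b).
Proof. by rewrite /delta; apply: is_derive_eq; rewrite /GRing.scale /=; ring. Qed.

Lemma moebius_derive u : 0 <= u <= b^-1 -> is_derive u 1 moebius (moebius' u).
Proof.
move=> uP; have dn : b * delta u != 0 by rewrite gt_eqF // mulr_gt0 // delta_gt0.
have D : is_derive u 1 (fun y => b * delta y) (b * (2 * k - b)).
  have := delta_derive u => ?; apply: is_derive_eq.
  by rewrite /GRing.scale /=; ring.
have V := @is_deriveV _ (fun y => b * delta y) u _ _ dn D.
rewrite /moebius; apply: is_derive_eq.
rewrite /GRing.scale /moebius' /= /delta; field.
by move: dn; rewrite /delta mulf_eq0 negb_or => /andP[-> ->].
Qed.

Lemma moebius'_continuous : {in `]0, b^-1[, continuous moebius'}.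
Proof.
move=> u; rewrite in_itv /= => /andP[h1 h2].
have d0 : 0 < delta u by rewrite delta_gt0 // !ltW.
have dc : delta @ u --> delta u.
  apply: differentiable_continuous; apply/derivable1_diffP.
  by have [] := delta_derive u.
apply: cvgM; first exact: cvg_cst.
apply: cvgV; first by rewrite mulf_neq0 ?expf_neq0 // gt_eqF.
apply: cvgM; first exact: cvg_cst.
apply: (cvg_comp delta (fun y : R => y ^+ 2)); first exact: dc.
exact: exprn_continuous.
Qed.

Lemma G2_moebius u : 0 < u < b^-1 -> G2 (moebius u) * moebius' u = G1 u.
Proof.
move=> uP; move/andP: (uP) => [u0 ub].
have d0 : 0 < delta u by rewrite delta_gt0 // !ltW.
have U'0 : 0 < moebius' u.
  by rewrite /moebius' divr_gt0 // ?mulr_gt0 ?exprn_gt0 // subr_gt0.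
have dn : delta u != 0 by rewrite gt_eqF.
have bn : b != 0 by rewrite gt_eqF.
have -> : G2 (moebius u) = G1 u / moebius' u; last by rewrite divfK // gt_eqF.
have E : moebius u * (1 - k * moebius u) * (b ^+ 2 * moebius u ^+ 2 - 1) =
    u * (1 + k * u) * (1 - b ^+ 2 * u ^+ 2) * moebius' u ^+ 2.
  by move: dn; rewrite /moebius /moebius' /delta => dn; field; rewrite dn bn.
have G0 := ltW (G1_pos uP).
apply: invsqrtM => //; last exact: ltW.
by rewrite E mulr_ge0 ?sqr_ge0.
Qed.

(** The Moebius map sends the branch points 0, 1/b, - 1/b, - 1/k of the first
    elliptic quotient to the branch points 1/b, 1/k, 0, - 1/b of the second, so
    the two quotients are isomorphic. *)
Lemma integral_moebius : ooint b^-1 k^-1 G2 = ooint 0 b^-1 G1.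
Proof.
have bi : 0 < b^-1 by rewrite invr_gt0.
have D x : 0 < x < b^-1 -> is_derive x 1 moebius (moebius' x).
  by move=> /andP[h1 h2]; apply: moebius_derive; rewrite !ltW.
have U0 : moebius 0 = b^-1 by rewrite /moebius /delta !mulr0 !addr0 mulr1 mul1r.
have U1 : moebius b^-1 = k^-1.
  have bn : b != 0 by rewrite gt_eqF.
  have kn : k != 0 by rewrite gt_eqF.
  have d1 : delta b^-1 = 2 * k / b by rewrite /delta mulrBl divff //; ring.
  rewrite /moebius d1 divff // mulrCA divff // mulr1 invfM mulrA divff ?mul1r //.
have := @improper_substitution _ 0 b^-1 moebius moebius' G2 bi _ D; rewrite U0 U1 => H.
rewrite /ooint H.
- by apply: eq_ooint => x; exact: G2_moebius.
- apply: derivable_within_continuous => x; rewrite in_itv /= => /moebius_derive.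
  by case.
- move=> x /andP[h1 h2].
  have d0 : 0 < delta x by rewrite delta_gt0 // !ltW.
  by rewrite /moebius' divr_gt0 ?mulr_gt0 ?exprn_gt0 ?subr_gt0.
- exact: moebius'_continuous.
- exact: G2_continuous.
- by move=> u _; rewrite invr_ge0 sqrtr_ge0.
Qed.

Lemma ooint_cst_mul (u v c : R) (h : R -> R) : 0 <= c ->
  {in `]u, v[, continuous h} -> (forall x, u < x < v -> 0 <= h x) ->
  ooint u v (fun x => c * h x) = (c%:E * ooint u v h)%E.
Proof.
move=> c0 hc h0; rewrite /ooint -ge0_integralZl_EFin //.
- exact: continuous_measurable_oo.
Qed.

Lemma ooint_add (u v : R) (h1 h2 : R -> R) :
  {in `]u, v[, continuous h1} -> {in `]u, v[, continuous h2} ->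
  (forall x, u < x < v -> 0 <= h1 x) -> (forall x, u < x < v -> 0 <= h2 x) ->
  ooint u v (fun x => h1 x + h2 x) = (ooint u v h1 + ooint u v h2)%E.
Proof.
move=> hc1 hc2 p1 p2; rewrite /ooint -ge0_integralD //.
- exact: continuous_measurable_oo.
- exact: continuous_measurable_oo.
Qed.

Lemma ooint_split (u v w : R) (h : R -> R) : u < v -> v < w ->
  {in `]u, w[, continuous h} -> (forall x, u < x < w -> 0 <= h x) ->
  ooint u w h = (ooint u v h + ooint v w h)%E.
Proof.
move=> uv vw hc h0.
have E : (`]u, w[ = `]u, v[ `|` `[v, w[)%classic.
  apply/seteqP; split => x /=; rewrite !in_itv /=.
    by move=> /andP[h1 h2]; case: (ltP x v) => xv; [left; rewrite h1|right; rewrite h2].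
  by case=> /andP[h1 h2]; apply/andP; split => //; [exact: lt_trans vw|exact: lt_le_trans h1].
have mh := continuous_measurable_oo hc.
rewrite /ooint E ge0_integral_setU //=.
- congr (_ + _)%E.
  rewrite (@integral_itv_bndoo _ v w _ true true) //.
  apply: measurable_funS mh => //; rewrite E => x /=; rewrite !in_itv /= => /andP[h1 h2].
  by right; rewrite h2 ltW.
- by rewrite -E.
- by move=> x; rewrite -[_ \/ _]/((`]u, v[ `|` `[v, w[)%classic x) -E /= in_itv /= => /h0; rewrite lee_fin.
- by apply/disj_setPS => x /= []; rewrite !in_itv /= => /andP[_ h1] /andP[h2 _]; move: (lt_le_trans h1 h2); rewrite ltxx.
Qed.

(** Y is a half period common to the two elliptic quotients.  It is the integral
    of (m - x) g over [0, 1], and half of the integral of (m + x) g over [1, a],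
    which is 2 m p by the inversion.  Hence m q - s = m p. *)
Lemma riemann_relation (p q s : R) : ooint 1 a g = p%:E -> ooint 0 1 g = q%:E ->
  ooint 0 1 (fun x => x * g x) = s%:E -> s = m * (q - p).
Proof.
move=> pE qE sE.
have cg1 : {in `]1, a[, continuous g} by exact: g_continuous_1a.
have cg0 : {in `]0, 1[, continuous g}.
  by move=> x; rewrite in_itv /= => xP; apply: invsqrtf_continuous; exact: f01_neq0.
have g0 x : 0 <= g x by exact: invsqrtf_ge0.
have cid u v (h : R -> R) : {in `]u, v[, continuous h} ->
    {in `]u, v[, continuous (fun x => x * h x)}.
  by move=> hc; apply: in_continuousM => // x; exact: cvg_id.
have ccst u v (h : R -> R) : {in `]u, v[, continuous h} ->
    {in `]u, v[, continuous (fun x => m * h x)}.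
  by move=> hc; apply: in_continuousM => // x; exact: cvg_cst.
have cp : {in `]1, a[, continuous (fun x => (m + x) * g x)}.
  by apply: in_continuousM => // x; apply: cvgD; [exact: cvg_cst|exact: cvg_id].
have cm : {in `]0, 1[, continuous (fun x => (m - x) * g x)}.
  by apply: in_continuousM => // x; apply: cvgB; [exact: cvg_cst|exact: cvg_id].
pose Y := ooint 0 1 (fun x => (m - x) * g x).
have E1 : ooint 1 a (fun x => (m + x) * g x) = (m%:E * p%:E + m%:E * p%:E)%E.
  have -> : ooint 1 a (fun x => (m + x) * g x) =
      ooint 1 a (fun x => m * g x + x * g x) by apply: eq_ooint => x _; rewrite mulrDl.
  rewrite ooint_add ?integral_xg ?ooint_cst_mul ?pE //; try by [exact: ltW|exact: ccst|exact: cid].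
  - by move=> x _; rewrite mulr_ge0 // ltW.
  - by move=> x /andP[h _]; rewrite mulr_ge0 // ltW // (lt_trans _ h).
have YE : Y = ooint 1 m (fun x => (m + x) * g x).
  by rewrite /Y -integral_G1 -integral_moebius integral_G2.
have E2 : ooint 1 a (fun x => (m + x) * g x) =
    (Y + Y)%E.
  rewrite (@ooint_split 1 m a) // ?integral_inversion_half ?YE //.
  by move=> x /andP[h _]; rewrite mulr_ge0 // addr_ge0 // ltW // (lt_trans _ h).
have E3 : (m%:E * q%:E = Y + s%:E)%E.
  rewrite -qE -sE /Y -ooint_cst_mul //; last exact: ltW.
  rewrite -ooint_add //; first by apply: eq_ooint => x _; rewrite -mulrDl subrK.
  - exact: cid.
  - by move=> x /andP[_ h]; rewrite mulr_ge0 // subr_ge0 ltW // (lt_trans h).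
  - by move=> x /andP[h _]; rewrite mulr_ge0 // ltW.
clear YE; move: E1 E3; rewrite {}E2; case: Y => [y| |] // [h1] [h2].
lra.
Qed.

End RiemannRelation.

(** * Symmetries of a trajectory through a branch point *)

Section RealTrajectory.
Context {R : realType} (a : R).
Local Notation C := (cplx R).
Local Notation f := (fpoly (rc a : C)).
Local Notation fR := (fpoly a).
Implicit Types (s t x y : R).

Lemma cconj1 : cconj (1 : C) = 1. Proof. exact: (cconj_rc 1). Qed.
Lemma cconj0 : cconj (0 : C) = 0. Proof. exact: (cconj_rc 0). Qed.

Lemma cconjN (z : C) : cconj (- z) = - cconj z.
Proof. by rewrite -sub0r cconjB cconj0 sub0r. Qed.

Lemma cconj_dfpoly (z : C) : cconj f^`().[z] = f^`().[cconj z].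
Proof. by rewrite !dfpolyE !(cconjN, cconjD, cconjM, cconj_rc, cconj1) rc1; ring. Qed.

Lemma cconj_fix (z : C) : cconj z = z -> z = rc (re z).
Proof.
move=> /(congr1 (@im R)); rewrite /= => h.
by apply: cplx_eq => //=; rewrite /im /= in h *; lra.
Qed.

Lemma fpoly_rc x : f.[rc x] = rc fR.[x].
Proof. by rewrite !fpolyE !(rcM, rcB, rcX, rc1). Qed.

Variables (A B : R) (u : C) (eps kap : R) (z w : R -> C).
Let k : C := u * rc kap.
Hypothesis zw : hyperelliptic_flow a A B k z w.

(** u is 1 for a horizontal path and i for a vertical one. *)
Hypothesis eps2 : eps * eps = 1.
Hypothesis cju : cconj u = rc eps * u.

Let cjk : cconj k = rc eps * k.
Proof. by rewrite /k cconjM cju cconj_rc mulrA. Qed.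

Let reps2 : rc eps * rc eps = 1 :> C.
Proof. by rewrite -rcM eps2. Qed.

(** The polynomial f' is real, and k is real or purely imaginary; in the second
    case the conjugation of w is combined with the hyperelliptic involution. *)
Lemma conj_flow : hyperelliptic_flow a A B k
  (fun t => cconj (z t)) (fun t => rc eps * cconj (w t)).
Proof.
move=> t tP; have [zd wd] := zw tP; split.
  have -> : k * (rc eps * cconj (w t)) = cconj (k * w t) by rewrite cconjM cjk; ring.
  exact: cderiv_conj.
have -> : k * (f^`().[cconj (z t)] / 2) = rc eps * cconj (k * (f^`().[z t] / 2)).
  rewrite [cconj (k * _)]cconjM cjk -cconj_dfpoly [cconj (_ / 2)]cconjM.
  have -> : cconj (2^-1 : C) = 2^-1.
    by rewrite -[2%R]/(1 + 1) -rc1 -rcD -rcV cconj_rc.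
  by rewrite !mulrA reps2 mul1r.
apply: cderivZ; exact: cderiv_conj.
Qed.

(** A trajectory through a real branch point is its own conjugate. *)
Lemma flow_real t0 x : A < t0 < B -> z t0 = rc x -> w t0 = 0 ->
  forall t, A < t < B -> z t = rc (re (z t)) /\ u * w t = rc (re (u * w t)).
Proof.
move=> t0P z0 w0 t tP.
have [||e1 e2] := flow_unique t0P zw conj_flow _ _ tP.
- by rewrite z0 cconj_rc.
- by rewrite w0 cconj0 mulr0.
split; first exact/cconj_fix/esym.
apply: cconj_fix; rewrite cconjM cju [in RHS]e2.
by ring.
Qed.

(** At a branch point, the hyperelliptic involution and the reversal of time
    have the same effect on a trajectory. *)
Lemma flow_even : w ((A + B) / 2) = 0 ->
  forall t, A < t < B -> z (A + B - t) = z t.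
Proof.
move=> w0 t tP.
have AB : A < (A + B) / 2 < B.
  by move/andP: tP => [h1 h2]; apply/andP; split; lra.
have inv s : A < s < B -> A < A + B - s < B.
  by move=> /andP[h1 h2]; apply/andP; split; lra.
have zw' : hyperelliptic_flow a A B k (fun s => z (A + B - s)) (fun s => - w (A + B - s)).
  move=> s /inv /zw [zd wd]; split.
    by rewrite mulrN; exact: (cderiv_reflect zd).
  by rewrite -[k * _]opprK; apply: cderivN; exact: (cderiv_reflect wd).
have [||-> //] := flow_unique AB zw' zw _ _ tP.
- by congr z; field.
- have -> : A + B - (A + B) / 2 = (A + B) / 2 by field.
  by rewrite w0 oppr0.
Qed.

End RealTrajectory.

(** * Half an oscillation between two branch points *)

Section QuarterPeriod.
Context {R : realType} (a : R).
Local Notation fR := (fpoly a).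
Local Notation g := (invsqrtf a).
Implicit Types (s t x y : R).
Variables (t0 t1 u0 u1 eps kap : R) (X V : R -> R).
Hypotheses (t01 : t0 < t1) (u01 : u0 < u1) (kap0 : 0 < kap) (eps1 : `|eps| = 1).
Hypothesis cX : {within `[t0, t1], continuous X}.
Hypotheses (X0 : X t0 = u0) (X1 : X t1 = u1).
Hypothesis dX : forall t, t0 < t < t1 -> is_derive t 1 X (kap * V t).
Hypothesis cV : forall t, t0 < t < t1 -> V @ t --> V t.
Hypothesis VX : forall t, t0 < t < t1 -> V t ^+ 2 = eps * fR.[X t].
Hypothesis Xavoid : forall t, t0 < t < t1 -> X t <> u0 /\ X t <> u1.
Hypothesis fpos : forall x, u0 < x < u1 -> 0 < eps * fR.[x].

(** Intermediate values: outside [u0, u1] the trajectory would have to take one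
    of the end values again. *)
Lemma trajectory_range t : t0 < t < t1 -> u0 < X t < u1.
Proof.
move=> /andP[h0 h1]; have [n0 n1] : X t <> u0 /\ X t <> u1 by apply: Xavoid; rewrite h0.
apply/andP; split; rewrite ltNge; apply/negP => h.
  have [s] : exists2 s, s \in `[t, t1]%R & X s = u0.
    apply: IVT; first exact: ltW.
      apply: continuous_subspaceW cX => s /=; rewrite !in_itv /= => /andP[h2 ->].
      by rewrite (le_trans (ltW h0)).
    by rewrite X1 ge_min le_max h (ltW u01) orbT.
  rewrite in_itv /= => /andP[h2 h3] e.
  have st : t < s by rewrite lt_neqAle h2 andbT; apply/eqP => E; apply: n0; rewrite E.
  have st1 : s < t1.
    rewrite lt_neqAle h3 andbT; apply/eqP => E; move: u01; rewrite -X1 -E e ltxx //.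
  by have [] := @Xavoid s _; rewrite ?(lt_trans h0 st).
have [s] : exists2 s, s \in `[t0, t]%R & X s = u1.
  apply: IVT; first exact: ltW.
    apply: continuous_subspaceW cX => s /=; rewrite !in_itv /= => /andP[-> h2].
    by rewrite (le_trans h2 (ltW h1)).
  by rewrite X0 ge_min le_max h (ltW u01) orbT.
rewrite in_itv /= => /andP[h2 h3] e.
have st : s < t by rewrite lt_neqAle h3 andbT; apply/eqP => E; apply: n1; rewrite -E.
have st1 : t0 < s.
  rewrite lt_neqAle h2 andbT; apply/eqP => E; move: u01; rewrite -X0 E e ltxx //.
by have [] := @Xavoid s _; rewrite ?st1 ?(lt_trans st h1).
Qed.

(** V does not vanish between the branch points and is continuous, and it is
    positive at the time given by the mean value theorem. *)
Lemma velocity_pos t : t0 < t < t1 -> 0 < V t.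
Proof.
have Vn s : t0 < s < t1 -> V s != 0.
  move=> sP; rewrite -sqrf_eq0 VX // gt_eqF //; apply: fpos.
  exact: trajectory_range.
have [s sP e] : exists2 s, s \in `]t0, t1[%R & X t1 - X t0 = kap * V s * (t1 - t0).
  by apply: MVT => // s; rewrite in_itv /= => /dX.
rewrite in_itv /= in sP.
have Vs : 0 < V s.
  have h : 0 < kap * V s * (t1 - t0) by rewrite -e X0 X1 subr_gt0.
  by move: h; rewrite pmulr_lgt0 ?subr_gt0 // pmulr_rgt0.
move=> tP; rewrite ltNge; apply/negP => Vt.
have between x y : t0 < x < t1 -> t0 < y < t1 -> x <= y -> Num.min (V x) (V y) <= 0 ->
    0 <= Num.max (V x) (V y) -> False.
  move=> /andP[x0 x1] /andP[y0 y1] xy m0 M0.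
  have [r] : exists2 r, r \in `[x, y]%R & V r = 0.
    apply: IVT => //; last by rewrite m0 M0.
    apply: continuous_in_subspaceT => r; rewrite inE /= in_itv /= => /andP[h1 h2].
    by apply: cV; rewrite (lt_le_trans x0) // (le_lt_trans h2).
  rewrite in_itv /= => /andP[h1 h2] /eqP; rewrite (negbTE (Vn r _)) //.
  by rewrite (lt_le_trans x0) // (le_lt_trans h2).
have [st|ts] := leP s t.
  by apply: (between s t) => //; rewrite ?ge_min ?le_max ?Vt ?(ltW Vs) ?orbT.
by apply: (between t s) => //; rewrite ?ge_min ?le_max ?Vt ?(ltW Vs) ?(ltW ts) ?orbT.
Qed.

Lemma velocityE t : t0 < t < t1 -> g (X t) * V t = 1.
Proof.
move=> tP; have Xt := trajectory_range tP.
have Vt := velocity_pos tP.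
rewrite /invsqrtf (_ : `|_| = V t ^+ 2); last first.
  by rewrite VX // -[LHS]mul1r -eps1 -normrM gtr0_norm // fpos.
by rewrite sqrtr_sqr gtr0_norm // mulVf // gt_eqF.
Qed.

(** The equation V^2 = |f X| with V > 0 says that dx / sqrt |f x| is kap dt
    along the trajectory. *)
Lemma quarter_period (l : R -> R) : continuous l ->
  (forall x, u0 < x < u1 -> 0 <= l x) ->
  ooint u0 u1 (fun x => l x * g x) = ooint t0 t1 (fun t => kap * l (X t)).
Proof.
move=> cl l0.
have H := @improper_substitution _ t0 t1 X (fun t => kap * V t) (fun x => l x * g x)
  t01 cX dX.
rewrite X0 X1 in H; rewrite /ooint H.
- apply: eq_ooint => t tP.
  by rewrite -mulrA [kap * V t]mulrC [g _ * _]mulrA velocityE // mul1r mulrC.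
- by move=> t tP; rewrite mulr_gt0 // velocity_pos.
- move=> t; rewrite in_itv /= => tP; apply: cvgM; [exact: cvg_cst|exact: cV].
- apply: in_continuousM; first exact: cl.
  move=> x; rewrite in_itv /= => /fpos fx; apply: invsqrtf_continuous.
  by apply: contraTneq fx => ->; rewrite mulr0 ltxx.
- by move=> x; rewrite in_itv /= => xP; rewrite mulr_ge0 ?invsqrtf_ge0 // l0.
Qed.

End QuarterPeriod.

(** * Integrals of even functions *)

Section EvenIntegrals.
Context {R : realType}.
Implicit Types (u v x y : R) (h : R -> R).

Lemma ooint_nil u h : ooint u u h = 0%E.
Proof. by rewrite /ooint set_itv_ge -?leNgt ?bnd_simp // integral_set0. Qed.

Lemma ooint_split_le (u v w : R) h : u <= v -> v <= w ->
  {in `]u, w[, continuous h} -> (forall x, u < x < w -> 0 <= h x) ->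
  ooint u w h = (ooint u v h + ooint v w h)%E.
Proof.
rewrite le_eqVlt => /predU1P[->|uv]; first by rewrite ooint_nil add0e.
rewrite le_eqVlt => /predU1P[->|vw]; first by rewrite ooint_nil adde0.
exact: ooint_split.
Qed.

Lemma ooint_reflect (u v : R) h : u < v ->
  {in `]u, v[, continuous h} -> (forall x, u < x < v -> 0 <= h x) ->
  (forall x, u < x < v -> h (u + v - x) = h x) ->
  ooint ((u + v) / 2) v h = ooint u ((u + v) / 2) h.
Proof.
move=> uv hc h0 ev; set m := (u + v) / 2.
have um : u < m by rewrite /m; lra.
have mv : m < v by rewrite /m; lra.
have D x : u < x < m -> is_derive x 1 (fun y => u + v - y) (- 1).
  by move=> _; apply: is_derive_eq; ring.
rewrite /ooint (@improper_substitution_decreasing _ u m m v (fun y => u + v - y)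
  (fun=> 1) h um mv _ _ D).
- apply: eq_ooint => x /andP[h1 h2]; rewrite mulr1 ev // h1.
  exact: lt_trans h2 mv.
- by move=> x /andP[h1 h2]; rewrite /m in h2 *; apply/andP; split; lra.
- move=> y /andP[h1 h2]; exists (u + v - y); last by ring.
  by rewrite /m in h1 *; apply/andP; split; lra.
- by move=> x _; exact: ltr01.
- by move=> x _; exact: cvg_cst.
- by move=> x; rewrite in_itv /= => /andP[h1 h2]; apply: hc; rewrite in_itv /= h2 (lt_trans um).
- by move=> x; rewrite in_itv /= => /andP[h1 h2]; apply: h0; rewrite h2 (lt_trans um).
Qed.

(** A function which is even about the midpoints of [0, sg] and of [sg, 1] has
    the same integral on both sides of each of them. *)
Lemma ooint_two_reflections (sg : R) h : 0 <= sg <= 1 ->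
  {in `]0, 1[, continuous h} -> (forall x, 0 < x < 1 -> 0 <= h x) ->
  (forall x, 0 < x < sg -> h (sg - x) = h x) ->
  (forall x, sg < x < 1 -> h (sg + 1 - x) = h x) ->
  ooint 0 1 h = (ooint (sg / 2) ((sg + 1) / 2) h + ooint (sg / 2) ((sg + 1) / 2) h)%E.
Proof.
move=> /andP[s0 s1] hc h0 ev0 ev1.
have sub u v : 0 <= u -> v <= 1 -> {in `]u, v[, continuous h} /\
    (forall x, u < x < v -> 0 <= h x).
  move=> u0 v1; split=> x; rewrite ?in_itv /= => /andP[h1 h2].
    by apply: hc; rewrite in_itv /= (le_lt_trans u0) // (lt_le_trans h2).
  by apply: h0; rewrite (le_lt_trans u0) // (lt_le_trans h2).
have half u v : 0 <= u -> u <= v -> v <= 1 -> (forall x, u < x < v -> h (u + v - x) = h x) ->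
    ooint u v h = (ooint ((u + v) / 2) v h + ooint ((u + v) / 2) v h)%E /\
    ooint u v h = (ooint u ((u + v) / 2) h + ooint u ((u + v) / 2) h)%E.
  move=> u0; rewrite le_eqVlt => /predU1P[<- _ _|uv v1 ev].
    have -> : (u + u) / 2 = u by field.
    by rewrite !ooint_nil adde0.
  have [hc1 h01] := sub u v u0 v1.
  have E : ooint u v h = (ooint u ((u + v) / 2) h + ooint ((u + v) / 2) v h)%E.
    by apply: ooint_split => //; lra.
  by rewrite E (ooint_reflect uv hc1 h01 ev).
have ev0' x : 0 < x < sg -> h (0 + sg - x) = h x by rewrite add0r; exact: ev0.
have [E0 _] := half 0 sg (lexx _) s0 s1 ev0'.
have [_ E1] := half sg 1 s0 s1 (lexx _) ev1.
rewrite (ooint_split_le s0 s1 hc h0) E0 E1 add0r addeACA.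
have [hc2 h02] : {in `]sg / 2, (sg + 1) / 2[, continuous h} /\
    (forall x, sg / 2 < x < (sg + 1) / 2 -> 0 <= h x) by apply: sub; lra.
by rewrite -(@ooint_split_le (sg / 2) sg ((sg + 1) / 2)) //; lra.
Qed.

Notation mu := (@lebesgue_measure R).

Lemma measure_oo u v : u <= v -> mu `]u, v[ = (v - u)%:E.
Proof.
rewrite lebesgue_measure_itv /= lte_fin le_eqVlt => /predU1P[->|->] //.
by rewrite ltxx subrr.
Qed.

Lemma bounded_integrable_oo u v h (M : R) : {in `]u, v[, continuous h} ->
  (forall x, u < x < v -> `|h x| <= M) -> mu.-integrable `]u, v[ (EFin \o h).
Proof.
move=> hc hM; apply: measurable_bounded_integrable => //.
- have [uv|vu] := leP u v.
    exact: (eq_ind_r (fun z => (z < +oo)%E) (ltry _) (measure_oo uv)).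
  by rewrite set_itv_ge ?measure0 // -leNgt bnd_simp ltW.
- by apply/measurable_EFinP; exact: continuous_measurable_oo.
- exists M; split; first exact: num_real.
  move=> N MN x /=; rewrite in_itv /= => /hM h1; exact: le_trans h1 (ltW MN).
Qed.

Lemma ooint_Rintegral u v h : mu.-integrable `]u, v[ (EFin \o h) ->
  ooint u v h = (\int[mu]_(x in `]u, v[) h x)%:E.
Proof. by move=> ih; rewrite /Rintegral fineK //; exact: integrable_fin_num. Qed.

Lemma ooint_cst u v (k : R) : u <= v -> ooint u v (fun=> k) = (k * (v - u))%:E.
Proof. by move=> uv; rewrite /ooint integral_cst //; exact: (congr1 (fun z => k%:E * z)%E (measure_oo uv)). Qed.

Lemma Rintegral_cc_oo u v h0 h : {in `]u, v[, continuous h} ->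
  (forall x, u < x < v -> h0 x = h x) ->
  \int[mu]_(x in `[u, v]) h0 x = \int[mu]_(x in `]u, v[) h x.
Proof.
move=> hc E; rewrite /Rintegral; congr fine.
rewrite integral_itv_bndoo.
  by apply: eq_integral => x; rewrite inE /= in_itv /= => /E ->.
apply: eq_measurable_fun (continuous_measurable_oo hc) => x.
by rewrite inE /= in_itv /= => /E ->.
Qed.

Lemma Rintegral_affine u v h (A B : R) : u <= v ->
  mu.-integrable `]u, v[ (EFin \o h) ->
  \int[mu]_(x in `]u, v[) (A + B * h x) =
  A * (v - u) + B * \int[mu]_(x in `]u, v[) h x.
Proof.
move=> uv ih.
have ic : mu.-integrable `]u, v[ (EFin \o (fun=> A)).
  apply: (@bounded_integrable_oo u v (fun=> A) `|A|) => // x _; exact: cvg_cst.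
have iB : mu.-integrable `]u, v[ (EFin \o (fun x => B * h x)).
  have mD : measurable (`]u, v[%classic : set (measurableTypeR R)) by [].
  have := integrableZl mD B ih; apply: eq_integrable => //.
rewrite RintegralD // RintegralZl // Rintegral_cst //.
by congr (_ * _ + _); exact: (congr1 fine (measure_oo uv)).
Qed.

End EvenIntegrals.

(** * Periods along a straight path *)

Section PathPeriod.
Context {R : realType} (a : R) (L : Lshape R) (c : R) (phi : surface L -> curve a).
Local Notation C := (cplx R).
Local Notation fR := (fpoly a).
Local Notation g := (invsqrtf a).
Local Notation X := (curve a).
Implicit Types (s t x y : R).
Hypothesis bih : biholomorphic (surface_atlas L) (curve_atlas a) phi.
Variables (omega : Defs.form (curve_atlas a)).
Hypothesis c0 : 0 < c.
Hypothesis hol : holomorphic_form omega.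
Hypothesis omegaZ : forall p, curve_dom (a:=a) Zloc p -> omega Zloc p = (wc p)^-1.
Hypothesis pull : is_pullback phi (fun i p => rc c * omega i p) (@dzeta R L).
Hypothesis a1 : 1 < a.
Variables (x0 y0 dx dy : R).
Hypothesis inn : forall t, 0 < t < 1 -> inner_xy L (x0 + t * dx) (y0 + t * dy).
Hypothesis slope0 : slope dx dy != 0.
Hypothesis pol : forall t, 0 <= t <= 1 -> polygon L (at_xy L (x0 + t * dx) (y0 + t * dy)).

Let path t := straight_path L x0 y0 dx dy t.
Let P t := phi (path t).
Let Z t := zc (P t).
Let W t := wc (P t).

Variables (u : C) (eps kap sg u0 u1 rho : R).
Hypothesis kE : slope dx dy / rc c = u * rc kap.
Hypothesis kap0 : 0 < kap.
Hypothesis eps2 : eps * eps = 1.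
Hypothesis uu : u * u = rc eps.
Hypothesis cju : cconj u = rc eps * u.
Hypothesis sg01 : 0 <= sg <= 1.
Hypothesis u01 : u0 < u1.
Hypothesis start : affine_point (P (sg / 2)) (rc u0) 0.
Hypothesis stop : affine_point (P ((sg + 1) / 2)) (rc u1) 0.
Hypothesis fpos : forall x, u0 < x < u1 -> 0 < eps * fR.[x].
Hypothesis rho_pos : forall x, u0 <= x <= u1 -> 0 <= rho * x.

Lemma affine_pointE (p : X) z w : affine_point p z w ->
  [/\ p <> None, zc p = z & wc p = w].
Proof. by move=> [v -> e]; rewrite /zc /wc e. Qed.

Let flow01 : hyperelliptic_flow a 0 1 (u * rc kap) Z W.
Proof.
move=> t t01; rewrite -kE.
exact: (path_ode bih c0 hol omegaZ pull a1 inn slope0 t01).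
Qed.

Let finite t : 0 < t < 1 -> P t <> None.
Proof. by move=> t01; exact: (path_finite bih c0 hol omegaZ pull inn slope0 t01). Qed.

Let Xt t := re (Z t).
Let Vt t := re (u * W t).

Let sg01' : 0 <= sg /\ sg <= 1. Proof. by move/andP: sg01. Qed.

Let real t : 0 < t < 1 -> Z t = rc (Xt t) /\ u * W t = rc (Vt t).
Proof.
move=> t01; have [s0 s1] := sg01'.
have [_ z0 w0] := affine_pointE start; have [_ z1 w1] := affine_pointE stop.
have [sg0|sg1] := ltP sg (1 / 2).
  apply: (flow_real flow01 eps2 cju (t0 := (sg + 1) / 2)) t01; first by lra.
    exact: z1.
  exact: w1.
apply: (flow_real flow01 eps2 cju (t0 := sg / 2)) t01; first by lra.
  exact: z0.
exact: w0.
Qed.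

Let sub_flow A B : 0 <= A -> B <= 1 -> hyperelliptic_flow a A B (u * rc kap) Z W.
Proof.
move=> A0 B1 t /andP[h1 h2]; apply: flow01.
by rewrite (le_lt_trans A0) // (lt_le_trans h2).
Qed.

Let even0 t : 0 < t < sg -> Xt (sg - t) = Xt t.
Proof.
move=> tP; have [s0 s1] := sg01'; have [_ _ w0] := affine_pointE start.
have := @flow_even _ a 0 sg u kap Z W (sub_flow (lexx _) s1).
by rewrite !add0r => /(_ w0 t tP); rewrite /Xt => ->.
Qed.

Let even1 t : sg < t < 1 -> Xt (sg + 1 - t) = Xt t.
Proof.
move=> tP; have [s0 s1] := sg01'; have [_ _ w1] := affine_pointE stop.
by have := flow_even (sub_flow s0 (lexx _)) w1 tP; rewrite /Xt => ->.
Qed.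

Let t0 := sg / 2.
Let t1 := (sg + 1) / 2.

Let t01 : t0 < t1. Proof. by rewrite /t0 /t1; lra. Qed.

Let in01 t : t0 < t < t1 -> 0 < t < 1.
Proof. by have [s0 s1] := sg01'; rewrite /t0 /t1 => /andP[h1 h2]; apply/andP; split; lra. Qed.

Let cXt : {within `[t0, t1], continuous Xt}.
Proof.
have [s0 s1] := sg01'.
have [n0 _ _] := affine_pointE start; have [n1 _ _] := affine_pointE stop.
apply/subspace_continuousP => t; rewrite /= in_itv /= => tP.
have PN : P t <> None.
  move/andP: tP => [h1 h2].
  have [->|tn0] := eqVneq t t0; first exact: n0.
  have [->|tn1] := eqVneq t t1; first exact: n1.
  by apply/finite/in01; rewrite !lt_neqAle h1 h2 eq_sym tn0 tn1.
have t01' : 0 <= t <= 1 by move: tP; rewrite /t0 /t1 => /andP[h1 h2]; apply/andP; split; lra.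
pose F := within `[t0, t1]%classic (nbhs t).
have Ft : F --> t by exact: cvg_within.
have near_pol : \forall s \near F, polygon L (at_xy L (x0 + s * dx) (y0 + s * dy)).
  rewrite /F near_withinE; apply: nearW => s /=; rewrite in_itv /= => sP; apply: pol.
  by move: sP; rewrite /t0 /t1 => /andP[h1 h2]; apply/andP; split; lra.
have c1 : path @ F --> path t by exact: (path_cvg Ft (pol t01') near_pol).
have pc : phi @ path t --> P t by exact: (phi_continuous bih).
have c2 : P @ F --> P t.
  exact: (cvg_comp path phi c1 pc).
have c3 : Z @ F --> Z t by exact: (cvg_comp P (@zc R a) c2 (zc_cvg PN)).
exact: cvg_re c3.
Qed.

Let X0 : Xt t0 = u0.
Proof. by have [_ e _] := affine_pointE start; rewrite /Xt /Z /t0 e. Qed.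

Let X1 : Xt t1 = u1.
Proof. by have [_ e _] := affine_pointE stop; rewrite /Xt /Z /t1 e. Qed.

Let rek t : re (u * rc kap * W t) = kap * Vt t.
Proof. by rewrite mulrAC reM re_rc im_rc mulr0 subr0 mulrC. Qed.

Let dXt t : t0 < t < t1 -> is_derive t 1 Xt (kap * Vt t).
Proof. by move=> /in01 /flow01 [zd _]; have := cderiv_re zd; rewrite rek. Qed.

Let cVt t : t0 < t < t1 -> Vt @ t --> Vt t.
Proof.
move=> /in01 /flow01 [_ /cderiv_continuous wd].
have h : (fun s => u * W s) @ t --> u * W t by exact: (cvgM (cvg_cst _) wd).
exact: cvg_re h.
Qed.

Let curveE t : 0 < t < 1 -> Vt t ^+ 2 = eps * fR.[Xt t].
Proof.
move=> tP; have [zr wr] := real tP; apply: (@rc_inj R).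
rewrite rcX -wr exprMn expr2 uu /W curve_eqn; last exact: finite.
by rewrite -/(Z t) zr fpoly_rc rcM.
Qed.

Let root t x : 0 < t < 1 -> eps * fR.[x] = 0 -> Xt t = x -> Z t = rc x /\ W t = 0.
Proof.
move=> tP fx Xx; have [zr wr] := real tP; split; first by rewrite zr Xx.
have := curveE tP; rewrite Xx fx => /eqP; rewrite sqrf_eq0 => /eqP v0.
move: wr; rewrite v0 => /eqP; rewrite mulf_eq0 => /orP[/eqP u00|/eqP //].
move: uu; rewrite u00 mul0r => /esym/eqP; rewrite rc_eq0 => /eqP e0.
by move/eqP: eps2; rewrite e0 mul0r eq_sym oner_eq0.
Qed.

Let path_injective s t : 0 < t < 1 -> 0 <= s <= 1 -> path t = path s -> t = s.
Proof.
move=> tP sP /(pt_inj (inn tP) (pol sP)) [/addrI e1 /addrI e2].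
have : slope dx dy * rc (t - s) = 0.
  rewrite /slope; apply: cplx_eq; rewrite ?reM ?imM /re /im /=; lra.
by move/eqP; rewrite mulf_eq0 (negbTE slope0) rc_eq0 subr_eq0 => /eqP.
Qed.

Let end_roots : eps * fR.[u0] = 0 /\ eps * fR.[u1] = 0.
Proof.
have [n0 z0 w0] := affine_pointE start; have [n1 z1 w1] := affine_pointE stop.
have h x p : p <> None -> @zc R a p = rc x -> wc p = 0 -> eps * fR.[x] = 0.
  move=> pN zx wx; have := curve_eqn pN; rewrite zx wx expr0n fpoly_rc /= => /esym/eqP.
  by rewrite rc_eq0 => /eqP ->; rewrite mulr0.
by split; [exact: (h u0 _ n0)|exact: (h u1 _ n1)].
Qed.

Let avoid t : t0 < t < t1 -> Xt t <> u0 /\ Xt t <> u1.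
Proof.
move=> tP; have [s0 s1] := sg01'; have [f0 f1] := end_roots; have tP' := in01 tP.
have [n0 z0 w0] := affine_pointE start; have [n1 z1 w1] := affine_pointE stop.
move/andP: tP => [h0 h1]; split=> e.
  have [zt wt] := root tP' f0 e.
  have E : P t = P t0 by apply: curve_inj => //; [exact: finite|rewrite z0|rewrite w0].
  have := path_injective tP' _ (phi_inj bih E).
  by rewrite /t0 => h; have := h _; rewrite /t0 in h0; lra.
have [zt wt] := root tP' f1 e.
have E : P t = P t1 by apply: curve_inj => //; [exact: finite|rewrite z1|rewrite w1].
have := path_injective tP' _ (phi_inj bih E).
by rewrite /t1 => h; have := h _; rewrite /t1 in h1; lra.
Qed.

Let range_in t : t0 < t < t1 -> u0 < Xt t < u1.
Proof. exact: (trajectory_range u01 cXt X0 X1 avoid). Qed.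

Let range t : 0 < t < 1 -> u0 <= Xt t <= u1.
Proof.
have [s0 s1] := sg01'.
have mid s : t0 <= s <= t1 -> u0 <= Xt s <= u1.
  move=> /andP[h1 h2].
  have [->|n0] := eqVneq s t0; first by rewrite X0 lexx ltW.
  have [->|n1] := eqVneq s t1; first by rewrite X1 lexx ltW.
  have /range_in/andP[h3 h4] : t0 < s < t1 by rewrite !lt_neqAle h1 h2 eq_sym n0 n1.
  by rewrite !ltW.
move=> /andP[h1 h2].
have [tt0|tt0] := leP t0 t; last first.
  rewrite -even0; last by rewrite h1 /=; move: tt0; rewrite /t0; lra.
  by apply: mid; move: tt0; rewrite /t0 /t1 => tt0; apply/andP; split; lra.
have [tt1|tt1] := leP t t1; first by apply: mid; rewrite tt0.
rewrite -even1; last by rewrite h2 andbT; move: tt1; rewrite /t1; lra.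
by apply: mid; move: tt1; rewrite /t0 /t1 => tt1; apply/andP; split; lra.
Qed.

Let cX01 : {in `]0, 1[, continuous Xt}.
Proof.
move=> t; rewrite in_itv /= => /flow01 [/cderiv_continuous zd _].
exact: cvg_re zd.
Qed.

Notation mu := (@lebesgue_measure R).

Let Xbound t : 0 < t < 1 -> `|Xt t| <= `|u0| + `|u1|.
Proof.
move=> /range/andP[h1 h2].
have n0 : - `|u0| <= u0 by rewrite lerNl -normrN ler_norm.
have n1 : u1 <= `|u1| by exact: ler_norm.
have p0 : 0 <= `|u0| by []. have p1 : 0 <= `|u1| by [].
by rewrite ler_norml; apply/andP; split; lra.
Qed.

Let iX : mu.-integrable `]0, 1[ (EFin \o Xt).
Proof. exact: (bounded_integrable_oo cX01 Xbound). Qed.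

Let half_range : (sg + 1) / 2 - sg / 2 = 1 / 2 :> R.
Proof. by field. Qed.

Let quarter (l : R -> R) : continuous l -> (forall x, u0 < x < u1 -> 0 <= l x) ->
  ooint u0 u1 (fun x => l x * g x) = ooint t0 t1 (fun t => kap * l (Xt t)).
Proof.
have eps1 : `|eps| = 1.
  by apply/eqP; rewrite -(@eqrXn2 _ 2) // expr1n -normrX expr2 eps2 normr1.
exact: (quarter_period t01 u01 kap0 eps1 cXt X0 X1 dXt cVt
  (fun t tP => curveE (in01 tP)) avoid fpos).
Qed.

Lemma path_period_g : ooint u0 u1 g = (kap / 2)%:E.
Proof.
rewrite (@eq_ooint _ u0 u1 g (fun x => 1 * g x)); last by move=> x _; rewrite mul1r.
rewrite (@quarter (fun=> 1)).
- by rewrite ooint_cst ?(ltW t01) // mulr1 /t1 /t0 half_range mul1r.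
- by move=> x; exact: cvg_cst.
- by [].
Qed.

Let I := \int[mu]_(t in `]0, 1[) Xt t.

Lemma path_period_xg : ooint u0 u1 (fun x => rho * x * g x) = (kap * rho * I / 2)%:E.
Proof.
rewrite (@quarter (fun x => rho * x)).
- pose h t := kap * (rho * Xt t).
  have hE t : h t = 0 + kap * rho * Xt t by rewrite /h; ring.
  have hc : {in `]0, 1[, continuous h}.
    move=> t tP; apply: cvgM; first exact: cvg_cst.
    by apply: cvgM; [exact: cvg_cst|exact: cX01].
  have h0 t : 0 < t < 1 -> 0 <= h t.
    by move=> /range/rho_pos r; rewrite mulr_ge0 // ltW.
  have ev0 t : 0 < t < sg -> h (sg - t) = h t by move=> tP; rewrite /h even0.
  have ev1 t : sg < t < 1 -> h (sg + 1 - t) = h t by move=> tP; rewrite /h even1.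
  have := ooint_two_reflections sg01 hc h0 ev0 ev1.
  have -> : ooint 0 1 h = (kap * rho * I)%:E.
    rewrite ooint_Rintegral; last first.
      apply: (@bounded_integrable_oo _ 0 1 h (kap * (`|rho| * (`|u0| + `|u1|)))) => //.
      move=> t tP; rewrite /h normrM gtr0_norm // ler_pM2l // normrM ler_wpM2l //.
      exact: Xbound.
    have -> : \int[mu]_(t in `]0, 1[) h t =
        \int[mu]_(t in `]0, 1[) (0 + kap * rho * Xt t).
      by apply: eq_Rintegral => t _; exact: hE.
    by rewrite Rintegral_affine // mul0r add0r.
  rewrite -/t0 -/t1; case: (ooint t0 t1 h) => [y| |] //= [e].
  by congr EFin; rewrite e; field.
- by move=> x; apply: cvgM; [exact: cvg_cst|exact: cvg_id].
- by move=> x /andP[h1 h2]; apply: rho_pos; rewrite !ltW.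
Qed.

Section Integral.
Variables (om : Defs.form (curve_atlas a)) (m0 m1 : C).
Hypothesis omE : forall i p, p <> None -> curve_dom (a:=a) i p ->
  om i p = (m0 + m1 * zc p) * omega i p.

(** Every chart gives the same value, and one of the coordinates z, w is a chart
    at each finite point. *)
Lemma form_on_pathE t : 0 < t < 1 ->
  form_on_path om P t = u * rc kap * (m0 + m1 * rc (Xt t)).
Proof.
move=> tP; have PN := finite tP; have [zr _] := real tP.
have val i : curve_dom (a:=a) i (P t) ->
    om i (P t) * velocity (curve_coord (a:=a) i \o P) t =
    u * rc kap * (m0 + m1 * rc (Xt t)).
  move=> Pi; have [D dD e] := path_velocity c0 pull inn slope0 tP Pi.
  rewrite (cderiv_velocity dD) omE // -kE -e -zr /Z /P.
  by ring.
rewrite /form_on_path; set S := [set v | _].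
have [v Sv] : exists v, S v.
  have [w0|w0] := eqVneq (W t) 0; last first.
    have Pd := Zloc_dom PN w0; exists (om Zloc (P t) * velocity (curve_coord (a:=a) Zloc \o P) t).
    by exists Zloc.
  have Pd : curve_dom (a:=a) Wloc (P t).
    split => //; apply/eqP; apply: simple_roots => //.
    by rewrite -curve_eqn // -/(W t) w0 expr0n.
  exists (om Wloc (P t) * velocity (curve_coord (a:=a) Wloc \o P) t).
  by exists Wloc.
have [i Pi ->] : S (xget 0 S) by apply: xgetPex; exists v.
exact: val.
Qed.

Lemma path_integralE :
  path_integral om P = u * (m0 * rc kap + m1 * rc (kap * I)).
Proof.
(* The parts re and im of the integrand are handled by the same argument. *)
have K (l : C -> R) : (forall z w, l (z + w) = l z + l w) ->
    (forall z x, l (z * rc x) = l z * x) ->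
    \int[mu]_(t in `[0, 1]) l (form_on_path om P t) =
    l (u * (m0 * rc kap + m1 * rc (kap * I))).
  move=> lD lM.
  pose A := l (u * rc kap * m0); pose B := l (u * rc kap * m1).
  have E t : 0 < t < 1 -> l (form_on_path om P t) = A + B * Xt t.
    by move=> tP; rewrite form_on_pathE // mulrDr lD mulrA lM.
  have cAB : {in `]0, 1[, continuous (fun t => A + B * Xt t)}.
    move=> t tP; apply: cvgD; first exact: cvg_cst.
    by apply: cvgM; [exact: cvg_cst|exact: cX01].
  rewrite (Rintegral_cc_oo cAB E) Rintegral_affine // subr0 mulr1 /A /B.
  rewrite mulrAC lM mulrAC lM mulrDr lD [u * (m0 * _)]mulrA lM rcM !mulrA lM lM.
  by rewrite -!mulrA.
rewrite /path_integral.
rewrite (K (@re R)) ?(K (@im R)); last first.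
- by move=> z x; rewrite reM re_rc im_rc mulr0 subr0.
- exact: reD.
- by move=> z x; rewrite imM re_rc im_rc mulr0 add0r.
- exact: imD.
by rewrite -cpxE.
Qed.

End Integral.

(** The two integrals between the branch points determine the periods of all
    combinations of dz/w and z dz/w along the path.  The factor rho is a sign
    that makes x dx / sqrt |f x| nonnegative; J is the mean of x along the path. *)
Lemma path_periods : ooint u0 u1 g = (kap / 2)%:E /\
  exists2 J : R, ooint u0 u1 (fun x => rho * x * g x) = (kap * rho * J / 2)%:E &
    forall (om : Defs.form (curve_atlas a)) m0 m1,
      (forall i p, p <> None -> curve_dom (a:=a) i p ->
        om i p = (m0 + m1 * zc p) * omega i p) ->
      path_integral om P = u * (m0 * rc kap + m1 * rc (kap * J)).
Proof.
split; first exact: path_period_g.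
exists I; first exact: path_period_xg.
by move=> om m0 m1; exact: path_integralE.
Qed.

End PathPeriod.

(** * Coordinates of dz/w and z dz/w in a basis *)

Lemma ord2P (j : 'I_2) : j = 0 \/ j = 1.
Proof. by case: j => -[|[|]] // jP; [left|right]; apply: val_inj. Qed.

Lemma big_ord2 (V : nmodType) (F : 'I_2 -> V) : \sum_j F j = F 0 + F 1.
Proof.
by rewrite big_ord_recl big_ord1; congr (_ + F _); apply: val_inj.
Qed.

Section BasisChange.
Context {R : realType} (a : R).
Local Notation C := (cplx R).
Local Notation f := (fpoly (rc a : C)).
Local Notation X := (curve a).
Variables (omega : Defs.form (curve_atlas a)).
Hypothesis a1 : 1 < a.
Hypothesis hol : holomorphic_form omega.
Hypothesis omegaZ : forall p, curve_dom (a:=a) Zloc p -> omega Zloc p = (wc p)^-1.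
Hypothesis NI : forall p : X, ProperFilter p^'.
Variables (c0 c1 : X).
Hypotheses (c0P : affine_point c0 0 0) (c1P : affine_point c1 1 0).
Variable basis : 'I_2 -> Defs.form (curve_atlas a).
Hypothesis basisP : holomorphic_basis basis.

Lemma branch_point_coef (p : X) z : affine_point p z 0 ->
  [/\ p <> None, curve_dom (a:=a) Wloc p & omega Wloc p != 0].
Proof.
move=> /affine_pointE [pN zE w0].
have f0 : f^`().[zc p] != 0.
  by apply: simple_roots => //; rewrite -curve_eqn // w0 expr0n.
split => //; first by split => //; apply/eqP.
by rewrite (omega_Wloc hol omegaZ NI) // mulf_neq0 ?invr_eq0 // pnatr_eq0.
Qed.

(** Since dz/w and z dz/w are combinations of the basis and are independent,
    as their values at the points (0, 0) and (1, 0) show, the matrix of these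
    combinations is invertible; its inverse gives the coordinates of the
    elements of the basis. *)
Lemma basis_change : exists2 N : 'M[C]_2, N \in unitmx &
  forall k i p, p <> None -> curve_dom (a:=a) i p ->
    basis k i p = (N k 0 + N k 1 * zc p) * omega i p.
Proof.
have [_ _ span] := basisP.
have [b0 b0P] := span _ hol.
have [b1 b1P] := span _ (z_form_holomorphic hol omegaZ NI).
pose B : 'M[C]_2 := \matrix_(j, k) (if j == 0 then b0 k else b1 k).
pose eta (j : 'I_2) : Defs.form (curve_atlas a) := if j == 0 then omega else z_form omega.
have etaE j i p : curve_dom (a:=a) i p -> eta j i p = \sum_k B j k * basis k i p.
  move=> ip; rewrite /eta; case: eqP => [->|/eqP j0].
    by rewrite b0P //; apply: eq_bigr => k _; rewrite mxE.
  by rewrite b1P //; apply: eq_bigr => k _; rewrite mxE (negbTE j0).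
have Bu : B \in unitmx.
  rewrite -row_free_unit -kermx_eq0; apply/rowV0P => v /sub_kermxP vB.
  have v0 i p : p <> None -> curve_dom (a:=a) i p ->
      (v 0 0 + v 0 1 * zc p) * omega i p = 0.
    move=> pN ip.
    have : \sum_j v 0 j * eta j i p = 0.
      under eq_bigr => j _ do rewrite etaE // mulr_sumr.
      rewrite exchange_big /= big1 // => k _.
      under eq_bigr => j _ do rewrite mulrA.
      rewrite -mulr_suml; move/rowP: vB => /(_ k); rewrite !mxE => ->.
      by rewrite mul0r.
    by rewrite big_ord2 /eta /= z_formE // => <-; rewrite mulrDl mulrA.
  have [n0 d0 o0] := branch_point_coef c0P; have [n1 d1 o1] := branch_point_coef c1P.
  have [_ z0 _] := affine_pointE c0P; have [_ z1 _] := affine_pointE c1P.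
  have /eqP := v0 _ _ n0 d0; rewrite z0 mulr0 addr0 mulf_eq0 (negbTE o0) orbF => /eqP v00.
  have /eqP := v0 _ _ n1 d1; rewrite z1 v00 add0r mulr1 mulf_eq0 (negbTE o1) orbF => /eqP v01.
  by apply/rowP => j; rewrite mxE; case: (ord2P j) => ->.
exists (invmx B); first by rewrite unitmx_inv.
move=> k i p pN ip.
have -> : basis k i p = \sum_j invmx B k j * eta j i p.
  under eq_bigr => j _ do rewrite etaE // mulr_sumr.
  rewrite exchange_big /= (eq_bigr (fun l => (1%:M : 'M[C]_2) k l * basis l i p)); last first.
    move=> l _; rewrite -(mulVmx Bu) mxE mulr_suml.
    by apply: eq_bigr => j _; rewrite mulrA.
  rewrite (bigD1 k) //= big1 ?addr0 ?mxE ?eqxx ?mul1r // => l lk.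
  by rewrite mxE eq_sym (negbTE lk) mul0r.
by rewrite big_ord2 /eta /= z_formE // mulrDl mulrA.
Qed.

End BasisChange.

(** * The periods along the four curves *)

Section FourPeriods.
Context {R : realType} (a : R) (L : Lshape R) (c : R) (phi : surface L -> curve a).
Local Notation C := (cplx R).
Local Notation fR := (fpoly a).
Local Notation g := (invsqrtf a).
Local Notation h := ((side L)%:num).
Local Notation l := ((width L)%:num).
Hypothesis a1 : 1 < a.
Hypothesis hphi : uniformization c phi.
Variable omega : Defs.form (curve_atlas a).
Hypothesis hol : holomorphic_form omega.
Hypothesis omegaZ : forall p, curve_dom (a:=a) Zloc p -> omega Zloc p = (wc p)^-1.
Hypothesis pull : is_pullback phi (fun i p => rc c * omega i p) (@dzeta R L).

Let bih := phi_biholomorphic hphi.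
Let c0 := c_gt0 hphi.

(** A and B are the periods of dz/w and z dz/w, divided by u. *)
Definition periods_along (gam : R -> surface L) (u : C) (A B : R) :=
  forall (om : Defs.form (curve_atlas a)) m0 m1,
    (forall i p, p <> None -> curve_dom (a:=a) i p ->
      om i p = (m0 + m1 * zc p) * omega i p) ->
    path_integral om (phi \o gam) = u * (m0 * rc A + m1 * rc B).

Let h0 : 0 < h. Proof. by []. Qed.
Let l0 : 0 < l. Proof. by []. Qed.
Let a0 : 0 < a. Proof. exact: lt_trans a1. Qed.

Let i2 : iC R * iC R = rc (-1). Proof. by rewrite iC2 rcN. Qed.
Let cji : cconj (iC R) = rc (-1) * iC R.
Proof. by rewrite /cconj /iC /rc; apply: cplx_eq; rewrite ?reM ?imM /re /im /=; ring. Qed.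

Let horizontal (d : R) : slope d 0 / rc c = 1 * rc (d / c) :> C.
Proof. by rewrite mul1r rcM rcV. Qed.
Let vertical (d : R) : slope 0 d / rc c = iC R * rc (d / c) :> C.
Proof. by rewrite /slope cpx_rc rc0 add0r rcM rcV mulrA. Qed.

Let slope_h (d : R) : 0 < d -> slope d 0 != 0 :> C.
Proof. by move=> d0; rewrite rc_eq0 gt_eqF. Qed.
Let slope_v (d : R) : 0 < d -> slope 0 d != 0 :> C.
Proof.
move=> d0; apply/eqP => /(congr1 (@im R)); rewrite /slope /im /= => e.
by rewrite e ltxx in d0.
Qed.

Let one_eps : (1 : R) * 1 = 1. Proof. exact: mulr1. Qed.
Let mone_eps : (-1 : R) * -1 = 1. Proof. by rewrite mulrNN mulr1. Qed.
Let uu1 : (1 : C) * 1 = rc 1. Proof. by rewrite mulr1. Qed.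
Let cju1 : cconj (1 : C) = rc 1 * 1. Proof. by rewrite cconj1 mulr1. Qed.

Lemma fpoly_odd x : fR.[- x] = - fR.[x].
Proof. by rewrite !fpolyE; ring. Qed.

Let f01_gt0 x : 0 < x < 1 -> 0 < 1 * fR.[x].
Proof.
move=> /andP[x0 x1].
have -> : 1 * fR.[x] = x * (1 - x ^+ 2) * (a ^+ 2 - x ^+ 2) by rewrite fpolyE; ring.
have xa : x < a by exact: lt_trans a1.
by rewrite !mulr_gt0 // subr_gt0 ?expr_lt1 ?ltr_pXn2r ?nnegrE // ltW.
Qed.

Let f1a_lt0 x : 1 < x < a -> 0 < -1 * fR.[x].
Proof.
move=> /andP[x1 xa]; have x0 : 0 < x by exact: lt_trans x1.
have -> : -1 * fR.[x] = x * (x ^+ 2 - 1) * (a ^+ 2 - x ^+ 2) by rewrite fpolyE; ring.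
by rewrite !mulr_gt0 // subr_gt0 ?exprn_egt1 ?ltr_pXn2r ?nnegrE // ltW.
Qed.

Let fN10_lt0 x : -1 < x < 0 -> 0 < -1 * fR.[x].
Proof.
move=> /andP[h1 h2]; have := @f01_gt0 (- x); rewrite fpoly_odd mulrN mulNr; apply.
by apply/andP; split; lra.
Qed.

Let fNa1_gt0 x : - a < x < -1 -> 0 < 1 * fR.[x].
Proof.
move=> /andP[h1 h2]; have := @f1a_lt0 (- x); rewrite fpoly_odd mulrNN; apply.
by apply/andP; split; lra.
Qed.

Lemma invsqrtf_even x : g (- x) = g x.
Proof.
rewrite /invsqrtf; congr (Num.sqrt _)^-1; rewrite -[RHS]normrN; congr `|_|.
by rewrite !fpolyE; ring.
Qed.

(** The integrand 1 / sqrt |f| is even. *)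
Lemma ooint_mirror u v (k : R -> R) : u < v -> {in `]u, v[, continuous g} ->
  continuous k -> (forall x, u < x < v -> 0 <= k x) ->
  ooint u v (fun x => k x * g x) = ooint (- v) (- u) (fun x => k (- x) * g x).
Proof.
move=> uv cg ck k0; rewrite /ooint (@improper_substitution_oppr _ u v) //.
- by apply: eq_ooint => x _; rewrite invsqrtf_even.
- exact: in_continuousM.
- by move=> x; rewrite in_itv /= => xP; rewrite mulr_ge0 ?invsqrtf_ge0 // k0.
Qed.

Lemma ooint_mirror1 u v : u < v -> {in `]u, v[, continuous g} ->
  ooint u v g = ooint (- v) (- u) g.
Proof.
move=> uv cg; rewrite /ooint (@improper_substitution_oppr _ u v) //.
- by apply: eq_ooint => x _; rewrite invsqrtf_even.
- by move=> x _; exact: invsqrtf_ge0.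
Qed.

Lemma ooint_mirrorx u v : 0 <= u -> u < v -> {in `]u, v[, continuous g} ->
  ooint u v (fun x => x * g x) = ooint (- v) (- u) (fun x => -1 * x * g x).
Proof.
move=> u0 uv cg; rewrite (@ooint_mirror u v id) //.
- by apply: eq_ooint => x _; rewrite mulN1r.
- by move=> x; exact: cvg_id.
- by move=> x /andP[ux _]; exact: le_trans (ltW ux).
Qed.

Let cg01 : {in `]0, 1[, continuous g}.
Proof. by move=> x; rewrite in_itv /= => xP; apply: invsqrtf_continuous; exact: f01_neq0. Qed.
Let cg1a : {in `]1, a[, continuous g}.
Proof. by move=> x; rewrite in_itv /= => xP; apply: invsqrtf_continuous; exact: f1a_neq0. Qed.

Let pathE x0 y0 dx dy (gam : R -> surface L) :
  (forall t, gam t = pt L (x0 + t * dx) (y0 + t * dy)) ->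
  phi \o gam = fun t => phi (straight_path L x0 y0 dx dy t).
Proof. by move=> E; apply/funext => t; rewrite /= E. Qed.

(** From (-a, 0) at time 0 to (-1, 0) at time 1/2; here f is positive. *)
Lemma alpha1_period : exists J : R, [/\ ooint 1 a g = (h / c / 2)%:E,
  ooint 1 a (fun x => x * g x) = (- (h / c * J) / 2)%:E &
  periods_along (alpha1 L) 1 (h / c) (h / c * J)].
Proof.
have inn t : 0 < t < 1 -> inner_xy L (0 + t * h) (- l / 2 + t * 0).
  move=> /andP[t0 t1]; apply/orP; right; rewrite add0r mulr0 addr0.
  have hp := h0; have lp := l0.
  have th : 0 < t * h < h by rewrite mulr_gt0 // gtr_pMl.
  by apply/andP; split; [exact: th|apply/andP; split; lra].
have pol t : 0 <= t <= 1 -> polygon L (at_xy L (0 + t * h) (- l / 2 + t * 0)).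
  move=> /andP[t0 t1]; rewrite add0r mulr0 addr0.
  have hp := h0; have lp := l0.
  apply: polygon_at_left; last by apply/andP; split; lra.
  by rewrite mulr_ge0 ?ler_piMl // ltW.
have start : affine_point (phi (straight_path L 0 (- l / 2) h 0 (0 / 2))) (rc (- a)) 0.
  have := left_Q1 hphi; rewrite -rcN; congr (affine_point (phi (pt L _ _)) _ _); ring.
have stop : affine_point (phi (straight_path L 0 (- l / 2) h 0 ((0 + 1) / 2))) (rc (- 1)) 0.
  have := center_Q1 hphi; rewrite rcN rc1.
  by congr (affine_point (phi (pt L _ _)) _ _); field.
have aa : - a < - 1 by rewrite ltrN2.
have rho_pos (x : R) : - a <= x <= - 1 -> 0 <= -1 * x by move=> /andP[_ ?]; lra.
have := @path_periods _ a L c phi bih omega c0 hol omegaZ pull a1 0 (- l / 2) h 0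
  inn (slope_h h0) pol 1 1 (h / c) 0 (- a) (- 1) (-1) (horizontal h) (divr_gt0 h0 c0)
  one_eps uu1 cju1 _ aa start stop fNa1_gt0 rho_pos.
case=> [|E1 [J E2 E3]]; first by rewrite lexx ler01.
exists J; split.
- by rewrite -E1; exact: ooint_mirror1.
- rewrite ooint_mirrorx // E2; congr EFin; ring.
- move=> om m0 m1 omE; rewrite (@pathE 0 (- l / 2) h 0); first exact: E3.
  by move=> t; rewrite /alpha1; congr (pt L _ _); ring.
Qed.

Let id1 u v : ooint u v (fun x => 1 * x * g x) = ooint u v (fun x => x * g x).
Proof. by apply: eq_ooint => x _; rewrite mul1r. Qed.

(** The centers of P0 and P1 are on the path at the times sg / 2 and
    (sg + 1) / 2, where sg is the time at which the path passes from P0 to P1. *)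
Lemma alpha2_period : exists J : R, [/\ ooint 0 1 g = ((h + l) / c / 2)%:E,
  ooint 0 1 (fun x => x * g x) = ((h + l) / c * J / 2)%:E &
  periods_along (alpha2 L) 1 ((h + l) / c) ((h + l) / c * J)].
Proof.
have hp := h0; have lp := l0; have hl : 0 < h + l by rewrite addr_gt0.
have hln : h + l != 0 by rewrite gt_eqF.
have inn t : 0 < t < 1 -> inner_xy L (0 + t * (h + l)) (h / 2 + t * 0).
  move=> /andP[t0 t1]; apply/orP; left; rewrite add0r mulr0 addr0.
  have th : 0 < t * (h + l) < h + l by rewrite mulr_gt0 // gtr_pMl.
  by apply/andP; split; [exact: th|apply/andP; split; lra].
have pol t : 0 <= t <= 1 -> polygon L (at_xy L (0 + t * (h + l)) (h / 2 + t * 0)).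
  move=> /andP[t0 t1]; rewrite add0r mulr0 addr0.
  apply: polygon_at; last by apply/andP; split; lra.
  by rewrite mulr_ge0 ?ler_piMl // ltW.
have sg : 0 <= h / (h + l) <= 1.
  by apply/andP; split; [rewrite divr_ge0 // ltW|rewrite ler_pdivrMr // mul1r lerDl].
have start : affine_point (phi (straight_path L 0 (h / 2) (h + l) 0 (h / (h + l) / 2))) (rc 0) 0.
  have := center_P0 hphi; congr (affine_point (phi (pt L _ _)) _ _); first by field.
  by ring.
have stop : affine_point (phi (straight_path L 0 (h / 2) (h + l) 0 ((h / (h + l) + 1) / 2))) (rc 1) 0.
  have := center_P1 hphi; congr (affine_point (phi (pt L _ _)) _ _); first by field.
  by ring.
have rho_pos (x : R) : 0 <= x <= 1 -> 0 <= 1 * x by move=> /andP[? _]; lra.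
have := @path_periods _ a L c phi bih omega c0 hol omegaZ pull a1 0 (h / 2) (h + l) 0
  inn (slope_h hl) pol 1 1 ((h + l) / c) (h / (h + l)) 0 1 1 (horizontal _)
  (divr_gt0 hl c0) one_eps uu1 cju1 sg ltr01 start stop f01_gt0 rho_pos.
case=> [E1 [J E2 E3]]; exists J; split; first exact: E1.
  by rewrite -id1 E2 mulr1.
move=> om m0 m1 omE; rewrite (@pathE 0 (h / 2) (h + l) 0); first exact: E3.
by move=> t; rewrite /alpha2; congr (pt L _ _); ring.
Qed.

(** From (-1, 0) in the center of Q1 to (0, 0) in the center of P0; here f is
    negative, and the velocity is imaginary. *)
Lemma beta1_period : exists J : R, [/\ ooint 0 1 g = ((h + l) / c / 2)%:E,
  ooint 0 1 (fun x => x * g x) = (- ((h + l) / c * J) / 2)%:E &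
  periods_along (beta1 L) (iC R) ((h + l) / c) ((h + l) / c * J)].
Proof.
have hp := h0; have lp := l0; have hl : 0 < h + l by rewrite addr_gt0.
have hln : h + l != 0 by rewrite gt_eqF.
have inn t : 0 < t < 1 -> inner_xy L (h / 2 + t * 0) (- l + t * (h + l)).
  move=> /andP[t0 t1]; apply/orP; right; rewrite mulr0 addr0.
  have /andP[th1 th2] : 0 < t * (h + l) < h + l by rewrite mulr_gt0 // gtr_pMl.
  by apply/andP; split; apply/andP; split; lra.
have pol t : 0 <= t <= 1 -> polygon L (at_xy L (h / 2 + t * 0) (- l + t * (h + l))).
  move=> /andP[t0 t1]; rewrite mulr0 addr0.
  have /andP[th1 th2] : 0 <= t * (h + l) <= h + l by rewrite mulr_ge0 ?ler_piMl // ltW.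
  by apply: polygon_at_left; apply/andP; split; lra.
have sg : 0 <= l / (h + l) <= 1.
  by apply/andP; split; [rewrite divr_ge0 // ltW|rewrite ler_pdivrMr // mul1r lerDr].
have start : affine_point (phi (straight_path L (h / 2) (- l) 0 (h + l) (l / (h + l) / 2))) (rc (- 1)) 0.
  have := center_Q1 hphi; rewrite rcN rc1; congr (affine_point (phi (pt L _ _)) _ _).
    by ring.
  by field.
have stop : affine_point (phi (straight_path L (h / 2) (- l) 0 (h + l) ((l / (h + l) + 1) / 2))) (rc 0) 0.
  have := center_P0 hphi; congr (affine_point (phi (pt L _ _)) _ _); first by ring.
  by field.
have rho_pos (x : R) : - 1 <= x <= 0 -> 0 <= -1 * x by move=> /andP[_ ?]; lra.
have N10 : - 1 < 0 :> R by rewrite oppr_lt0.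
have := @path_periods _ a L c phi bih omega c0 hol omegaZ pull a1 (h / 2) (- l) 0 (h + l)
  inn (slope_v hl) pol (iC R) (-1) ((h + l) / c) (l / (h + l)) (- 1) 0 (-1) (vertical _)
  (divr_gt0 hl c0) mone_eps i2 cji sg N10 start stop fN10_lt0 rho_pos.
case=> [E1 [J E2 E3]]; exists J; split.
- by rewrite -E1 -{2}oppr0; exact: ooint_mirror1.
- by rewrite ooint_mirrorx // oppr0 E2; congr EFin; ring.
- move=> om m0 m1 omE; rewrite (@pathE (h / 2) (- l) 0 (h + l)); first exact: E3.
  by move=> t; rewrite /beta1; congr (pt L _ _); ring.
Qed.

(** From (1, 0) at time 1/2 to (a, 0) at time 1; here f is negative. *)
Lemma beta2_period : exists J : R, [/\ ooint 1 a g = (h / c / 2)%:E,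
  ooint 1 a (fun x => x * g x) = (h / c * J / 2)%:E &
  periods_along (beta2 L) (iC R) (h / c) (h / c * J)].
Proof.
have hp := h0; have lp := l0.
have inn t : 0 < t < 1 -> inner_xy L (h + l / 2 + t * 0) (0 + t * h).
  move=> /andP[t0 t1]; apply/orP; left; rewrite add0r mulr0 addr0.
  have th : 0 < t * h < h by rewrite mulr_gt0 // gtr_pMl.
  by apply/andP; split; [apply/andP; split; lra|exact: th].
have pol t : 0 <= t <= 1 -> polygon L (at_xy L (h + l / 2 + t * 0) (0 + t * h)).
  move=> /andP[t0 t1]; rewrite add0r mulr0 addr0.
  apply: polygon_at; first by apply/andP; split; lra.
  by rewrite mulr_ge0 ?ler_piMl // ltW.
have sg : 0 <= (1 : R) <= 1 by rewrite ler01 lexx.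
have start : affine_point (phi (straight_path L (h + l / 2) 0 0 h (1 / 2))) (rc 1) 0.
  have := center_P1 hphi; congr (affine_point (phi (pt L _ _)) _ _); first by ring.
  by field.
have stop : affine_point (phi (straight_path L (h + l / 2) 0 0 h ((1 + 1) / 2))) (rc a) 0.
  have := upper_P1 hphi; congr (affine_point (phi (pt L _ _)) _ _); first by ring.
  by field.
have rho_pos (x : R) : 1 <= x <= a -> 0 <= 1 * x by move=> /andP[? _]; lra.
have := @path_periods _ a L c phi bih omega c0 hol omegaZ pull a1 (h + l / 2) 0 0 h
  inn (slope_v h0) pol (iC R) (-1) (h / c) 1 1 a 1 (vertical _)
  (divr_gt0 h0 c0) mone_eps i2 cji sg a1 start stop f1a_lt0 rho_pos.
case=> [E1 [J E2 E3]]; exists J; split; first exact: E1.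
  by rewrite -id1 E2 mulr1.
move=> om m0 m1 omE; rewrite (@pathE (h + l / 2) 0 0 h); first exact: E3.
by move=> t; rewrite /beta2; congr (pt L _ _); ring.
Qed.

End FourPeriods.

(** * The period matrix *)

Lemma Rintegral_of_ooint (R : realType) (u v : R) (k : R -> R) val :
  {in `]u, v[, continuous k} -> ooint u v k = val%:E ->
  \int[lebesgue_measure]_(x in `[u, v]) k x = val.
Proof.
by move=> kc e; rewrite (@Rintegral_cc_oo _ _ _ k k) // /Rintegral -/(ooint u v k) e.
Qed.

Lemma mx22_mul (K : comNzRingType) (x y z t x' y' z' t' : K) :
  mx22 x y z t *m mx22 x' y' z' t' =
  mx22 (x * x' + y * z') (x * y' + y * t') (z * x' + t * z') (z * y' + t * t').
Proof.
apply/matrixP => j k; rewrite !mxE big_ord2 !mxE.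
by case: (ord2P j) => ->; case: (ord2P k) => ->.
Qed.

Lemma mx22_unit (K : fieldType) (x y z t : K) : x * t - y * z != 0 ->
  mx22 x y z t \in unitmx.
Proof.
move=> d0.
suff /mulmx1_unit[] :
  mx22 x y z t *m ((x * t - y * z)^-1 *: mx22 t (- y) (- z) x) = 1%:M by [].
apply/matrixP => j k; rewrite -scalemxAr mx22_mul !mxE.
by case: (ord2P j) => ->; case: (ord2P k) => -> /=; field.
Qed.

(** One entry of A Pi = C, reduced to an identity between real numbers. *)
Lemma period_quotient (R : realType) (A B A' B' D Z : R) : D != 0 ->
  A * B + A' * B' = Z * D ->
  iC R / rc D * (rc A * rc B + rc A' * rc B') = iC R * rc Z.
Proof.
move=> D0 e; have D1 : rc D != 0 :> cplx R by rewrite rc_eq0.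
by rewrite -!rcM -rcD e rcM; field.
Qed.

Theorem theorem4p1 (R : realType) (a : R) (ha : 1 < a)
    (L : Lshape R) (c : R) (phi : surface L -> curve a)
    (hphi : uniformization c phi) :
  let f := fpoly a in
  let p := \int[lebesgue_measure]_(x in `[1, a]) (Num.sqrt `|f.[x]|)^-1 in
  let q := \int[lebesgue_measure]_(x in `[0, 1]) (Num.sqrt `|f.[x]|)^-1 in
  let r := - \int[lebesgue_measure]_(x in `[1, a]) (x / Num.sqrt `|f.[x]|) in
  let s := \int[lebesgue_measure]_(x in `[0, 1]) (x / Num.sqrt `|f.[x]|) in
  is_period_matrix (curve_atlas a)
    (fun k => cycle_image phi (alpha L k))
    (fun k => cycle_image phi (gamma L k))
    ((iC R / rc (p * s - q * r)) *:
       mx22 (rc (2 * q * s - p * r)) (rc (p * r))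
            (rc (p * r)) (rc (- 2 * p * r))).
Proof.
move=> f p q r s basis basisP.
have [omega [hol omegaZ] pull] := dzetaE hphi.
have c0 := c_gt0 hphi; have bih := phi_biholomorphic hphi.
have [J1 [P1 X1 I1]] := alpha1_period ha hphi hol omegaZ pull.
have [J2 [Q1 Y2 I2]] := alpha2_period ha hphi hol omegaZ pull.
have [J3 [_ Y3 I3]] := beta1_period ha hphi hol omegaZ pull.
have [J4 [_ X4 I4]] := beta2_period ha hphi hol omegaZ pull.
(* From here on only the numbers h / c and (h + l) / c matter. *)
have h0 : 0 < (side L)%:num by []. have l0 : 0 < (width L)%:num by [].
move: (side L)%:num (width L)%:num h0 l0 P1 Q1 X1 Y2 Y3 X4 I1 I2 I3 I4.
move=> h l h0 l0 P1 Q1 X1 Y2 Y3 X4 I1 I2 I3 I4.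
have cg01 : {in `]0, 1[, continuous (invsqrtf a)}.
  by move=> x; rewrite in_itv /= => xP; apply: invsqrtf_continuous; exact: f01_neq0.
have cg1a : {in `]1, a[, continuous (invsqrtf a)}.
  by move=> x; rewrite in_itv /= => xP; apply: invsqrtf_continuous; exact: f1a_neq0.
have cx (u v : R) : {in `]u, v[, continuous (invsqrtf a)} ->
    {in `]u, v[, continuous (fun x : R => x * invsqrtf a x)}.
  by move=> cg; apply: (@in_continuousM _ id) => // x; exact: cvg_id.
have pE : p = h / c / 2 by exact: (Rintegral_of_ooint cg1a P1).
have qE : q = (h + l) / c / 2 by exact: (Rintegral_of_ooint cg01 Q1).
have sE : s = (h + l) / c * J2 / 2 by exact: (Rintegral_of_ooint (cx _ _ cg01) Y2).
have rE : r = - (h / c * J4 / 2).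
  by congr (- _); exact: (Rintegral_of_ooint (cx _ _ cg1a) X4).
(* Each of the two integrals of x dx / sqrt |f| is obtained from a horizontal and
   from a vertical curve; comparing the results gives the other two periods. *)
have J1E : h / c * J1 = 2 * r.
  by move: X4; rewrite X1 rE => -[]; lra.
have J3E : (h + l) / c * J3 = - 2 * s.
  by move: Y3; rewrite Y2 sE => -[]; lra.
pose m := Num.sqrt a.
have a0 : 0 < a by exact: lt_trans ha.
have m2 : m ^+ 2 = a by rewrite sqr_sqrtr // ltW.
have m1 : 1 < m by rewrite -(@ltr_pXn2r _ 2) ?nnegrE ?sqrtr_ge0 // m2 expr1n.
have rm : r = - (m * p).
  have := integral_xg m1; rewrite m2 X4 ooint_cst_mul ?P1 //; last 2 first.
  - by rewrite sqrtr_ge0.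
  - by move=> x _; exact: invsqrtf_ge0.
  by move=> -[e]; rewrite rE e pE.
have sm : s = m * (q - p).
  by rewrite qE pE sE; apply: (riemann_relation m1); rewrite m2.
have p0 : 0 < p by rewrite pE !divr_gt0.
have qp : 0 < q - p.
  by rewrite qE pE -!mulrBl addrAC subrr add0r !divr_gt0.
have m0 : 0 < m by exact: lt_trans m1.
have D0 : p * s - q * r != 0.
  have -> : p * s - q * r = m * p * ((q - p) + q) by rewrite sm rm; ring.
  by rewrite gt_eqF // !mulr_gt0 // addr_gt0 //; lra.
have NI := curve_nonisolated bih.
have [N Nu NE] := basis_change ha hol omegaZ NI (center_P0 hphi) (center_P1 hphi) basisP.
(* The periods of dz/w (first row) and z dz/w (second row). *)
pose A := mx22 (rc (2 * p) : cplx R) (rc (2 * q)) (rc (2 * r)) (rc (2 * s)).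
pose Cm := mx22 (iC R * rc (2 * (q - p))) (iC R * rc (2 * p))
  (iC R * rc (2 * (r - s))) (iC R * rc (- 2 * r)).
have AE : periods (A := curve_atlas a) basis (fun k => cycle_image phi (alpha L k)) = N *m A.
  apply/matrixP => j k; rewrite !mxE big_ord2 !mxE /cycle_integral.
  have n := NE j.
  case: (ord2P k) => -> /=; rewrite big_cons big_nil addr0 /= mul1r.
    rewrite (I1 _ _ _ n) mul1r J1E; congr (_ * rc _ + _); rewrite pE; field.
    by rewrite gt_eqF.
  rewrite (I2 _ _ _ n) mul1r; congr (_ * rc _ + _ * rc _); rewrite ?qE ?sE; field;
  by rewrite gt_eqF.
have CE : periods (A := curve_atlas a) basis (fun k => cycle_image phi (gamma L k)) = N *m Cm.
  apply/matrixP => j k; rewrite !mxE big_ord2 !mxE /cycle_integral.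
  have n := NE j.
  have kp : h / c = 2 * p by rewrite pE; field; rewrite gt_eqF.
  have kq : (h + l) / c = 2 * q by rewrite qE; field; rewrite gt_eqF.
  have J4E : h / c * J4 = - 2 * r by rewrite rE; field; rewrite gt_eqF.
  case: (ord2P k) => ->; rewrite /cycle_image /gamma /=.
    rewrite !big_cons big_nil /= (I3 _ _ _ n) (I4 _ _ _ n) J3E J4E kp kq.
    by rewrite mulN1r !(rcM, rcB, rcN); ring.
  by rewrite big_cons big_nil /= (I4 _ _ _ n) J4E kp; ring.
have Au : A \in unitmx.
  apply: mx22_unit; rewrite -!rcM -rcB rc_eq0.
  have -> : 2 * p * (2 * s) - 2 * q * (2 * r) = 4 * (p * s - q * r) by ring.
  by rewrite mulf_neq0.
split; first by rewrite AE unitmx_mul Nu Au.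
rewrite AE CE; set Pi := _ *: _.
have -> : Cm = A *m Pi.
  rewrite /A /Pi -scalemxAr mx22_mul; apply/matrixP => j k; rewrite !mxE.
  case: (ord2P j) => ->; case: (ord2P k) => -> /=;
    apply/esym/period_quotient => //; rewrite sm rm; ring.
rewrite mulmxA mulKmx //; by rewrite unitmx_mul Nu Au.
Qed.
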